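(* Let $\tau>0$ be fixed. For $0<k=|\mathbf{k}|<\sqrt{\pi/2}/\tau$ consider the exact hydrodynamics $\frac{d}{dt}\hat{\mathbf{h}}=\mathbf{H}\boldsymbol{\Lambda}\mathbf{H}^{-1}\hat{\mathbf{h}}$, $\boldsymbol{\Lambda}=\mathrm{diag}(\lambda_{\rm diff},\lambda_{\rm ac},\lambda_{\rm ac}^*,\lambda_{\rm shear},\lambda_{\rm shear})$, with $\mathbf{H}$ as in the context, and let $C_1,\dots,C_6$ be the entries defined by $$\mathbf{H}\boldsymbol{\Lambda}\mathbf{H}^{-1}=\tilde{\mathbf{Q}}_{\mathbf{k}}\begin{pmatrix}0&-\mathrm{i}k&0&0&0\\ C_1&C_2&0&0&C_3\\0&0&\lambda_{\rm shear}&0&0\\0&0&0&\lambda_{\rm shear}&0\\ C_4&C_5&0&0&C_6\end{pmatrix}\tilde{\mathbf{Q}}_{\mathbf{k}}^T .$$ Then, as $k\to0$, $$C_1=-\mathrm{i}k-\mathrm{i}\tfrac43\tau^2k^3+\mathcal{O}(k^5),\qquad C_2=-\tfrac43\tau k^2+\tfrac{16}{9}\tau^3k^4+\mathcal{O}(k^6),$$ $$C_3=-\sqrt{\tfrac23}\,\mathrm{i}k+\mathcal{O}(k^5),\qquad C_4=-\sqrt{\tfrac23}\,\tfrac{10}{3}\tau^3k^4+\mathcal{O}(k^6),$$ $$C_5=-\mathrm{i}\sqrt{\tfrac23}\,k-\mathrm{i}\tfrac13\sqrt{\tfrac23}\,\tau^2k^3+\mathcal{O}(k^5),\qquad C_6=-\tfrac53\tau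 k^2-\tfrac{16}{9}\tau^3k^4+\mathcal{O}(k^6).$$ Consequently, written in the variables $(\hat\rho,\hat{\mathbf{u}},\hat T)$, where $\hat{\mathbf{h}}=(\hat\rho,\hat{\mathbf{u}},\sqrt{3/2}\,\hat T)^T$, truncation of the exact hydrodynamics in powers of $k$ gives the following. (i) At first order in $k$, the Euler equations $$\frac{\partial}{\partial t}\begin{pmatrix}\hat\rho\\ \hat{\mathbf{u}}\\ \hat T\end{pmatrix}=\tilde{\mathbf{Q}}_{\mathbf{k}}\begin{pmatrix}0&-\mathrm{i}k&0&0&0\\-\mathrm{i}k&0&0&0&-\mathrm{i}k\\0&0&0&0&0\\0&0&0&0&0\\0&-\frac23\mathrm{i}k&0&0&0\end{pmatrix}\tilde{\mathbf{Q}}_{\mathbf{k}}^T\begin{pmatrix}\hat\rho\\ \hat{\mathbf{u}}\\ \hat T\end{pmatrix},$$ in physical space $\partial_t\rho=-\nabla\cdot\mathbf{u}$, $\partial_t\mathbf{u}=-\nabla(\rho+T)$, $\partial_tT=-\frac23\nabla\cdot\mathbf{u}$. (ii) At second order in $k$, the Navier--Stokes equations $$\frac{\partial}{\partial t}\begin{pmatrix}\hat\rho\\ \hat{\mathbf{u}}\\ \hat T\end{pmatrix}=\tilde{\mathbf{Q}}_{\mathbf{k}}\begin{pmatrix}0&-\mathrm{i}k&0&0&0\\-\mathrm{i}k&-\frac43\tau k^2&0&0&-\mathrm{i}k\\0&0&-\tau k^2&0&0\\0&0&0&-\tau k^2&0\\0&-\frac23\mathrm{i}k&0&0&-\frac53\tau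 k^2\end{pmatrix}\tilde{\mathbf{Q}}_{\mathbf{k}}^T\begin{pmatrix}\hat\rho\\ \hat{\mathbf{u}}\\ \hat T\end{pmatrix},$$ in physical space $\partial_t\rho=-\nabla\cdot\mathbf{u}$, $\partial_t\mathbf{u}=-\nabla(\rho+T)+\tau\Delta\mathbf{u}+\frac\tau3\nabla(\nabla\cdot\mathbf{u})$, $\partial_tT=-\frac23\nabla\cdot\mathbf{u}+\frac53\tau\Delta T$. (iii) At third order in $k$, the Burnett equations $$\frac{\partial}{\partial t}\begin{pmatrix}\hat\rho\\ \hat{\mathbf{u}}\\ \hat T\end{pmatrix}=\tilde{\mathbf{Q}}_{\mathbf{k}}\begin{pmatrix}0&-\mathrm{i}k&0&0&0\\-\mathrm{i}k-\frac43\mathrm{i}\tau^2k^3&-\frac43\tau k^2&0&0&-\mathrm{i}k\\0&0&-\tau k^2&0&0\\0&0&0&-\tau k^2&0\\0&-\frac23\mathrm{i}k-\frac29\mathrm{i}\tau^2k^3&0&0&-\frac53\tau k^2\end{pmatrix}\tilde{\mathbf{Q}}_{\mathbf{k}}^T\begin{pmatrix}\hat\rho\\ \hat{\mathbf{u}}\\ \hat T\end{pmatrix},$$ in physical space $\partial_t\rho=-\nabla\cdot\mathbf{u}$, $\partial_t\mathbf{u}=-\nabla(\rho+T)+\frac43\tau^2\nabla\Delta\rho+\tau\Delta\mathbf{u}+\frac\tau3\nabla(\nabla\cdot\mathbf{u})$, $\partial_tT=-\frac23\nabla\cdot\mathbf{u}+\frac29\tau^2\Delta\nabla\cdot\mathbf{u}+\frac53\tau\Delta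 T$.
   Context: Let $\mathcal{H}_{\mathbf{v}}=L^2(\mathbb{R}^3,(2\pi)^{-3/2}e^{-|\mathbf{v}|^2/2}d\mathbf{v})$ (complex-valued functions), with inner product $\langle f,g\rangle_{\mathbf{v}}=(2\pi)^{-3/2}\int_{\mathbb{R}^3}f(\mathbf{v})g^*(\mathbf{v})e^{-|\mathbf{v}|^2/2}\,d\mathbf{v}$, where $*$ denotes complex conjugation. The functions $e_0=1$, $e_j=v_j$ ($j=1,2,3$), $e_4=(|\mathbf{v}|^2-3)/\sqrt6$ are orthonormal, and $\mathbb{P}_5f=\sum_{j=0}^4\langle f,e_j\rangle_{\mathbf{v}}e_j$. For wave vector $\mathbf{k}$, $k=|\mathbf{k}|$, and relaxation time $\tau>0$, $\mathcal{L}_{\mathbf{k}}=-\mathrm{i}\,\mathbf{v}\cdot\mathbf{k}-\tfrac1\tau(1-\mathbb{P}_5)$ on $\mathcal{H}_{\mathbf{v}}$ with its natural (maximal) domain. Known spectral facts (prior work, taken as given): for $0<k<\sqrt{\pi/2}/\tau$, the eigenvalues of $\mathcal{L}_{\mathbf{k}}$ off the essential spectrum $\{\Re\lambda=-1/\tau\}$ all lie in $-1/\tau<\Re\lambda<0$ and are exactly: a real eigenvalue $\lambda_{\rm diff}$ and a non-real conjugate pair $\lambda_{\rm ac},\lambda_{\rm ac}^*$ ($\Im\lambda_{\rm ac}>0$), all of algebraic multiplicity one, and a real eigenvalue $\lambda_{\rm shear}$ of algebraic and geometric multiplicity two. They depend only on $k$ and $\tau$, and as $k\to0$, $$\lambda_{\rm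 diff}=-\tau k^2+\tfrac95\tau^3k^4+\mathcal{O}(k^6),\quad \lambda_{\rm shear}=-\tau k^2+\tau^3k^4+\mathcal{O}(k^6),$$ $$\lambda_{\rm ac}=\mathrm{i}\sqrt{\tfrac53}\,k-\tau k^2+\mathrm{i}\tfrac{7\tau^2}{6\sqrt{15}}k^3+\tfrac{62}{45}\tau^3k^4+\mathcal{O}(k^5).$$ $\mathbf{Q}_{\mathbf{k}}$ is a $3\times3$ rotation matrix with $\mathbf{Q}_{\mathbf{k}}(k,0,0)^T=\mathbf{k}$, and $\tilde{\mathbf{Q}}_{\mathbf{k}}=\mathrm{diag}(1,\mathbf{Q}_{\mathbf{k}},1)$ ($5\times5$ block-diagonal). The plasma dispersion function is $Z(\zeta)=\frac1{\sqrt{2\pi}}\int_{\mathbb{R}}\frac{e^{-v^2/2}}{v-\zeta}\,dv$, $\zeta\in\mathbb{C}\setminus\mathbb{R}$, and the spectral temperature is $$\theta(\lambda)=\frac{\sqrt{6}\left(\big(k^2\tau^2-\tau\lambda(\tau\lambda+1)\big)\,Z\!\left(\frac{\mathrm{i}(\tau\lambda+1)}{k\tau}\right)-\mathrm{i}k\tau\,(k^2\tau^2-\tau\lambda)\right)}{\big(k^2\tau^2+(\tau\lambda+1)^2\big)\,Z\!\left(\frac{\mathrm{i}(\tau\lambda+1)}{k\tau}\right)-\mathrm{i}k\tau(\tau\lambda+1)} .$$ The (invertible) matrix of spectral basis vectors is $$\mathbf{H}=\tilde{\mathbf{Q}}_{\mathbf{k}}\begin{pmatrix}1&1&1&0&0\\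 \frac{\mathrm{i}}{k}\lambda_{\rm diff}&\frac{\mathrm{i}}{k}\lambda_{\rm ac}&\frac{\mathrm{i}}{k}\lambda_{\rm ac}^*&0&0\\0&0&0&1&0\\0&0&0&0&1\\ \theta(\lambda_{\rm diff})&\theta(\lambda_{\rm ac})&\theta(\lambda_{\rm ac}^* )&0&0\end{pmatrix}.$$ Its columns are the vectors $(\langle f,e_0\rangle_{\mathbf{v}},\dots,\langle f,e_4\rangle_{\mathbf{v}})^T$ of moments of suitably normalized eigenfunctions $f$ of $\mathcal{L}_{\mathbf{k}}$ for the listed eigenvalues. The macroscopic variables are $\hat\rho=\langle\hat f,e_0\rangle_{\mathbf{v}}$, $\hat{\mathbf{u}}=\langle\hat f,(e_1,e_2,e_3)\rangle_{\mathbf{v}}$, $\hat T=\sqrt{2/3}\,\langle\hat f,e_4\rangle_{\mathbf{v}}$; physical-space equations are obtained by summing Fourier series in $\mathbf{x}$ with modes $e^{\mathrm{i}\mathbf{k}\cdot\mathbf{x}}$.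
   Formalization: The k^4 coefficients of C_4 and C_6 are corrected to C_4 = -sqrt(2/3) τ^3k^4 + O(k^6) and C_6 = -(5/3)τk^2 + (25/9)τ^3k^4 + O(k^6); the printed ones contradict C_2+C_6 = λ_diff+λ_ac+λ_ac^*, whose k^4 coefficient is (41/9)τ^3. *)

(* Defs.v *)
From HB Require Import structures.
From mathcomp Require Import all_boot all_order all_algebra.
From mathcomp Require Export complex.
From mathcomp Require Import all_classical all_reals all_analysis.
Set Implicit Arguments.
Unset Strict Implicit.
Unset Printing Implicit Defensive.
Import Order.TTheory GRing.Theory Num.Theory.
Import numFieldNormedType.Exports.
Import ComplexField.

Local Open Scope classical_set_scope.
Local Open Scope ring_scope.
Local Open Scope complex_scope.

Local Notation cRe := complex.Re.
Local Notation cIm := complex.Im.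

(* The library integrates and differentiates real-valued functions; complex
   values are handled through real and imaginary parts. *)
Definition Cintegral (d : measure_display) (T : measurableType d) (R : realType)
    (mu : {measure set T -> \bar R}) (f : T -> R[i]) : R[i] :=
  (\int[mu]_x cRe (f x)) +i* (\int[mu]_x cIm (f x)).

Definition Cseries (R : realType) (u : nat -> R[i]) : R[i] :=
  limn (series (fun n => cRe (u n))) +i* limn (series (fun n => cIm (u n))).

Definition Cderivable (R : realType) (V : normedModType R)
    (f : V -> R[i]) (a v : V) : Prop :=
  derivable (fun x => cRe (f x)) a v /\ derivable (fun x => cIm (f x)) a v.

Definition Cderive (R : realType) (V : normedModType R)
    (f : V -> R[i]) (a v : V) : R[i] :=
  'D_v (fun x => cRe (f x)) a +i* 'D_v (fun x => cIm (f x)) a.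

Definition expi (R : realType) (y : R) : R[i] := cos y +i* sin y.

Definition bigO_at0 (R : realType) (n : nat) (f : R -> R[i]) : Prop :=
  exists M : R, \forall k \near 0^'+, Normc.normc (f k) <= M * k ^+ n.

Notation Vel R :=
  (measurableTypeR R * measurableTypeR R * measurableTypeR R)%type.

Definition vel_coord (R : realType) (j : 'I_3) (v : Vel R) : R :=
  if val j == 0%N then v.1.1 else if val j == 1%N then v.1.2 else v.2.

Definition vel_measure (R : realType) : {measure set (Vel R) -> \bar R} :=
  ((@lebesgue_measure R \x @lebesgue_measure R) \x @lebesgue_measure R)%E.

Definition vel_sqr (R : realType) (v : Vel R) : R :=
  \sum_(j < 3) vel_coord j v ^+ 2.

Definition gauss (R : realType) (v : Vel R) : R :=
  (2 * pi) `^ (- (3 / 2)) * expR (- vel_sqr v / 2).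

(* Elements of H_v are represented by functions, to be identified when they
   agree almost everywhere (for Lebesgue, or equivalently Gaussian, measure). *)
Definition ae_equal (R : realType) (f g : Vel R -> R[i]) : Prop :=
  {ae @vel_measure R, forall v, f v = g v}.

Definition in_Hv (R : realType) (f : Vel R -> R[i]) : Prop :=
  [/\ measurable_fun [set: Vel R] (fun v => cRe (f v)),
      measurable_fun [set: Vel R] (fun v => cIm (f v)) &
      (\int[@vel_measure R]_v (Normc.normc (f v) ^+ 2 * gauss v)%:E < +oo)%E].

Definition ip (R : realType) (f g : Vel R -> R[i]) : R[i] :=
  Cintegral (@vel_measure R) (fun v => f v * (g v)^* * (gauss v)%:C).

Definition i_rho : 'I_5 := lshift 4 (ord0 : 'I_1).
Definition i_u (j : 'I_3) : 'I_5 := rshift 1 (lshift 1 j : 'I_4).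
Definition i_T : 'I_5 := rshift 1 (rshift 3 (ord0 : 'I_1) : 'I_4).

Definition basis_e (R : realType) (i : 'I_5) (v : Vel R) : R[i] :=
  (match fintype.split (i : 'I_(1 + (3 + 1))) with
   | inl _ => 1
   | inr i' => match fintype.split i' with
               | inl j => vel_coord j v
               | inr _ => (vel_sqr v - 3) / Num.sqrt 6
               end
   end)%:C.

Definition P5 (R : realType) (f : Vel R -> R[i]) (v : Vel R) : R[i] :=
  \sum_(i < 5) ip f (@basis_e R i) * basis_e i v.

(* Euclidean norm (the norm of the library on matrices is the max norm). *)
Definition enorm (R : realType) (x : 'cV[R]_3) : R :=
  Num.sqrt (\sum_(j < 3) x j 0 ^+ 2).

Definition vel_dot (R : realType) (v : Vel R) (kk : 'cV[R]_3) : R :=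
  \sum_(j < 3) vel_coord j v * kk j 0.

Definition Lk (R : realType) (tau : R) (kk : 'cV[R]_3)
    (f : Vel R -> R[i]) (v : Vel R) : R[i] :=
  - 'i * (vel_dot v kk)%:C * f v - (tau^-1)%:C * (f v - P5 f v).

(* Maximal domain: as P5 is bounded, L_k f lies in H_v iff (v.k) f does. *)
Definition in_dom (R : realType) (kk : 'cV[R]_3) (f : Vel R -> R[i]) : Prop :=
  in_Hv f /\ in_Hv (fun v => (vel_dot v kk)%:C * f v).

Definition is_eigenfunction (R : realType) (tau : R) (kk : 'cV[R]_3)
    (lam : R[i]) (f : Vel R -> R[i]) : Prop :=
  [/\ in_dom kk f, ~ ae_equal f (fun=> 0) &
      ae_equal (Lk tau kk f) (fun v => lam * f v)].

Definition is_eigenvalue (R : realType) (tau : R) (kk : 'cV[R]_3)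
    (lam : R[i]) : Prop :=
  exists f, is_eigenfunction tau kk lam f.

Fixpoint in_ker_pow (R : realType) (tau : R) (kk : 'cV[R]_3) (lam : R[i])
    (n : nat) (f : Vel R -> R[i]) : Prop :=
  if n is n'.+1 then
    in_dom kk f /\
    in_ker_pow tau kk lam n' (fun v => Lk tau kk f v - lam * f v)
  else ae_equal f (fun=> 0).

(* S is, modulo equality a.e., a vector space of dimension d *)
Definition has_dim (R : realType) (S : (Vel R -> R[i]) -> Prop) (d : nat) :
    Prop :=
  exists b : 'I_d -> Vel R -> R[i],
    [/\ forall i, S (b i),
        forall c : 'I_d -> R[i],
          ae_equal (fun v => \sum_(i < d) c i * b i v) (fun=> 0) ->
          forall i, c i = 0 &
        forall f, S f -> exists c : 'I_d -> R[i],
          ae_equal f (fun v => \sum_(i < d) c i * b i v)].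

Definition geometric_mult (R : realType) (tau : R) (kk : 'cV[R]_3)
    (lam : R[i]) (d : nat) : Prop :=
  has_dim (in_ker_pow tau kk lam 1) d.

Definition algebraic_mult (R : realType) (tau : R) (kk : 'cV[R]_3)
    (lam : R[i]) (d : nat) : Prop :=
  has_dim (fun f => exists n : nat, in_ker_pow tau kk lam n.+1 f) d.

Definition admissible (R : realType) (tau : R) (kk : 'cV[R]_3) : Prop :=
  0 < enorm kk < Num.sqrt (pi / 2) / tau.

(* The discrete spectrum of L_k; the branches depend on |k| only. *)
Definition spectrum_spec (R : realType) (tau : R)
    (lam_diff lam_shear : R -> R) (lam_ac : R -> R[i]) : Prop :=
  forall kk : 'cV[R]_3, admissible tau kk ->
  let k := enorm kk in
  [/\ forall lam, is_eigenvalue tau kk lam -> cRe lam != - tau^-1 ->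
        - tau^-1 < cRe lam < 0,
      forall lam, is_eigenvalue tau kk lam /\ cRe lam != - tau^-1 <->
        lam \in [:: (lam_diff k)%:C; lam_ac k; (lam_ac k)^*;
                    (lam_shear k)%:C],
      0 < cIm (lam_ac k),
      [/\ algebraic_mult tau kk (lam_diff k)%:C 1,
          algebraic_mult tau kk (lam_ac k) 1 &
          algebraic_mult tau kk (lam_ac k)^* 1] &
      algebraic_mult tau kk (lam_shear k)%:C 2 /\
      geometric_mult tau kk (lam_shear k)%:C 2].

Definition lam_expansions (R : realType) (tau : R)
    (lam_diff lam_shear : R -> R) (lam_ac : R -> R[i]) : Prop :=
  [/\ bigO_at0 6 (fun k => (lam_diff k)%:C -
        (- tau * k ^+ 2 + 9 / 5 * tau ^+ 3 * k ^+ 4)%:C),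
      bigO_at0 6 (fun k => (lam_shear k)%:C -
        (- tau * k ^+ 2 + tau ^+ 3 * k ^+ 4)%:C) &
      bigO_at0 5 (fun k => lam_ac k -
        ('i * (Num.sqrt (5 / 3) * k)%:C - (tau * k ^+ 2)%:C
         + 'i * (7 * tau ^+ 2 / (6 * Num.sqrt 15) * k ^+ 3)%:C
         + (62 / 45 * tau ^+ 3 * k ^+ 4)%:C))].

Definition Zplasma (R : realType) (zeta : R[i]) : R[i] :=
  ((Num.sqrt (2 * pi))^-1)%:C *
  Cintegral (@lebesgue_measure R)
    (fun v : measurableTypeR R =>
       (expR (- (v : R) ^+ 2 / 2))%:C / ((v : R)%:C - zeta)).

Definition theta (R : realType) (tau k : R) (lam : R[i]) : R[i] :=
  let kt : R[i] := (k * tau)%:C in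
  let tl : R[i] := tau%:C * lam in
  let Z := Zplasma ('i * (tl + 1) / kt) in
  (Num.sqrt 6)%:C * ((kt ^+ 2 - tl * (tl + 1)) * Z - 'i * kt * (kt ^+ 2 - tl))
  / ((kt ^+ 2 + (tl + 1) ^+ 2) * Z - 'i * kt * (tl + 1)).

Definition mx_of_rows (R : realType) (rows : seq (seq R[i])) : 'M[R[i]]_5 :=
  \matrix_(i, j) nth 0 (nth [::] rows i) j.

Definition is_rotation (R : realType) (Q : 'M[R]_3) : Prop :=
  Q *m Q^T = 1%:M /\ \det Q = 1.

(* For k = 0 the second condition is void. *)
Definition wave_rotation (R : realType) (Q : 'cV[R]_3 -> 'M[R]_3) : Prop :=
  forall kk, is_rotation (Q kk) /\ Q kk *m (enorm kk *: delta_mx 0 0) = kk.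

Definition Qtilde (R : realType) (Q : 'M[R]_3) : 'M[R[i]]_5 :=
  map_mx (fun x : R => x%:C)
    (block_mx 1%:M 0 0 (block_mx Q 0 0 1%:M) : 'M[R]_(1 + (3 + 1))).

Definition Hmx (R : realType) (tau : R) (lam_diff : R -> R)
    (lam_ac : R -> R[i]) (Q : 'cV[R]_3 -> 'M[R]_3) (kk : 'cV[R]_3) :
    'M[R[i]]_5 :=
  let k := enorm kk in
  let ld := (lam_diff k)%:C in
  let la := lam_ac k in
  let ik := 'i / k%:C in
  Qtilde (Q kk) *m mx_of_rows
   [:: [:: 1;                1;                1;                   0; 0];
       [:: ik * ld;          ik * la;          ik * la^*;           0; 0];
       [:: 0;                0;                0;                   1; 0];
       [:: 0;                0;                0;                   0; 1];
       [:: theta tau k ld;   theta tau k la;   theta tau k la^*;    0; 0]].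

Definition lam_seq (R : realType) (lam_diff lam_shear : R -> R)
    (lam_ac : R -> R[i]) (k : R) : seq R[i] :=
  [:: (lam_diff k)%:C; lam_ac k; (lam_ac k)^*;
      (lam_shear k)%:C; (lam_shear k)%:C].

Definition Lambda (R : realType) (lam_diff lam_shear : R -> R)
    (lam_ac : R -> R[i]) (k : R) : 'M[R[i]]_5 :=
  diag_mx (\row_(j < 5) (lam_seq lam_diff lam_shear lam_ac k)`_j).

Definition spectral_basis_spec (R : realType) (tau : R)
    (lam_diff lam_shear : R -> R) (lam_ac : R -> R[i])
    (Q : 'cV[R]_3 -> 'M[R]_3) : Prop :=
  forall kk : 'cV[R]_3, admissible tau kk ->
  let H := Hmx tau lam_diff lam_ac Q kk in
  H \in unitmx /\
  forall j : 'I_5, exists2 f : Vel R -> R[i],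
    is_eigenfunction tau kk
      (lam_seq lam_diff lam_shear lam_ac (enorm kk))`_j f &
    forall i : 'I_5, ip f (@basis_e R i) = H i j.

Definition exact_gen (R : realType) (tau : R)
    (lam_diff lam_shear : R -> R) (lam_ac : R -> R[i])
    (Q : 'cV[R]_3 -> 'M[R]_3) (kk : 'cV[R]_3) : 'M[R[i]]_5 :=
  let H := Hmx tau lam_diff lam_ac Q kk in
  H *m Lambda lam_diff lam_shear lam_ac (enorm kk) *m invmx H.

(* The block form of Qtilde_k^T (H Lambda H^-1) Qtilde_k. *)
Definition hydro_mx (R : realType) (k : R) (C1 C2 C3 C4 C5 C6 lam_sh : R[i]) :
    'M[R[i]]_5 :=
  mx_of_rows
   [:: [:: 0;   - ('i * k%:C);  0;       0;       0];
       [:: C1;  C2;             0;       0;       C3];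
       [:: 0;   0;              lam_sh;  0;       0];
       [:: 0;   0;              0;       lam_sh;  0];
       [:: C4;  C5;             0;       0;       C6]].

(* The k^4 terms of C4 and C6 are the ones compatible with the spectrum.
   Trace and determinant of the (rho, u_1, T) block force
     C2 + C6 = lam_diff + 2 Re lam_ac = - 3 tau k^2 + 41/9 tau^3 k^4 + O(k^5),
     i k (C1 C6 - C3 C4) = lam_diff |lam_ac|^2
                         = - 5/3 tau k^4 + 11/9 tau^3 k^6 + O(k^7).
   The coefficients -10/3 sqrt(2/3) of C4 and -16/9 of C6 found in print
   violate both: they result from dropping the k^4 terms of lam_diff and
   lam_ac. *)
Definition coef_expansions (R : realType) (tau : R)
    (C1 C2 C3 C4 C5 C6 : R -> R[i]) : Prop :=
  let s := Num.sqrt (2 / 3) : R in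
  [/\ bigO_at0 5 (fun k => C1 k -
        (- ('i * k%:C) - 'i * (4 / 3 * tau ^+ 2 * k ^+ 3)%:C)),
      bigO_at0 6 (fun k => C2 k -
        (- (4 / 3) * tau * k ^+ 2 + 16 / 9 * tau ^+ 3 * k ^+ 4)%:C) &
      bigO_at0 5 (fun k => C3 k - (- ('i * (s * k)%:C)))] /\
  [/\ bigO_at0 6 (fun k => C4 k - (- s * tau ^+ 3 * k ^+ 4)%:C),
      bigO_at0 5 (fun k => C5 k -
        (- ('i * (s * k)%:C) - 'i * (1 / 3 * s * tau ^+ 2 * k ^+ 3)%:C)) &
      bigO_at0 6 (fun k => C6 k -
        (- (5 / 3) * tau * k ^+ 2 + 25 / 9 * tau ^+ 3 * k ^+ 4)%:C)].

(* h = Dmacro (rho, u, T)^T *)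
Definition Dmacro (R : realType) : 'M[R[i]]_5 :=
  diag_mx (\row_(j < 5) [:: 1; 1; 1; 1; (Num.sqrt (3 / 2))%:C]`_j).

Definition macro_gen (R : realType) (tau : R)
    (lam_diff lam_shear : R -> R) (lam_ac : R -> R[i])
    (Q : 'cV[R]_3 -> 'M[R]_3) (kk : 'cV[R]_3) : 'M[R[i]]_5 :=
  invmx (Dmacro R) *m exact_gen tau lam_diff lam_shear lam_ac Q kk
  *m Dmacro R.

Definition solves (R : realType) (I : set R) (A : 'M[R[i]]_5)
    (h : R -> 'cV[R[i]]_5) : Prop :=
  forall t, I t -> forall j : 'I_5,
    Cderivable (fun s : R => h s j 0) t 1 /\
    Cderive (fun s : R => h s j 0) t 1 = (A *m h t) j 0.

(* Qtilde_k T(|k|) Qtilde_k^T is the truncation of G(k) at order n in |k|: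
   the entries of T are polynomials of degree at most n in |k| and
   Qtilde_k^T G(k) Qtilde_k = T(|k|) + O(|k|^(n+1)). *)
Definition truncation (R : realType) (Q : 'cV[R]_3 -> 'M[R]_3) (n : nat)
    (G : 'cV[R]_3 -> 'M[R[i]]_5) (T : R -> 'M[R[i]]_5) : Prop :=
  (exists2 P : 'M[{poly R[i]}]_5,
     forall i j, (size (P i j) <= n.+1)%N &
     forall (k : R) i j, T k i j = (P i j).[k%:C]) /\
  exists M d : R, 0 < d /\
    forall kk, 0 < enorm kk < d -> forall i j,
      Normc.normc (((Qtilde (Q kk))^T *m G kk *m Qtilde (Q kk)
                    - T (enorm kk)) i j) <= M * enorm kk ^+ n.+1.

Definition euler_mx (R : realType) (k : R) : 'M[R[i]]_5 :=
  let ik := 'i * k%:C in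
  mx_of_rows
   [:: [:: 0;     - ik;                 0; 0; 0];
       [:: - ik;  0;                    0; 0; - ik];
       [:: 0;     0;                    0; 0; 0];
       [:: 0;     0;                    0; 0; 0];
       [:: 0;     - ((2 / 3)%:C * ik);  0; 0; 0]].

Definition navier_stokes_mx (R : realType) (tau k : R) : 'M[R[i]]_5 :=
  let ik := 'i * k%:C in
  let tk2 := tau * k ^+ 2 in
  mx_of_rows
   [:: [:: 0;     - ik;                 0;          0;          0];
       [:: - ik;  - (4 / 3 * tk2)%:C;   0;          0;          - ik];
       [:: 0;     0;                    - tk2%:C;   0;          0];
       [:: 0;     0;                    0;          - tk2%:C;   0];
       [:: 0;     - ((2 / 3)%:C * ik);  0;          0;
           - (5 / 3 * tk2)%:C]].

Definition burnett_mx (R : realType) (tau k : R) : 'M[R[i]]_5 :=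
  let ik := 'i * k%:C in
  let tk2 := tau * k ^+ 2 in
  let it2k3 := 'i * (tau ^+ 2 * k ^+ 3)%:C in
  mx_of_rows
   [:: [:: 0;     - ik;                 0;          0;          0];
       [:: - ik - (4 / 3)%:C * it2k3;
                  - (4 / 3 * tk2)%:C;   0;          0;          - ik];
       [:: 0;     0;                    - tk2%:C;   0;          0];
       [:: 0;     0;                    0;          - tk2%:C;   0];
       [:: 0;     - ((2 / 3)%:C * ik) - (2 / 9)%:C * it2k3;
                                        0;          0;
           - (5 / 3 * tk2)%:C]].

Section Physical.
Variable R : realType.
Implicit Types (g : 'cV[R]_3 -> R[i]) (w : 'I_3 -> 'cV[R]_3 -> R[i]).

Definition pd (j : 'I_3) g (x : 'cV[R]_3) : R[i] :=
  Cderive g x (delta_mx j 0).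
Definition divg w x : R[i] := \sum_(j < 3) pd j (w j) x.
Definition lapl g x : R[i] := \sum_(j < 3) pd j (pd j g) x.
Definition dt (F : R -> 'cV[R]_3 -> R[i]) (t : R) (x : 'cV[R]_3) : R[i] :=
  Cderive (fun s : R => F s x) t 1.

Fixpoint partially_diff (m : nat) g : Prop :=
  if m is m'.+1 then
    forall j, (forall x, Cderivable g x (delta_mx j 0)) /\
              partially_diff m' (pd j g)
  else True.

Definition pde_type : Type :=
  (R -> 'cV[R]_3 -> R[i]) -> ('I_3 -> R -> 'cV[R]_3 -> R[i]) ->
  (R -> 'cV[R]_3 -> R[i]) -> R -> 'cV[R]_3 -> Prop.

Definition euler_pde : pde_type := fun rho u T t x =>
  [/\ dt rho t x = - divg (fun j => u j t) x,
      forall j, dt (u j) t x = - pd j (fun y => rho t y + T t y) x &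
      dt T t x = - ((2 / 3)%:C * divg (fun j => u j t) x)].

Definition navier_stokes_pde (tau : R) : pde_type := fun rho u T t x =>
  [/\ dt rho t x = - divg (fun j => u j t) x,
      forall j, dt (u j) t x =
        - pd j (fun y => rho t y + T t y) x
        + tau%:C * lapl (u j t) x
        + (tau / 3)%:C * pd j (divg (fun i => u i t)) x &
      dt T t x = - ((2 / 3)%:C * divg (fun j => u j t) x)
        + (5 / 3 * tau)%:C * lapl (T t) x].

Definition burnett_pde (tau : R) : pde_type := fun rho u T t x =>
  [/\ dt rho t x = - divg (fun j => u j t) x,
      forall j, dt (u j) t x =
        - pd j (fun y => rho t y + T t y) x
        + (4 / 3 * tau ^+ 2)%:C * pd j (lapl (rho t)) x
        + tau%:C * lapl (u j t) x
        + (tau / 3)%:C * pd j (divg (fun i => u i t)) x &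
      dt T t x = - ((2 / 3)%:C * divg (fun j => u j t) x)
        + (2 / 9 * tau ^+ 2)%:C * lapl (divg (fun j => u j t)) x
        + (5 / 3 * tau)%:C * lapl (T t) x].

Definition fourier_sum (kk : nat -> 'cV[R]_3)
    (a : nat -> R -> 'cV[R[i]]_5) (j : 'I_5) (t : R) (x : 'cV[R]_3) : R[i] :=
  Cseries (fun n => a n t j 0 * expi (\sum_(l < 3) kk n l 0 * x l 0)).

(* the series obtained from fourier_sum by at most m term-by-term space
   derivatives converge normally, locally uniformly in time *)
Definition normal_cvg (I : set R) (m : nat) (kk : nat -> 'cV[R]_3)
    (a : nat -> R -> 'cV[R[i]]_5) : Prop :=
  forall t, I t -> exists2 B : nat -> R, cvgn (series B) &
    \forall s \near t, forall (n : nat) (j : 'I_5),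
      (1 + enorm (kk n)) ^+ m * Normc.normc (a n s j 0) <= B n.

(* Summing Fourier modes k_n (any sequence of wave vectors, such as an
   enumeration of a lattice) whose amplitudes obey
   a' = Qtilde_k T(|k|) Qtilde_k^T a gives fields obeying the order-m pde. *)
Definition physical_form (Q : 'cV[R]_3 -> 'M[R]_3) (T : R -> 'M[R[i]]_5)
    (m : nat) (pde : pde_type) : Prop :=
  forall (I : set R) (kk : nat -> 'cV[R]_3) (a : nat -> R -> 'cV[R[i]]_5),
    open I ->
    (forall n, solves I (Qtilde (Q (kk n)) *m T (enorm (kk n))
                         *m (Qtilde (Q (kk n)))^T) (a n)) ->
    normal_cvg I m kk a ->
    let F := fourier_sum kk a in
    forall t, I t ->
      (forall j, partially_diff m (F j t)) /\
      forall x, (forall j, Cderivable (fun s : R => F j s x) t 1) /\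
                pde (F i_rho) (fun j => F (i_u j)) (F i_T) t x.

End Physical.

(* Main.v *)
From HB Require Import structures.
Require Import Defs.
From mathcomp Require Import all_boot all_order all_algebra complex ring lra.
From mathcomp Require Import all_classical all_reals all_analysis measurable_realfun.
Import Order.TTheory GRing.Theory Num.Theory.
Import numFieldNormedType.Exports.

Set Implicit Arguments.
Unset Strict Implicit.
Unset Printing Implicit Defensive.

Local Open Scope classical_set_scope.
Local Open Scope ring_scope.
Local Open Scope complex_scope.

Local Notation cRe := complex.Re.
Local Notation cIm := complex.Im.
Local Notation normc := Normc.normc.

(** An eigenfunction [f] for the wave vector $k e_1$ is the polynomial $P_5f$ divided
    by $1+\tau\lambda+\mathrm ik\tau v_1$, so it is known from its density, velocity
    and temperature, and these are the entries of a column of $\mathbf H$. With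
    $X=\tau k$, $\tilde u=\lambda/k$ and $z=\mathrm iv_1$, the moments of
    $f(1+X(\tilde u+z))=P_5f$ give the balance of momentum and energy
    ([eigen_conservation]), in which the stress and the heat flux of [f] are Gaussian
    expectations of polynomials times $(1+X(\tilde u+z))^{-1}$. For small [k] this
    factor is expanded in a Neumann series whose remainder is controlled by Gaussian
    moments ([deviator_expansion], [remainder_le]).

    Every term of the series is linear in the moments $(1,\tilde u,T)$ with a power of
    $\tilde u$ as a factor, and on a mode this power is a power of the matrix [B] that
    closes the equations for density, velocity and temperature. The three slow modes
    have independent limits: $\tilde u$ tends to $0$ and to $\pm\mathrm i\sqrt{5/3}$,
    and the leading momentum balance forces $T\to-1-\tilde u^2$ ([mode_temperature]).
    Hence an equation between rows that holds on the three modes holds for the rows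
    ([three_modes]), and [B] is a fixed point, up to $O(k^5)$, of the Chapman-Enskog
    map [neumann4]. In that map [B] comes with a factor $X^2$, so the agreement of [B]
    with an explicit polynomial solution improves from $O(1)$ to $O(k^2)$ and to
    $O(k^4)$, and once more in the entries that require it ([closure_expansion]).
    Multiplying by powers of [k] gives the coefficients of the generator
    ([coefs_expansion]) and its truncations ([truncations]).

    For the equations in physical space, normal convergence allows termwise
    differentiation ([is_derive_series0]), so that derivatives act on Fourier sums as
    multipliers. The three truncated generators are instances of one matrix
    [fluid_mx], whose rotated form ([fluid_mx_rotated]) has as its entries the
    multipliers of the equations ([physical_fluid]). *)

(** * Norm of complex numbers *)

Section ComplexNorm.
Variable R : realType.
Implicit Types x y : R[i].

Lemma normcE x : (normc x)%:C = `|x|.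
Proof. by []. Qed.

Lemma normc0 : normc (0 : R[i]) = 0.
Proof. by apply: complexI; rewrite normcE normr0. Qed.

Lemma normc1 : normc (1 : R[i]) = 1.
Proof. by apply: complexI; rewrite normcE normr1. Qed.

Lemma normcD x y : normc (x + y) <= normc x + normc y.
Proof. by rewrite -lecR rmorphD /= !normcE ler_normD. Qed.

Lemma normcM x y : normc (x * y) = normc x * normc y.
Proof. by apply: complexI; rewrite rmorphM /= !normcE normrM. Qed.

Lemma normcN x : normc (- x) = normc x.
Proof. by apply: complexI; rewrite !normcE normrN. Qed.

Lemma normcX x n : normc (x ^+ n) = normc x ^+ n.
Proof. by apply: complexI; rewrite rmorphXn /= !normcE normrX. Qed.

Lemma normcV x : normc x^-1 = (normc x)^-1.
Proof. by apply: complexI; rewrite fmorphV /= !normcE normfV. Qed.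

Lemma normc_ge0 x : 0 <= normc x.
Proof. by rewrite -lecR normcE normr_ge0. Qed.

Lemma normc_real (a : R) : normc a%:C = `|a|.
Proof. by rewrite /= expr0n addr0 sqrtr_sqr. Qed.

Lemma normc_i : normc ('i : R[i]) = 1.
Proof. by rewrite /= expr0n add0r expr1n sqrtr1. Qed.

Lemma normc_conj x : normc x^* = normc x.
Proof. by case: x => a b; rewrite /= sqrrN. Qed.

Lemma normc_le x : normc x <= `|cRe x| + `|cIm x|.
Proof.
case: x => a b /=; rewrite -ler_sqr ?nnegrE ?sqrtr_ge0 ?addr_ge0 //.
rewrite sqr_sqrtr ?addr_ge0 ?sqr_ge0 // sqrrD !real_normK ?num_real //.
by rewrite lerD2r lerDl mulrn_wge0 // mulr_ge0.
Qed.

Lemma Re_le_normc x : `|cRe x| <= normc x.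
Proof.
case: x => a b /=; rewrite -ler_sqr ?nnegrE ?sqrtr_ge0 //.
by rewrite sqr_sqrtr ?addr_ge0 ?sqr_ge0 // real_normK ?num_real // lerDl sqr_ge0.
Qed.

Lemma Im_le_normc x : `|cIm x| <= normc x.
Proof.
case: x => a b /=; rewrite -ler_sqr ?nnegrE ?sqrtr_ge0 //.
by rewrite sqr_sqrtr ?addr_ge0 ?sqr_ge0 // real_normK ?num_real // lerDr sqr_ge0.
Qed.

Lemma Re_mul x y : cRe (x * y) = cRe x * cRe y - cIm x * cIm y.
Proof. by case: x y => [a b] [c d]. Qed.

Lemma Im_mul x y : cIm (x * y) = cRe x * cIm y + cIm x * cRe y.
Proof. by case: x y => [a b] [c d]. Qed.

Lemma Re_add x y : cRe (x + y) = cRe x + cRe y.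
Proof. by case: x y => [a b] [c d]. Qed.

Lemma Im_add x y : cIm (x + y) = cIm x + cIm y.
Proof. by case: x y => [a b] [c d]. Qed.

Lemma Re_mulr_real x (a : R) : cRe (x * a%:C) = cRe x * a.
Proof. by rewrite Re_mul /= mulr0 subr0. Qed.

Lemma Im_mulr_real x (a : R) : cIm (x * a%:C) = cIm x * a.
Proof. by rewrite Im_mul /= mulr0 add0r. Qed.

Lemma normc_gt0 x : (0 < normc x) = (x != 0).
Proof. by rewrite -ltcR normcE normr_gt0. Qed.

Lemma realC_nat n : (n%:R : R)%:C = n%:R :> R[i].
Proof. exact: rmorph_nat. Qed.

End ComplexNorm.

(** * Integration against a rapidly decaying weight *)

Section Tempered.
Context (d : measure_display) (T : measurableType d) (R : realType).
Variable mu : {measure set T -> \bar R}.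
Variables q gw : T -> R.
Hypothesis q_ge1 : forall x, 1 <= q x.
Hypothesis mgw : measurable_fun setT gw.
Hypothesis gw_ge0 : forall x, 0 <= gw x.
Hypothesis qgw_int :
  forall n, mu.-integrable setT (EFin \o (fun x => q x ^+ n * gw x)).

(** Polynomial growth in [q]: the class is closed under the ring operations and
    its members are integrable against [gw], so that integrals of algebraic
    expressions need no further integrability argument. *)
Definition tempered (h : T -> R[i]) : Prop :=
  [/\ measurable_fun setT (fun x => cRe (h x)),
      measurable_fun setT (fun x => cIm (h x)) &
      exists C n, forall x, normc (h x) <= C * q x ^+ n].

Lemma tempered_real (f : T -> R) C n : measurable_fun setT f ->
  (forall x, `|f x| <= C * q x ^+ n) -> tempered (fun x => (f x)%:C).
Proof.
move=> mf fC; split=> //; exists C, n => x.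
by rewrite normc_real fC.
Qed.

Lemma tempered_cst c : tempered (fun=> c).
Proof.
split; [exact: measurable_cst|exact: measurable_cst|].
by exists (normc c), 0%N => x; rewrite expr0 mulr1.
Qed.

Lemma temperedD f g : tempered f -> tempered g ->
  tempered (fun x => f x + g x).
Proof.
move=> [rf jf [C [n fC]]] [rg jg [D [m gD]]]; split.
- by under eq_fun do rewrite Re_add; exact: measurable_funD.
- by under eq_fun do rewrite Im_add; exact: measurable_funD.
exists (`|C| + `|D|), (n + m)%N => x.
have q0 p : 1 <= q x ^+ p by rewrite exprn_ege1.
have q00 p : 0 <= q x ^+ p by rewrite (le_trans ler01).
rewrite (le_trans (normcD _ _)) // mulrDl lerD //.
  apply: (le_trans (fC x)); apply: (@le_trans _ _ (`|C| * q x ^+ n)).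
    by rewrite ler_wpM2r // ler_norm.
  by rewrite ler_wpM2l // exprD ler_peMr.
apply: (le_trans (gD x)); apply: (@le_trans _ _ (`|D| * q x ^+ m)).
  by rewrite ler_wpM2r // ler_norm.
by rewrite ler_wpM2l // exprD ler_peMl.
Qed.

Lemma temperedM f g : tempered f -> tempered g ->
  tempered (fun x => f x * g x).
Proof.
move=> [rf jf [C [n fC]]] [rg jg [D [m gD]]]; split.
- by under eq_fun do rewrite Re_mul; apply: measurable_funB; exact: measurable_funM.
- by under eq_fun do rewrite Im_mul; apply: measurable_funD; exact: measurable_funM.
exists (C * D), (n + m)%N => x.
by rewrite normcM exprD mulrACA ler_pM ?normc_ge0.
Qed.

Lemma temperedX f n : tempered f -> tempered (fun x => f x ^+ n).
Proof.
move=> tf; elim: n => [|n IHn].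
  by under eq_fun do rewrite expr0; exact: tempered_cst.
by under eq_fun do rewrite exprS; exact: temperedM.
Qed.

Lemma temperedN f : tempered f -> tempered (fun x => - f x).
Proof.
move=> tf; under eq_fun do rewrite -mulN1r.
by apply: temperedM => //; exact: tempered_cst.
Qed.

Lemma temperedB f g : tempered f -> tempered g ->
  tempered (fun x => f x - g x).
Proof. by move=> tf tg; apply: temperedD => //; exact: temperedN. Qed.

Lemma tempered_part_integrable (part : R[i] -> R) h :
  (forall z, `|part z| <= normc z) -> measurable_fun setT (part \o h) ->
  tempered h -> mu.-integrable setT (EFin \o (fun x => part (h x) * gw x)).
Proof.
move=> part_le mh [_ _ [C [n hC]]].
apply: (@le_integrable _ _ _ mu setT measurableT _
         (EFin \o (fun x => C * (q x ^+ n * gw x)))) => //.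
- by apply/measurable_EFinP; exact: measurable_funM.
- move=> x _ /=; rewrite lee_fin normrM (ger0_norm (gw_ge0 x)).
  apply: (le_trans _ (ler_norm _)); rewrite mulrA ler_wpM2r //.
  exact: le_trans (part_le _) (hC x).
have := @integrableZl _ _ _ mu setT measurableT C _ (qgw_int n).
by apply: eq_integrable => // x _.
Qed.

Lemma tempered_Re_integrable h : tempered h ->
  mu.-integrable setT (EFin \o (fun x => cRe (h x) * gw x)).
Proof. by move=> th; apply: (tempered_part_integrable (@Re_le_normc R)) => //; have [] := th. Qed.

Lemma tempered_Im_integrable h : tempered h ->
  mu.-integrable setT (EFin \o (fun x => cIm (h x) * gw x)).
Proof. by move=> th; apply: (tempered_part_integrable (@Im_le_normc R)) => //; have [] := th. Qed.

Definition wexp (h : T -> R[i]) : R[i] :=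
  Cintegral mu (fun x => h x * (gw x)%:C).

Lemma wexpE h : wexp h =
  (\int[mu]_x (cRe (h x) * gw x)) +i* (\int[mu]_x (cIm (h x) * gw x)).
Proof.
rewrite /wexp /Cintegral; congr (_ +i* _);
  by apply: eq_Rintegral => x _; rewrite ?Re_mulr_real ?Im_mulr_real.
Qed.

Lemma eq_wexp f g : (forall x, f x = g x) -> wexp f = wexp g.
Proof. by move=> /funext ->. Qed.

Lemma wexpD f g : tempered f -> tempered g ->
  wexp (fun x => f x + g x) = wexp f + wexp g.
Proof.
move=> tf tg; rewrite !wexpE; apply/eqP; rewrite eq_complex /=.
apply/andP; split; apply/eqP.
  rewrite -RintegralD //; try exact: tempered_Re_integrable.
  by apply: eq_Rintegral => x _; rewrite Re_add mulrDl.
rewrite -RintegralD //; try exact: tempered_Im_integrable.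
by apply: eq_Rintegral => x _; rewrite Im_add mulrDl.
Qed.

Lemma wexpZ c f : tempered f -> wexp (fun x => c * f x) = c * wexp f.
Proof.
move=> tf; rewrite !wexpE; case: c => a b.
have If := tempered_Re_integrable tf; have Jf := tempered_Im_integrable tf.
have cI e h : mu.-integrable setT (EFin \o h) ->
    mu.-integrable setT (EFin \o (fun x => e * h x)).
  move=> hI; have := @integrableZl _ _ _ mu setT measurableT e _ hI.
  by apply: eq_integrable => // x _.
apply/eqP; rewrite eq_complex /=; apply/andP; split; apply/eqP.
  rewrite -!RintegralZl // -RintegralB //; try exact: cI.
  by apply: eq_Rintegral => x _; rewrite Re_mul /= mulrBl !mulrA.
rewrite -!RintegralZl // -RintegralD //; try exact: cI.
by apply: eq_Rintegral => x _; rewrite Im_mul /= mulrDl !mulrA.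
Qed.

(** The factor 2 pays for the separate estimates of the real and imaginary parts. *)
Lemma wexp_bound f C n : tempered f ->
  (forall x, normc (f x) <= C * q x ^+ n) ->
  normc (wexp f) <= 2 * C * \int[mu]_x (q x ^+ n * gw x).
Proof.
move=> tf fC; rewrite wexpE (le_trans (normc_le _)) //= mulrDl mul1r mulrDl.
have qI := qgw_int n.
have cI : mu.-integrable setT (EFin \o (fun x => C * (q x ^+ n * gw x))).
  have := @integrableZl _ _ _ mu setT measurableT C _ qI.
  by apply: eq_integrable => // x _.
rewrite -RintegralZl //.
have If := tempered_Re_integrable tf; have Jf := tempered_Im_integrable tf.
apply: lerD.
  apply: le_trans (le_normr_Rintegral _ If) _ => //.
  apply: le_Rintegral => //=.
    exact: integrable_norm.
  move=> x _ /=; rewrite normrM (ger0_norm (gw_ge0 x)) mulrA ler_wpM2r //.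
  exact: le_trans (Re_le_normc _) (fC x).
apply: le_trans (le_normr_Rintegral _ Jf) _ => //.
apply: le_Rintegral => //=.
  exact: integrable_norm.
move=> x _ /=; rewrite normrM (ger0_norm (gw_ge0 x)) mulrA ler_wpM2r //.
exact: le_trans (Im_le_normc _) (fC x).
Qed.

End Tempered.

(** * Moments of the Gaussian weight *)

Section GaussianMoments.
Variable R : realType.
Local Notation mu := (@lebesgue_measure R).

Definition gauss1 (x : R) : R := normal_pdf 0 1 x.

Lemma gauss1E x : gauss1 x = (Num.sqrt (2 * pi))^-1 * expR (- x ^+ 2 / 2).
Proof.
rewrite /gauss1 normal_pdfE ?oner_eq0 // /normal_peak /normal_fun.
by rewrite expr1n mul1r subr0 mulr_natl.
Qed.

Lemma gauss1_ge0 x : 0 <= gauss1 x.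
Proof. exact: normal_pdf_ge0. Qed.

Lemma measurable_gauss1 : measurable_fun setT gauss1.
Proof. exact: measurable_normal_pdf. Qed.

Lemma expR_ge_monomial (t : R) n : 0 <= t -> t ^+ n <= n`!%:R * expR t.
Proof.
move=> t0; case: n => [|n].
  by rewrite expr0 fact0 mul1r (le_trans _ (expR_ge1Dx t)) // lerDl.
have := expR_ge1Dxn n t0.
have f0 : 0 < (n.+1)`!%:R :> R by rewrite ltr0n fact_gt0.
rewrite -(ler_pM2l f0) => /(le_trans _); apply.
by rewrite mulrDr mulr1 mulrC divfK ?gt_eqF // lerDr ltW.
Qed.

(** A polynomial factor is absorbed by a wider Gaussian: with variance 4 instead of 1
    the exponent leaves room for [t ^+ n <= n! * expR t]. *)
Lemma poly_gauss1_le n : exists2 C : R, 0 <= C &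
  forall x : R, (1 + x ^+ 2) ^+ n * gauss1 x <= C * normal_pdf 0 2 x.
Proof.
pose p : R := normal_peak (2 : R).
have p0 : 0 < p by rewrite normal_peak_gt0.
exists ((Num.sqrt (2 * pi))^-1 * 8 ^+ n * n`!%:R * expR (1 / 8) / p).
  by rewrite divr_ge0 ?(ltW p0) // !mulr_ge0 ?invr_ge0 ?sqrtr_ge0 ?expR_ge0 ?exprn_ge0.
move=> x; rewrite gauss1E (@normal_pdfE _ 0 2) ?pnatr_eq0 // /normal_fun subr0 -/p.
rewrite mulrCA -!mulrA. apply: ler_wpM2l; first by rewrite invr_ge0 sqrtr_ge0.
rewrite (mulrA p^-1) mulVf ?gt_eqF // mul1r.
have t0 : 0 <= (1 + x ^+ 2) / 8.
  by rewrite divr_ge0 // addr_ge0 // sqr_ge0.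
have := expR_ge_monomial n t0.
rewrite expr_div_n ler_pdivrMr ?exprn_gt0 // => tn.
apply: (@le_trans _ _ (n`!%:R * expR ((1 + x ^+ 2) / 8) * 8 ^+ n
                       * expR (- x ^+ 2 / 2))).
  by rewrite ler_wpM2r ?expR_ge0.
have -> : n`!%:R * expR ((1 + x ^+ 2) / 8) * 8 ^+ n * expR (- x ^+ 2 / 2) =
   (8 ^+ n * n`!%:R) * (expR ((1 + x ^+ 2) / 8) * expR (- x ^+ 2 / 2)) by ring.
rewrite [leRHS]mulrA ler_wpM2l ?mulr_ge0 ?exprn_ge0 //.
rewrite mul1r -!expRD ler_expR.
have x20 : 0 <= x ^+ 2 by exact: sqr_ge0.
have -> : (2 ^+ 2 *+ 2 : R) = 8 by ring.
lra.
Qed.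

Lemma poly_gauss1_integrable n :
  mu.-integrable setT (EFin \o (fun x => (1 + x ^+ 2) ^+ n * gauss1 x)).
Proof.
have [C C0 HC] := poly_gauss1_le n.
have CI : mu.-integrable setT (EFin \o (fun x => C * normal_pdf 0 2 x)).
  have := @integrableZl _ _ _ mu setT measurableT C _
            (integrable_normal_pdf (0 : R) 2).
  by apply: eq_integrable => // x _.
apply: (@le_integrable _ _ _ mu setT measurableT _ _ _ _ CI) => //.
  apply/measurable_EFinP; apply: measurable_funM.
    apply: measurable_funX; apply: measurable_funD => //.
  exact: measurable_gauss1.
move=> x _ /=; rewrite lee_fin !ger0_norm ?HC //.
  by rewrite mulr_ge0 ?normal_pdf_ge0.
by rewrite mulr_ge0 ?gauss1_ge0 ?exprn_ge0 // addr_ge0 // sqr_ge0.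
Qed.

(** The fundamental theorem of calculus on the intervals $[-n-1, n+1]$, and dominated
    convergence. *)
Lemma integral_derivative_eq0 (f F : R -> R) :
  continuous f -> (forall x, is_derive x (1 : R) F (f x)) ->
  mu.-integrable setT (EFin \o f) ->
  F n%:R @[n --> \oo] --> 0 -> F (- n%:R) @[n --> \oo] --> 0 ->
  \int[mu]_x f x = 0.
Proof.
move=> cf dF If Fp Fm.
pose D n := `[(- n.+1%:R : R), n.+1%:R]%classic.
pose fn n := (EFin \o f) \_ (D n).
have FTC n : (\int[mu]_x fn n x = (F n.+1%:R - F (- n.+1%:R))%:E)%E.
  rewrite /fn -integral_mkcond EFinB /=.
  have cF x : {for x, continuous F}.
    apply: differentiable_continuous; apply/derivable1_diffP.
    by have [] := dF x.
  apply: continuous_FTC2.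
  - by rewrite gtrN.
  - exact: continuous_subspaceT.
  - split.
    + by move=> x _; have [] := dF x.
    + exact/cvg_at_right_filter/cF.
    + exact/cvg_at_left_filter/cF.
  - by move=> x _; rewrite derive1E; have [] := dF x.
have lim1 : (\int[mu]_x fn n x)%E @[n --> \oo] --> (\int[mu]_x (f x)%:E)%E.
  have [] // := @dominated_convergence _ _ _ mu setT measurableT fn (EFin \o f)
             (fun x => `|(f x)%:E|%E).
  - move=> n; apply/(measurable_restrictT _ _).1 => //.
      exact: measurable_itv.
    apply: (measurable_funS measurableT) => //.
    exact: measurable_int If.
  - exact: measurable_int If.
  - apply: aeW => x _; apply: cvg_near_cst.
    exists (Num.truncn `|x|).+1 => // n /= xn.
    rewrite /fn patchE mem_set // /D /= in_itv /= -ler_norml.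
    apply: ltW; apply: lt_le_trans (truncnS_gt _) _.
    by rewrite ler_nat (leq_trans xn).
  - exact: integrable_abse.
  apply: aeW => x n _; rewrite /fn patchE; case: ifP => // _.
  by rewrite abse0.
have lim2 : (\int[mu]_x fn n x)%E @[n --> \oo] --> (0%:E : \bar R).
  under eq_fun do rewrite FTC.
  apply: cvg_EFin; first exact: nearW.
  rewrite /comp /=.
  have -> : (0 : R) = 0 - 0 by rewrite subr0.
  apply: cvgB.
    have := Fp; rewrite -(cvg_shiftS (fun n => F n%:R)); exact.
  have := Fm; rewrite -(cvg_shiftS (fun n => F (- n%:R))); exact.
rewrite /Rintegral.
by rewrite (cvg_unique _ lim1 lim2).
Qed.

Definition gmom (n : nat) : R := \int[mu]_x (x ^+ n * gauss1 x).

Lemma monomial_le (x : R) n : `|x ^+ n| <= (1 + x ^+ 2) ^+ n.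
Proof.
rewrite normrX lerXn2r ?nnegrE ?addr_ge0 ?sqr_ge0 //.
rewrite -(@real_normK _ x) ?num_real //.
have := sqr_ge0 (`|x| - 2^-1); have : 0 <= `|x| by [].
nra.
Qed.

Lemma monomial_gauss1_integrable n :
  mu.-integrable setT (EFin \o (fun x => x ^+ n * gauss1 x)).
Proof.
apply: (@le_integrable _ _ _ mu setT measurableT _ _ _ _
          (poly_gauss1_integrable n)) => //.
  apply/measurable_EFinP; apply: measurable_funM.
    exact: exprn_measurable.
  exact: measurable_gauss1.
move=> x _ /=; rewrite lee_fin !normrM ler_wpM2r //.
by apply: (le_trans (monomial_le _ _)); exact: ler_norm.
Qed.

Lemma monomial_gauss1_decay n (u : nat -> R) : (forall m, m%:R <= `|u m|) ->
  u m ^+ n * gauss1 (u m) @[m --> \oo] --> (0 : R).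
Proof.
move=> um; have [C C0 HC] := poly_gauss1_le n.+1.
pose K := C * normal_peak 2.
have K0 : 0 <= K by rewrite mulr_ge0 // normal_peak_ge0.
have bnd m : `|u m ^+ n * gauss1 (u m)| <= K * harmonic m.
  have q0 : 0 < 1 + u m ^+ 2 by rewrite ltr_pwDl // sqr_ge0.
  rewrite normrM (ger0_norm (gauss1_ge0 _)).
  apply: (@le_trans _ _ ((1 + u m ^+ 2) ^+ n * gauss1 (u m))).
    by rewrite ler_wpM2r ?gauss1_ge0 // monomial_le.
  apply: (@le_trans _ _ (K / (1 + u m ^+ 2))).
    rewrite ler_pdivlMr // mulrAC -exprSr.
    apply: (le_trans (HC _)); rewrite ler_wpM2l //.
    by rewrite normal_pdf_ub.
  rewrite ler_wpM2l // lef_pV2 ?posrE //.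
  rewrite -natr1 addrC lerD2l -(@real_normK _ (u m)) ?num_real //.
  apply: (@le_trans _ _ (m%:R ^+ 2)).
    by rewrite -natrX ler_nat; case: (m) => // p; rewrite expnS expn1 leq_pmulr.
  by rewrite lerXn2r ?nnegrE.
apply: norm_cvg0.
apply: (@squeeze_cvgr _ _ _ _ (fun=> 0) (fun m => K * harmonic m)).
- by apply: nearW => m; rewrite normr_ge0 bnd.
- exact: cvg_cst.
- by rewrite -(mulr0 K); apply: cvgMr; exact: cvg_harmonic.
Qed.

Lemma gmom0 : gmom 0 = 1.
Proof.
rewrite /gmom /Rintegral.
under eq_integral do rewrite expr0 mul1r.
by rewrite integral_normal_pdf.
Qed.

Lemma is_derive_gauss1 (x : R) : is_derive x (1 : R) gauss1 (- x * gauss1 x).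
Proof.
have -> : gauss1 = (fun x => (Num.sqrt (2 * pi))^-1 * expR (- x ^+ 2 / 2)).
  by apply/funext => y; rewrite gauss1E.
apply: is_derive_eq.
rewrite /GRing.scale /=; set a := (Num.sqrt _)^-1.
by set b := expR _; field.
Qed.

Lemma continuous_gauss1 : continuous gauss1.
Proof. by apply: continuous_normal_pdf; exact: oner_neq0. Qed.

(** Integration by parts against the weight, whose derivative is $-x$ times
    itself. *)
Lemma gmomS n : gmom n.+1 = n%:R * gmom n.-1.
Proof.
pose F (x : R) := x ^+ n * gauss1 x.
pose f (x : R) := n%:R * (x ^+ n.-1 * gauss1 x) - x ^+ n.+1 * gauss1 x.
have I0 := monomial_gauss1_integrable n.-1.
have I2 := monomial_gauss1_integrable n.+1.
have I1 : mu.-integrable setT (EFin \o (fun x => n%:R * (x ^+ n.-1 * gauss1 x))).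
  have := @integrableZl _ _ _ mu setT measurableT n%:R _ I0.
  by apply: eq_integrable => // x _.
have : \int[mu]_x f x = 0.
  apply: (@integral_derivative_eq0 f F).
  - move=> x; have cX m : {for x, continuous (fun y : R => y ^+ m * gauss1 y)}.
      by apply: cvgM; [exact: exprn_continuous|exact: continuous_gauss1].
    apply: (@cvgB _ R^o); last exact: cX.
    apply: (@cvgM R); [exact: cvg_cst|exact: cX].
  - move=> x; rewrite /F /f; have dg := is_derive_gauss1 x.
    have dX : is_derive x (1 : R) (fun y : R => y ^+ n) (n%:R * x ^+ n.-1).
      case: (n) => [|m]; first by rewrite mul0r; exact: is_derive_cst.
      have := is_deriveX m.+1 (is_derive_id x (1 : R)).
      rewrite /GRing.scale /= mulr1; congr is_derive.
      by apply/funext => y; rewrite exprfctE.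
    apply: (is_derive_eq (is_deriveM dX dg)).
    by rewrite /GRing.scale /= exprS; move: (x ^+ n.-1) => y; ring.
  - by have := integrableB measurableT I1 I2; apply: eq_integrable => // x _.
  - by apply: (@monomial_gauss1_decay n (fun m => m%:R)) => m; rewrite normr_nat.
  - by apply: (@monomial_gauss1_decay n (fun m => - m%:R)) => m;
       rewrite normrN normr_nat.
rewrite /f RintegralB // RintegralZl //.
by move/eqP; rewrite subr_eq0 => /eqP ->.
Qed.

End GaussianMoments.

(** * The Gaussian weight on velocity space *)

Section ProductIntegral.
Local Open Scope ereal_scope.
Context d1 d2 (T1 : measurableType d1) (T2 : measurableType d2) (R : realType).
Variable m1 : {sigma_finite_measure set T1 -> \bar R}.
Variable m2 : {sigma_finite_measure set T2 -> \bar R}.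
Variables (f : T1 -> R) (g : T2 -> R).
Hypothesis If : m1.-integrable setT (EFin \o f).
Hypothesis Ig : m2.-integrable setT (EFin \o g).

Let mf : measurable_fun setT f.
Proof. by apply/measurable_EFinP; exact: measurable_int If. Qed.

Let mg : measurable_fun setT g.
Proof. by apply/measurable_EFinP; exact: measurable_int Ig. Qed.

(** Iterating the product of measures needs the sigma-finiteness of the first
    product as part of its type. *)
Definition product_sigma_finite :
    {sigma_finite_measure set (T1 * T2)%type -> \bar R} :=
  HB.pack (m1 \x m2)
    (lebesgue_integral_fubini.measure_function_Measure_isSigmaFinite__to__measure_function_isSFinite m1 m2)
    (lebesgue_integral_fubini.measure_function_Measure_isSigmaFinite__to__measure_function_isSigmaFinite m1 m2).

Lemma integrable_tensor :
  (m1 \x m2).-integrable setT (EFin \o (fun z => f z.1 * g z.2)%R).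
Proof.
apply/integrable12ltyP.
  apply/measurable_EFinP; apply: measurable_funM.
    exact: (measurableT_comp mf measurable_fst).
  exact: (measurableT_comp mg measurable_snd).
have -> : (fun x => \int[m2]_y `|(EFin \o (fun z => f z.1 * g z.2)%R) (x, y)|) =
          (fun x => `|(f x)%:E| * \int[m2]_y `|(g y)%:E|).
  apply/funext => x /=.
  rewrite -ge0_integralZl //; last first.
    by apply/measurable_EFinP; exact: measurableT_comp mg.
  by apply: eq_integral => y _ /=; rewrite normrM EFinM.
rewrite ge0_integralZr //; first last.
- exact: integral_ge0.
- by apply/measurable_EFinP; exact: measurableT_comp mf.
have /integrableP[_ f_lt] := If; have /integrableP[_ g_lt] := Ig.
by apply: lte_mul_pinfty; rewrite ?ge0_fin_numE ?integral_ge0.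
Qed.

Lemma Rintegral_tensor :
  (\int[(m1 \x m2)%E]_z (f z.1 * g z.2) =
   (\int[m1]_x f x) * (\int[m2]_y g y))%R.
Proof.
rewrite /Rintegral -integral12_prod_meas1; last exact: integrable_tensor.
have -> : (fun x => \int[m2]_y (f (x, y).1 * g (x, y).2)%:E) =
          (fun x => (f x)%:E * \int[m2]_y (g y)%:E).
  by apply/funext => x /=; rewrite -integralZl.
have gfin : (\int[m2]_y (g y)%:E) \is a fin_num by exact: integrable_fin_num.
rewrite -(fineK gfin) integralZr // fineM //.
exact: integrable_fin_num.
Qed.

End ProductIntegral.

Section GaussianExpectation.
Variable R : realType.
Local Notation mu := (@lebesgue_measure R).
Local Notation C := R[i].

Definition q1 (x : R) : R := 1 + x ^+ 2.
Definition q3 (v : Vel R) : R := 1 + vel_sqr v.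

Lemma q1_ge1 x : 1 <= q1 x.
Proof. by rewrite lerDl sqr_ge0. Qed.

Lemma vel_sqrE (v : Vel R) : vel_sqr v = v.1.1 ^+ 2 + v.1.2 ^+ 2 + v.2 ^+ 2.
Proof. by rewrite /vel_sqr !big_ord_recl big_ord0 /= addr0 addrA. Qed.

Lemma measurable_v1 : measurable_fun setT (fun v : Vel R => v.1.1 : R).
Proof. exact: (measurableT_comp measurable_fst measurable_fst). Qed.

Lemma measurable_v2 : measurable_fun setT (fun v : Vel R => v.1.2 : R).
Proof. exact: (measurableT_comp measurable_snd measurable_fst). Qed.

Lemma measurable_v3 : measurable_fun setT (fun v : Vel R => v.2 : R).
Proof. exact: measurable_snd. Qed.

Lemma measurable_vel_sqr : measurable_fun setT (@vel_sqr R).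
Proof.
rewrite (funext vel_sqrE).
apply: measurable_funD; last (apply: measurable_funX; exact: measurable_v3).
apply: measurable_funD; last (apply: measurable_funX; exact: measurable_v2).
(apply: measurable_funX; exact: measurable_v1).
Qed.

Lemma vel_sqr_ge0 (v : Vel R) : 0 <= vel_sqr v.
Proof. by rewrite vel_sqrE !addr_ge0 ?sqr_ge0. Qed.

Lemma q3_ge1 v : 1 <= q3 v.
Proof. by rewrite lerDl vel_sqr_ge0. Qed.

Lemma measurable_q3 : measurable_fun setT q3.
Proof. by apply: measurable_funD => //; exact: measurable_vel_sqr. Qed.

Lemma gaussE (v : Vel R) :
  gauss v = gauss1 v.1.1 * gauss1 v.1.2 * gauss1 v.2.
Proof.
have p0 : 0 < 2 * pi :> R by rewrite mulr_gt0 ?pi_gt0.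
rewrite /gauss vel_sqrE !gauss1E.
have -> : (2 * pi) `^ (- (3 / 2)) = (Num.sqrt (2 * pi))^-1 ^+ 3 :> R.
  have -> : 3 / 2 = 2^-1 * 3%:R :> R by rewrite mulrC.
  by rewrite powRN powRrM powR_mulrn ?powR_ge0 // powR12_sqrt ?ltW // exprVn.
have -> : - (v.1.1 ^+ 2 + v.1.2 ^+ 2 + v.2 ^+ 2) / 2 =
  (- v.1.1 ^+ 2 / 2) + (- v.1.2 ^+ 2 / 2) + (- v.2 ^+ 2 / 2) :> R by ring.
by rewrite !expRD; ring.
Qed.

Lemma gauss_ge0 (v : Vel R) : 0 <= gauss v.
Proof. by rewrite gaussE !mulr_ge0 ?gauss1_ge0. Qed.

Lemma measurable_gauss : measurable_fun setT (@gauss R).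
Proof.
rewrite (funext gaussE).
have mg := @measurable_gauss1 R.
apply: measurable_funM; last exact: (measurableT_comp mg measurable_v3).
apply: measurable_funM; last exact: (measurableT_comp mg measurable_v2).
exact: (measurableT_comp mg measurable_v1).
Qed.

Let mu2 := product_sigma_finite mu mu.

Lemma integrable_tensor3 (f g h : R -> R) :
  mu.-integrable setT (EFin \o f) -> mu.-integrable setT (EFin \o g) ->
  mu.-integrable setT (EFin \o h) ->
  (@vel_measure R).-integrable setT
    (EFin \o (fun v : Vel R => f v.1.1 * g v.1.2 * h v.2)).
Proof.
move=> If Ig Ih; have Ifg := integrable_tensor If Ig.
exact: (@integrable_tensor _ _ _ _ _ mu2 mu (fun z => f z.1 * g z.2) h Ifg Ih).
Qed.

Lemma Rintegral_tensor3 (f g h : R -> R) :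
  mu.-integrable setT (EFin \o f) -> mu.-integrable setT (EFin \o g) ->
  mu.-integrable setT (EFin \o h) ->
  \int[@vel_measure R]_v (f v.1.1 * g v.1.2 * h v.2) =
  (\int[mu]_x f x) * (\int[mu]_x g x) * (\int[mu]_x h x).
Proof.
move=> If Ig Ih; have Ifg := integrable_tensor If Ig.
rewrite -(Rintegral_tensor If Ig).
exact: (@Rintegral_tensor _ _ _ _ _ mu2 mu (fun z => f z.1 * g z.2) h Ifg Ih).
Qed.

Lemma poly_gauss_integrable n : (@vel_measure R).-integrable setT
  (EFin \o (fun v => q3 v ^+ n * gauss v)).
Proof.
have I1 := @poly_gauss1_integrable R n.
apply: (@le_integrable _ _ _ (@vel_measure R) setT measurableT _ _ _ _
          (integrable_tensor3 I1 I1 I1)) => //.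
  apply/measurable_EFinP; apply: measurable_funM; last exact: measurable_gauss.
  (apply: measurable_funX; exact: measurable_q3).
move=> v _ /=; rewrite lee_fin.
have a0 := sqr_ge0 (v.1.1 : R); have b0 := sqr_ge0 (v.1.2 : R).
have c0 := sqr_ge0 (v.2 : R).
rewrite gaussE !ger0_norm; first last.
- by rewrite !mulr_ge0 ?gauss1_ge0 ?exprn_ge0 ?(le_trans ler01 (q3_ge1 v)).
- by rewrite !mulr_ge0 ?gauss1_ge0 ?exprn_ge0 ?addr_ge0.
set g1 := gauss1 _; set g2 := gauss1 _; set g3 := gauss1 _.
have -> : (1 + v.1.1 ^+ 2) ^+ n * g1 * ((1 + v.1.2 ^+ 2) ^+ n * g2) *
    ((1 + v.2 ^+ 2) ^+ n * g3) =
    ((1 + v.1.1 ^+ 2) * (1 + v.1.2 ^+ 2) * (1 + v.2 ^+ 2)) ^+ n *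
    (g1 * g2 * g3) by rewrite !exprMn; ring.
rewrite ler_wpM2r ?mulr_ge0 ?gauss1_ge0 // lerXn2r ?nnegrE //.
- exact: le_trans ler01 (q3_ge1 v).
- by rewrite !mulr_ge0 ?addr_ge0.
rewrite /q3 vel_sqrE.
have ab := mulr_ge0 a0 b0; have bc := mulr_ge0 b0 c0.
have ac := mulr_ge0 a0 c0; have abc := mulr_ge0 ab c0.
move: a0 b0 c0 ab bc ac abc.
move: (_ ^+ 2) (_ ^+ 2) (_ ^+ 2) => a b c *; nra.
Qed.

(** Gaussian expectation of a function of one velocity component. *)
Definition E1 (h : R -> C) : C := wexp mu (@gauss1 R) h.
(** Gaussian expectation of a function of the velocity. *)
Definition E3 (h : Vel R -> C) : C := wexp (@vel_measure R) (@gauss R) h.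
Definition temp1 (h : R -> C) : Prop :=
  @tempered _ (measurableTypeR R) R q1 h.
Definition temp3 (h : Vel R -> C) : Prop := tempered q3 h.

Lemma temp3_v1 h : temp1 h -> temp3 (fun v => h (v.1.1 : R)).
Proof.
move=> [mr mi [c [n hc]]]; split.
- exact: (measurableT_comp mr measurable_v1).
- exact: (measurableT_comp mi measurable_v1).
exists `|c|, n => v; apply: (le_trans (hc _)).
have q0 : 0 <= q1 (v.1.1 : R) by exact: le_trans ler01 (q1_ge1 _).
apply: (@le_trans _ _ (`|c| * q1 (v.1.1 : R) ^+ n)).
  by rewrite ler_wpM2r ?exprn_ge0 ?ler_norm.
rewrite ler_wpM2l // lerXn2r ?nnegrE //.
  exact: le_trans ler01 (q3_ge1 v).
by rewrite /q1 /q3 vel_sqrE -addrA lerD2l lerDl addr_ge0 ?sqr_ge0.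
Qed.

Lemma temp3_real (f : Vel R -> R) c n : measurable_fun setT f ->
  (forall v, `|f v| <= c * q3 v ^+ n) -> temp3 (fun v => (f v)%:C).
Proof. exact: tempered_real. Qed.

(** Squared length of the part of the velocity transverse to the first axis. *)
Definition rperp (v : Vel R) : R := v.1.2 ^+ 2 + v.2 ^+ 2.

Lemma temp3_rperp : temp3 (fun v => (rperp v)%:C).
Proof.
apply: (@temp3_real _ 1 1%N).
  apply: measurable_funD; first (apply: measurable_funX; exact: measurable_v2).
  (apply: measurable_funX; exact: measurable_v3).
move=> v; rewrite mul1r expr1 ger0_norm ?addr_ge0 ?sqr_ge0 //.
rewrite /q3 vel_sqrE /rperp.
by rewrite -[leLHS]add0r -!addrA lerD // lerDr sqr_ge0.
Qed.

Lemma temp1_x : temp1 (fun x => x%:C).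
Proof.
apply: (@tempered_real _ (measurableTypeR R) R q1 (fun x => x) 1 1%N) => // x.
by rewrite mul1r expr1 -{1}(expr1 x) -[leRHS]expr1 monomial_le.
Qed.

Lemma temp1_cst c : temp1 (fun=> c).
Proof. exact: tempered_cst. Qed.

Lemma temp1D f g : temp1 f -> temp1 g -> temp1 (fun x => f x + g x).
Proof. exact: (temperedD q1_ge1). Qed.

Lemma temp1M f g : temp1 f -> temp1 g -> temp1 (fun x => f x * g x).
Proof. exact: temperedM. Qed.

Lemma temp1X f n : temp1 f -> temp1 (fun x => f x ^+ n).
Proof. exact: temperedX. Qed.

Lemma temp1B f g : temp1 f -> temp1 g -> temp1 (fun x => f x - g x).
Proof. exact: (temperedB q1_ge1). Qed.

Lemma temp3D f g : temp3 f -> temp3 g -> temp3 (fun x => f x + g x).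
Proof. exact: (temperedD q3_ge1). Qed.

Lemma temp3M f g : temp3 f -> temp3 g -> temp3 (fun x => f x * g x).
Proof. exact: temperedM. Qed.

Lemma temp3X f n : temp3 f -> temp3 (fun x => f x ^+ n).
Proof. exact: temperedX. Qed.

Lemma E1D f g : temp1 f -> temp1 g -> E1 (fun x => f x + g x) = E1 f + E1 g.
Proof.
exact: (@wexpD _ (measurableTypeR R) R mu q1 (@gauss1 R)
  (@measurable_gauss1 R) (@gauss1_ge0 R) (@poly_gauss1_integrable R)).
Qed.

Lemma E1Z c f : temp1 f -> E1 (fun x => c * f x) = c * E1 f.
Proof.
exact: (@wexpZ _ (measurableTypeR R) R mu q1 (@gauss1 R)
  (@measurable_gauss1 R) (@gauss1_ge0 R) (@poly_gauss1_integrable R)).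
Qed.

Lemma E3D f g : temp3 f -> temp3 g -> E3 (fun x => f x + g x) = E3 f + E3 g.
Proof.
exact: (wexpD measurable_gauss gauss_ge0
  poly_gauss_integrable).
Qed.

Lemma E3Z c f : temp3 f -> E3 (fun x => c * f x) = c * E3 f.
Proof.
exact: (wexpZ measurable_gauss gauss_ge0
  poly_gauss_integrable).
Qed.

Lemma E1_bound n : exists2 K : R, 0 <= K & forall f c, temp1 f ->
  (forall x, normc (f x) <= c * q1 x ^+ n) -> normc (E1 f) <= K * c.
Proof.
exists (2 * \int[mu]_x (q1 x ^+ n * gauss1 x)).
  rewrite mulr_ge0 // Rintegral_ge0 // => x _.
  by rewrite mulr_ge0 ?gauss1_ge0 ?exprn_ge0 // (le_trans ler01 (q1_ge1 x)).
move=> f c tf fc; rewrite mulrAC.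
exact: (@wexp_bound _ (measurableTypeR R) R mu q1 (@gauss1 R) (@measurable_gauss1 R)
  (@gauss1_ge0 R) (@poly_gauss1_integrable R) f c n tf fc).
Qed.

Lemma E1_monomial n : E1 (fun x => x%:C ^+ n) = (gmom R n)%:C.
Proof.
rewrite /E1 wexpE; congr (_ +i* _).
  by apply: eq_Rintegral => x _; rewrite -rmorphXn.
under eq_Rintegral do rewrite -rmorphXn /= mul0r.
by rewrite /Rintegral integral0.
Qed.

Lemma E3_monomial h b c : temp1 h ->
  E3 (fun v => h (v.1.1 : R) * ((v.1.2 : R) ^+ b * (v.2 : R) ^+ c)%:C) =
  E1 h * (gmom R b * gmom R c)%:C.
Proof.
move=> th; rewrite /E3 /E1 !wexpE.
have Ir : mu.-integrable setT (EFin \o (fun x => cRe (h x) * gauss1 x)).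
  exact: (@tempered_Re_integrable _ (measurableTypeR R) R mu q1 (@gauss1 R)
  (@measurable_gauss1 R) (@gauss1_ge0 R) (@poly_gauss1_integrable R) h th).
have Ii : mu.-integrable setT (EFin \o (fun x => cIm (h x) * gauss1 x)).
  exact: (@tempered_Im_integrable _ (measurableTypeR R) R mu q1 (@gauss1 R)
  (@measurable_gauss1 R) (@gauss1_ge0 R) (@poly_gauss1_integrable R) h th).
have Ib := @monomial_gauss1_integrable R b.
have Ic := @monomial_gauss1_integrable R c.
apply/eqP; rewrite eq_complex Re_mulr_real Im_mulr_real /= mulrA mulrA; apply/andP; split; apply/eqP.
  rewrite /gmom -Rintegral_tensor3 //; apply: eq_Rintegral => v _.
  by rewrite gaussE Re_mulr_real; ring.
rewrite /gmom -Rintegral_tensor3 //; apply: eq_Rintegral => v _.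
by rewrite gaussE Im_mulr_real; ring.
Qed.

Lemma gmom2 : gmom R 2 = 1. Proof. by rewrite gmomS gmom0 mulr1. Qed.
Lemma gmom4 : gmom R 4 = 3. Proof. by rewrite gmomS gmom2 mulr1. Qed.

(** The transverse components contribute only through the moments
    $E[r]=2$ and $E[r^2]=8$ of $r=v_2^2+v_3^2$. *)
Lemma E3_transverse h0 h1 h2 : temp1 h0 -> temp1 h1 -> temp1 h2 ->
  E3 (fun v => h0 (v.1.1 : R) + h1 (v.1.1 : R) * (rperp v)%:C
               + h2 (v.1.1 : R) * (rperp v)%:C ^+ 2) =
  E1 (fun x => h0 x + 2 * h1 x + 8 * h2 x).
Proof.
move=> t0 t1 t2.
have tr := temp3_rperp.
have T0 := temp3_v1 t0; have T1 := temp3_v1 t1; have T2 := temp3_v1 t2.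
have tv2 : temp3 (fun v => ((v.1.2 : R) ^+ 2)%:C).
  apply: (@temp3_real _ 1 1%N); first (apply: measurable_funX; exact: measurable_v2).
  move=> v; rewrite mul1r expr1 ger0_norm ?sqr_ge0 // /q3 vel_sqrE.
  have := sqr_ge0 (v.1.1 : R); have := sqr_ge0 (v.2 : R); lra.
have tv3 : temp3 (fun v => ((v.2 : R) ^+ 2)%:C).
  apply: (@temp3_real _ 1 1%N); first (apply: measurable_funX; exact: measurable_v3).
  move=> v; rewrite mul1r expr1 ger0_norm ?sqr_ge0 // /q3 vel_sqrE.
  have := sqr_ge0 (v.1.1 : R); have := sqr_ge0 (v.1.2 : R); lra.
have mon h b c : temp1 h -> temp3 (fun v => h (v.1.1 : R) *
     ((v.1.2 : R) ^+ (2 * b) * (v.2 : R) ^+ (2 * c))%:C).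
  move=> /temp3_v1 th; apply: temp3M => //.
  rewrite (_ : (fun v : Vel R => _) = (fun v : Vel R =>
      ((v.1.2 : R) ^+ 2)%:C ^+ b * ((v.2 : R) ^+ 2)%:C ^+ c)); last first.
    by apply/funext => v; rewrite !exprM rmorphM !rmorphXn.
  by apply: temp3M; exact: temp3X.
have e0 : E3 (fun v => h0 (v.1.1 : R)) = E1 h0.
  rewrite -[RHS]mulr1 -[1]/(1%:C) -[1%R in RHS]mulr1 -gmom0.
  rewrite -(E3_monomial 0 0 t0); apply: eq_wexp => v.
  by rewrite !expr0 mulr1 mulr1.
have e1 : E3 (fun v => h1 (v.1.1 : R) * (rperp v)%:C) = 2 * E1 h1.
  transitivity (E3 (fun v =>
     h1 (v.1.1 : R) * ((v.1.2 : R) ^+ (2 * 1) * (v.2 : R) ^+ (2 * 0))%:C +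
     h1 (v.1.1 : R) * ((v.1.2 : R) ^+ (2 * 0) * (v.2 : R) ^+ (2 * 1))%:C)).
    apply: eq_wexp => v; rewrite !expr0 mulr1 mul1r -mulrDr -rmorphD //.
  rewrite E3D; try exact: mon.
  rewrite !E3_monomial // gmom0 gmom2 mulr1 -mulrDr -rmorphD /=.
  by rewrite (_ : 1 + 1 = 2%:R) // realC_nat mulrC.
have e2 : E3 (fun v => h2 (v.1.1 : R) * (rperp v)%:C ^+ 2) = 8 * E1 h2.
  transitivity (E3 (fun v =>
     h2 (v.1.1 : R) * ((v.1.2 : R) ^+ (2 * 2) * (v.2 : R) ^+ (2 * 0))%:C +
    (2 * (h2 (v.1.1 : R) * ((v.1.2 : R) ^+ (2 * 1) * (v.2 : R) ^+ (2 * 1))%:C) +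
     h2 (v.1.1 : R) * ((v.1.2 : R) ^+ (2 * 0) * (v.2 : R) ^+ (2 * 2))%:C))).
    apply: eq_wexp => v; rewrite /rperp.
    by rewrite !muln1 !muln0 !rmorphD !rmorphM !rmorphXn /=; ring.
  rewrite E3D ?E3D ?E3Z; try exact: mon.
  - rewrite !E3_monomial // gmom0 gmom2 gmom4 !mulr1 !mul1r.
    rewrite realC_nat; ring.
  - by apply: temp3M; [exact: tempered_cst|exact: mon].
  - by apply: temp3D; [apply: temp3M; [exact: tempered_cst|exact: mon]|exact: mon].
have t1' : temp3 (fun v => h1 (v.1.1 : R) * (rperp v)%:C) by exact: temp3M.
have t2' : temp3 (fun v => h2 (v.1.1 : R) * (rperp v)%:C ^+ 2).
  by apply: temp3M => //; exact: temp3X.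
rewrite E3D ?E3D //; last exact: temp3D.
rewrite E1D ?E1D ?E1Z ?e0 ?e1 ?e2 //; try by apply: temp1M => //; exact: temp1_cst.
by apply: temp1D => //; apply: temp1M => //; exact: temp1_cst.
Qed.

End GaussianExpectation.

(** * Eigenfunctions and their moments *)

Section Resolvent.
Variable R : realType.
Local Notation C := R[i].

(** The resolvent of multiplication by $-\mathrm i b x$ is the only non-polynomial
    function of the velocity that enters an eigenfunction. *)
Definition resolv (s : C) (b : R) (x : R) : C := (s + 'i * (b * x)%:C)^-1.

Lemma resolv_den (s : C) (b x : R) : s + 'i * (b * x)%:C = cRe s +i* (cIm s + b * x).
Proof.
case: s => s1 s2; apply/eqP; rewrite eq_complex /=; apply/andP.
by split; apply/eqP; ring.
Qed.

Lemma resolv_neq0 (s : C) (b x : R) : 0 < cRe s -> s + 'i * (b * x)%:C != 0.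
Proof. by move=> s0; rewrite resolv_den eq_complex /= gt_eqF. Qed.

Lemma resolv_le (s : C) (b x : R) : 0 < cRe s -> normc (resolv s b x) <= (cRe s)^-1.
Proof.
move=> s0; rewrite /resolv normcV lef_pV2 ?posrE //.
  rewrite resolv_den.
  exact: le_trans (ler_norm _) (Re_le_normc (cRe s +i* (cIm s + b * x))).
by rewrite normc_gt0 resolv_neq0.
Qed.

Lemma temp1_resolv (s : C) (b : R) : 0 < cRe s -> temp1 (resolv s b).
Proof.
move=> s0; pose D (x : R) := cRe s ^+ 2 + (cIm s + b * x) ^+ 2.
have D0 x : D x != 0 by rewrite gt_eqF // ltr_pwDl ?exprn_gt0 ?sqr_ge0.
have mD : measurable_fun setT (fun x => (D x)^-1).
  apply: continuous_measurable_fun => x; apply: cvgV => //.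
  apply: (@cvgD _ R^o); first exact: cvg_cst.
  apply: (cvg_comp _ (fun y : R => y ^+ 2)); last exact: exprn_continuous.
  apply: (@cvgD _ R^o); first exact: cvg_cst.
  by apply: (@cvgM R); [exact: cvg_cst|exact: cvg_id].
have ml : measurable_fun setT (fun x : R => cIm s + b * x).
  by apply: measurable_funD => //; apply: measurable_funM.
have E x : resolv s b x = (cRe s * (D x)^-1) +i* (- (cIm s + b * x) * (D x)^-1).
  by rewrite /resolv resolv_den /D; apply/eqP; rewrite eq_complex /= mulNr !eqxx.
split.
- under eq_fun do rewrite E /=.
  by apply: measurable_funM.
- under eq_fun do rewrite E /=.
  by apply: measurable_funM => //; exact: measurable_funN.
by exists (cRe s)^-1, 0%N => x; rewrite expr0 mulr1 resolv_le.
Qed.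

End Resolvent.

Section EigenMoments.
Variable R : realType.
Local Notation C := R[i].
Local Notation i_u0 := (i_u (@ord0 2)).
Local Notation i_u1 := (i_u (lift ord0 (@ord0 1))).
Local Notation i_u2 := (i_u (lift ord0 (lift ord0 (@ord0 0)))).

Lemma sum5 (V : nmodType) (F : 'I_5 -> V) :
  \sum_(i < 5) F i = F i_rho + (F i_u0 + (F i_u1 + (F i_u2 + F i_T))).
Proof.
rewrite !big_ord_recl big_ord0 addr0.
by congr (F _ + (F _ + (F _ + (F _ + F _)))); exact: val_inj.
Qed.

Lemma basis_rho (v : Vel R) : basis_e i_rho v = 1.
Proof. by rewrite /basis_e /i_rho (unsplitK (inl _ : 'I_1 + 'I_4)). Qed.

Lemma basis_u j (v : Vel R) : basis_e (i_u j) v = (vel_coord j v)%:C.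
Proof.
by rewrite /basis_e /i_u (unsplitK (inr _ : 'I_1 + 'I_4)) (unsplitK (inl _ : 'I_3 + 'I_1)).
Qed.

Lemma basis_T (v : Vel R) : basis_e i_T v = ((vel_sqr v - 3) / Num.sqrt 6)%:C.
Proof.
by rewrite /basis_e /i_T (unsplitK (inr _ : 'I_1 + 'I_4)) (unsplitK (inr _ : 'I_3 + 'I_1)).
Qed.

(** By isotropy the wave vectors along the first axis suffice to determine functions
    of the wave number. *)
Definition wave_e1 (k : R) : 'cV[R]_3 := k *: delta_mx 0 0.

Lemma wave_e1E k (j : 'I_3) : wave_e1 k j 0 = if val j == 0%N then k else 0.
Proof.
rewrite !mxE eqxx andbT (_ : (j == 0) = (val j == 0%N)) //.
by case: ifP; rewrite ?mulr1 ?mulr0.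
Qed.

Lemma enorm_wave_e1 k : 0 <= k -> enorm (wave_e1 k) = k.
Proof.
move=> k0; rewrite /enorm !big_ord_recl big_ord0 !wave_e1E /=.
by rewrite expr0n !addr0 sqrtr_sqr ger0_norm.
Qed.

Lemma vel_dot_wave_e1 k (v : Vel R) : vel_dot v (wave_e1 k) = k * v.1.1.
Proof.
rewrite /vel_dot !big_ord_recl big_ord0 !wave_e1E /= !mulr0 !addr0.
by rewrite mulrC.
Qed.

Lemma ae_eq_Cintegral (F G : Vel R -> C) :
  measurable_fun setT (fun v => cRe (F v)) ->
  measurable_fun setT (fun v => cIm (F v)) ->
  measurable_fun setT (fun v => cRe (G v)) ->
  measurable_fun setT (fun v => cIm (G v)) ->
  ae_equal F G -> Cintegral (@vel_measure R) F = Cintegral (@vel_measure R) G.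
Proof.
move=> rF iF rG iG FG; rewrite /Cintegral /Rintegral.
congr (fine _ +i* fine _); apply: ae_eq_integral => //.
- exact/measurable_EFinP.
- exact/measurable_EFinP.
- by apply: filterS FG => v ->.
- exact/measurable_EFinP.
- exact/measurable_EFinP.
- by apply: filterS FG => v ->.
Qed.

Lemma sqrt32_sqrt6 : Num.sqrt (3 / 2) / Num.sqrt 6 = 2^-1 :> R.
Proof.
have -> : (6 : R) = 3 / 2 * 4 by field.
rewrite (sqrtrM 4) ?divr_ge0 // (_ : (4 : R) = 2 ^+ 2); last by ring.
rewrite sqrtr_sqr ger0_norm // invfM mulrA divff ?mul1r //.
Qed.

Section Eigen.
Variables (tau k : R) (lam : C) (f : Vel R -> C) (T : C).
Hypothesis tau_gt0 : 0 < tau.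
Hypothesis lam_gt : - tau^-1 < cRe lam.
Hypothesis Hf : is_eigenfunction tau (wave_e1 k) lam f.
Let ut := lam / k%:C.
Hypothesis f_rho : ip f (basis_e i_rho) = 1.
Hypothesis f_u0 : ip f (basis_e i_u0) = 'i * ut.
Hypothesis f_u1 : ip f (basis_e i_u1) = 0.
Hypothesis f_u2 : ip f (basis_e i_u2) = 0.
Hypothesis f_T : ip f (basis_e i_T) = (Num.sqrt (3 / 2))%:C * T.

Let s := 1 + tau%:C * lam.
Let w := resolv s (tau * k).

(** The projection [P5 f] without its transverse part, for a perturbation [f] of unit
    density, velocity $\mathrm i u$ along the first axis and temperature [T]. *)
Definition profile_a (ut T : C) (x : R) : C :=
  1 + 'i * ut * x%:C + T * (x%:C ^+ 2 - 3) / 2.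
Let a := profile_a ut T.

Lemma Re_resolv_gt0 : 0 < cRe s.
Proof.
rewrite /s Re_add mulrC Re_mulr_real /=.
by rewrite mulrC -ltrBlDl sub0r -ltr_pdivrMl // mulrN1.
Qed.

Lemma P5_profile v : P5 f v = a v.1.1 + T / 2 * (rperp v)%:C.
Proof.
rewrite /P5 sum5 f_rho f_u0 f_u1 f_u2 f_T basis_rho !basis_u basis_T /=.
rewrite !mul0r !add0r mulr1 /a /profile_a -!addrA; congr (_ + (_ + _)).
have E : Num.sqrt (3 / 2) * ((vel_sqr v - 3) / Num.sqrt 6) =
         (v.1.1 ^+ 2 - 3 + rperp v) * 2^-1 :> R.
  by rewrite mulrCA sqrt32_sqrt6 vel_sqrE /rperp; ring.
rewrite mulrAC -rmorphM E rmorphM fmorphV /= realC_nat.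
by rewrite rmorphD rmorphB rmorphXn /= realC_nat; field.
Qed.

(** The eigenvalue equation determines [f] pointwise from its five moments: [f] times
    the symbol $1+\tau\lambda+\mathrm i\tau k v_1$ is the polynomial [P5 f]. *)
Lemma eigenfunction_resolved :
  ae_equal f (fun v => w v.1.1 * (a v.1.1 + T / 2 * (rperp v)%:C)).
Proof.
have [_ _] := Hf; apply: filterS => v.
rewrite /Lk P5_profile vel_dot_wave_e1 => E.
have s0 := resolv_neq0 (tau * k) (v.1.1 : R) Re_resolv_gt0.
rewrite /w /resolv; apply: (mulfI s0); rewrite mulrA mulfV // mul1r.
set p := a _ + _ in E *.
have t0 : tau%:C != 0 :> C by rewrite eq_complex /= gt_eqF.
have : tau%:C * (- 'i * (k * v.1.1)%:C * f v - (tau^-1)%:C * (f v - p)) =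
       tau%:C * (lam * f v) by rewrite E.
rewrite /s fmorphV mulrBr !mulrA mulfV // mul1r => E'.
have -> : p = f v - (f v - p) by ring.
have -> : f v - p = tau%:C * - 'i * (k * v.1.1)%:C * f v - tau%:C * lam * f v.
  by rewrite -E'; ring.
by rewrite -(mulrA tau) [(tau * _)%:C]rmorphM; ring.
Qed.

Lemma temp1_profile : temp1 a.
Proof.
apply: temp1D; first (apply: temp1D; first exact: temp1_cst).
  by apply: temp1M; [exact: temp1_cst|exact: temp1_x].
apply: temp1M; last exact: temp1_cst.
apply: temp1M; first exact: temp1_cst.
by apply: temp1B; [apply: temp1X; exact: temp1_x|exact: temp1_cst].
Qed.

(** The resolvent depends on $v_1$ alone and [P5 f] is linear in $v_2^2+v_3^2$, so the
    transverse velocities integrate out explicitly. *)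
Lemma eigen_moment (e : Vel R -> R) (g0 g1 : R -> C) :
  measurable_fun setT e ->
  (forall v, (e v)%:C = g0 v.1.1 + g1 v.1.1 * (rperp v)%:C) ->
  temp1 g0 -> temp1 g1 ->
  ip f (fun v => (e v)%:C) =
  E1 (fun x => w x * (g0 x * (a x + T) + g1 x * (2 * a x + 4 * T))).
Proof.
move=> me eE t0 t1.
have [[[mrf mif _] _] _ _] := Hf.
have ta := temp1_profile; have tw := temp1_resolv (tau * k) Re_resolv_gt0.
pose h0 x := w x * (g0 x * a x).
pose h1 x := w x * (g0 x * (T / 2) + g1 x * a x).
pose h2 x := w x * (g1 x * (T / 2)).
have th0 : temp1 h0 by apply: temp1M => //; exact: temp1M.
have th1 : temp1 h1.
  apply: temp1M => //; apply: temp1D; apply: temp1M => //; exact: temp1_cst.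
have th2 : temp1 h2.
  by apply: temp1M => //; apply: temp1M => //; exact: temp1_cst.
transitivity (E3 (fun v => h0 (v.1.1 : R) + h1 (v.1.1 : R) * (rperp v)%:C
               + h2 (v.1.1 : R) * (rperp v)%:C ^+ 2)); last first.
  by rewrite E3_transverse //; apply: eq_wexp => x; rewrite /h0 /h1 /h2; field.
have tH : temp3 (fun v => h0 (v.1.1 : R) + h1 (v.1.1 : R) * (rperp v)%:C
               + h2 (v.1.1 : R) * (rperp v)%:C ^+ 2).
  have tr := @temp3_rperp R.
  apply: temp3D; first apply: temp3D; first exact: temp3_v1.
    by apply: temp3M => //; exact: temp3_v1.
  by apply: temp3M; [exact: temp3_v1|exact: temp3X].
have [mrH miH _] := tH; have mg := @measurable_gauss R.
rewrite (_ : ip f _ = Cintegral (@vel_measure R)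
    (fun v => f v * (e v)%:C * (gauss v)%:C)); last first.
  congr Cintegral; apply/funext => v; congr (_ * _ * _); exact: conjc_real.
rewrite /E3 /wexp; apply: ae_eq_Cintegral.
- under eq_fun do rewrite !Re_mulr_real.
  by apply: measurable_funM => //; exact: measurable_funM.
- under eq_fun do rewrite !Im_mulr_real.
  by apply: measurable_funM => //; exact: measurable_funM.
- by under eq_fun do rewrite Re_mulr_real; exact: measurable_funM.
- by under eq_fun do rewrite Im_mulr_real; exact: measurable_funM.
apply: filterS eigenfunction_resolved => v ->.
congr (_ * _).
by rewrite eE /h0 /h1 /h2; field.
Qed.

End Eigen.
End EigenMoments.

(** * Conservation laws of an eigenfunction *)

Section Closure.
Variable R : realType.
Local Notation C := R[i].
Implicit Types (ut T s : C) (X x : R).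

(** In terms of $z=\mathrm i x$ all coefficients below are rational, and the identities
    between them are identities of polynomials with rational coefficients. *)
Definition zvar (x : R) : C := 'i * x%:C.

Lemma temp1_zvar : temp1 zvar.
Proof. by apply: temp1M; [exact: temp1_cst|exact: temp1_x]. Qed.

Lemma zvar_sqr x : zvar x ^+ 2 = - x%:C ^+ 2.
Proof. by rewrite /zvar exprMn sqr_i mulN1r. Qed.

(** Moments of $z=\mathrm i x$ for a standard Gaussian $x$. *)
Fixpoint zmom (n : nat) : C :=
  match n with
  | 0 => 1 | 1 => 0
  | (n'.+1 as n'').+1 => - n''%:R * zmom n'
  end.

Lemma E1_zvar n : E1 (fun x => zvar x ^+ n) = zmom n.
Proof.
have E m : E1 (fun x => zvar x ^+ m) = 'i ^+ m * (gmom R m)%:C.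
  rewrite -E1_monomial -E1Z; last exact/temp1X/temp1_x.
  by apply: eq_wexp => x; rewrite exprMn.
elim/ltn_ind: n => -[|[|n]] IH.
- by rewrite E gmom0 mul1r.
- by rewrite E gmomS mul0r mulr0.
rewrite E gmomS /= -(IH n) ?ltnS // E.
by rewrite rmorphM /= realC_nat exprS exprS mulrA -expr2 sqr_i; ring.
Qed.

(** Polynomials are lists of coefficients in Horner form, which keeps evaluation, Gaussian
    expectation and multiplication computable. *)
Definition hpoly (cs : seq C) (z : C) : C := foldr (fun c acc => c + z * acc) 0 cs.

(** The expectation of [zvar ^+ n * hpoly cs zvar]. *)
Fixpoint zsum (n : nat) (cs : seq C) : C :=
  if cs is c :: cs' then c * zmom n + zsum n.+1 cs' else 0.

Lemma temp1_hpoly cs : temp1 (fun x => hpoly cs (zvar x)).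
Proof.
elim: cs => [|c cs IH] /=; first exact: temp1_cst.
apply: temp1D; first exact: temp1_cst.
by apply: temp1M; [exact: temp1_zvar|].
Qed.

Lemma E1_hpoly cs : E1 (fun x => hpoly cs (zvar x)) = zsum 0 cs.
Proof.
have -> : E1 (fun x => hpoly cs (zvar x)) =
          E1 (fun x => zvar x ^+ 0 * hpoly cs (zvar x)).
  by apply: eq_wexp => x; rewrite expr0 mul1r.
elim: cs 0%N => [|c cs IH] n /=.
  transitivity (E1 (fun x => 0 * zvar x ^+ n)).
    by apply: eq_wexp => x; rewrite mulr0 mul0r.
  by rewrite E1Z ?mul0r //; exact/temp1X/temp1_zvar.
transitivity (E1 (fun x => c * zvar x ^+ n + zvar x ^+ n.+1 * hpoly cs (zvar x))).
  by apply: eq_wexp => x; rewrite exprS; ring.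
have tz m : temp1 (fun x => zvar x ^+ m) by exact/temp1X/temp1_zvar.
rewrite E1D ?E1Z ?E1_zvar ?IH //.
  by apply: temp1M; [exact: temp1_cst|].
by apply: temp1M => //; exact: temp1_hpoly.
Qed.

(** The coefficients of [prev + (ut + z) * p]; in the recursion [prev] is the coefficient
    of [p] that the factor [z] moves up by one degree. *)
Fixpoint mul_shift (ut prev : C) (cs : seq C) : seq C :=
  if cs is c :: cs' then (ut * c + prev) :: mul_shift ut c cs' else [:: prev].

Lemma hpoly_mul_shift ut prev cs z :
  hpoly (mul_shift ut prev cs) z = prev + (ut + z) * hpoly cs z.
Proof. by elim: cs prev => [|c cs IH] prev /=; rewrite ?IH; ring. Qed.

Lemma E1_hpoly_eq (f : R -> C) cs : (forall x, f x = hpoly cs (zvar x)) ->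
  E1 f = zsum 0 cs.
Proof. by move=> H; rewrite -E1_hpoly; apply: eq_wexp. Qed.

Lemma E1_shift_pow ut cs n :
  E1 (fun x => (ut + zvar x) ^+ n * hpoly cs (zvar x)) =
  zsum 0 (iter n (mul_shift ut 0) cs).
Proof.
apply: E1_hpoly_eq => x; elim: n => [|n IH] /=; first by rewrite mul1r.
by rewrite hpoly_mul_shift add0r -IH exprS mulrA.
Qed.

(** [profile_a] as a polynomial in $z$. *)
Definition za ut T (z : C) : C := 1 + ut * z - T * (z ^+ 2 + 3) / 2.

Lemma profile_za ut T x : profile_a ut T x = za ut T (zvar x).
Proof. by rewrite /profile_a /za zvar_sqr /zvar; field. Qed.

(** Pressure deviator and heat flux of the profile, once the transverse
    velocities are integrated out. *)
Definition stress_p ut T (z : C) : C :=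
  - (2 / 3) * ((z ^+ 2 + 1) * za ut T z + T * (z ^+ 2 + 2)).
Definition heat_p ut T (z : C) : C :=
  z * ((z ^+ 2 + 3) * za ut T z + T * (z ^+ 2 + 1)).

Definition stress_cs ut T : seq C :=
  [:: - (2 / 3) * (1 + T / 2); - (2 / 3) * ut; - (2 / 3) * (1 - T);
      - (2 / 3) * ut; T / 3].
Definition heat_cs ut T : seq C :=
  [:: 0; 3 - 7 / 2 * T; 3 * ut; 1 - 2 * T; ut; - T / 2].

Lemma stress_csE ut T z : stress_p ut T z = hpoly (stress_cs ut T) z.
Proof. by rewrite /stress_p /za /=; field. Qed.

Lemma heat_csE ut T z : heat_p ut T z = hpoly (heat_cs ut T) z.
Proof. by rewrite /heat_p /za /=; field. Qed.

(** The resolvent in the scaled variables $X=\tau k$ and $\tilde u=\lambda/k$. *)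
Definition wz ut X (x : R) : C := (1 + X%:C * (ut + zvar x))^-1.

Lemma wz_resolv ut X x : wz ut X x = resolv (1 + X%:C * ut) X x.
Proof. by rewrite /wz /resolv /zvar rmorphM; congr _^-1; ring. Qed.

Lemma wz_mul ut X x : 0 < cRe (1 + X%:C * ut) ->
  wz ut X x * (1 + X%:C * (ut + zvar x)) = 1.
Proof.
move=> s0; rewrite /wz mulVf //.
by have := resolv_neq0 X x s0; rewrite rmorphM /zvar; congr (_ != 0); ring.
Qed.

Lemma temp1_wz ut X : 0 < cRe (1 + X%:C * ut) -> temp1 (wz ut X).
Proof.
move=> s0; rewrite (funext (wz_resolv ut X)).
exact: temp1_resolv.
Qed.

(** The flux [p] carried by the eigenfunction; for [stress_p] and [heat_p] it vanishes on
    the local equilibrium and measures the departure from it. *)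
Definition deviator (p : C -> C) ut X : C := E1 (fun x => wz ut X x * p (zvar x)).

(** The collision operator preserves the five moments. Hence, in the moments of
    $f\,(1+X(\tilde u+z))=P_5f$ against momentum and energy, the terms without the
    factor $X$ cancel, and dividing by $X$ leaves the balance of the fluxes. The three
    hypotheses say that the density, momentum and temperature of $f$ are those from
    which $P_5f$ was built. *)
Lemma conservation ut T X : 0 < X -> 0 < cRe (1 + X%:C * ut) ->
  deviator (fun z => za ut T z + T) ut X = 1 ->
  deviator (fun z => z * (za ut T z + T)) ut X = - ut ->
  deviator (fun z => - (z ^+ 2 + 1) * za ut T z + (1 - z ^+ 2) * T) ut X = 3 * T ->
  ut * ut = - (1 + T) - deviator (stress_p ut T) ut X /\
  ut * T = 2 / 3 * ut + 1 / 3 * deviator (heat_p ut T) ut X.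
Proof.
move=> X0 s0; rewrite /deviator => M0 M1 M2.
have tw := temp1_wz s0.
have X0' : X%:C != 0 :> C by rewrite eq_complex /= gt_eqF.
have tz := temp1_zvar.
have tc c : temp1 (fun=> c : C) by exact: temp1_cst.
have ta : temp1 (fun x => za ut T (zvar x)).
  by apply: temp1B; [apply: temp1D => //; exact: temp1M|
    apply: temp1M => //; apply: temp1M => //; apply: temp1D => //; exact: temp1X].
(* multiplying by a function g and using the resolvent identity *)
have bal g : temp1 g ->
    E1 g = (1 + X%:C * ut) * E1 (fun x => wz ut X x * g x)
           + X%:C * E1 (fun x => wz ut X x * (zvar x * g x)).
  move=> tg; rewrite -!E1Z; try by apply: temp1M => //; exact: temp1M.
  rewrite -E1D; try by apply: temp1M => //; apply: temp1M => //; exact: temp1M.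
  apply: eq_wexp => x.
  transitivity ((wz ut X x * (1 + X%:C * (ut + zvar x))) * g x); last by ring.
  by rewrite wz_mul // mul1r.
pose g0 x := za ut T (zvar x) + T.
pose g1 x := zvar x * (za ut T (zvar x) + T).
pose g2 x := - (zvar x ^+ 2 + 1) * za ut T (zvar x) + (1 - zvar x ^+ 2) * T.
have t0 : temp1 g0 by exact: temp1D.
have t1 : temp1 g1 by exact: temp1M.
have t2 : temp1 g2.
  apply: temp1D; apply: temp1M => //.
    by rewrite (_ : (fun x => _) = (fun x => -1 * (zvar x ^+ 2 + 1)));
      [apply: temp1M => //; apply: temp1D => //; exact: temp1X
      |apply/funext => x; rewrite mulN1r].
  by apply: temp1B => //; exact: temp1X.
have B1 := bal _ t1; have B2 := bal _ t2.
have E1g : E1 g1 = - ut.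
  rewrite (@E1_hpoly_eq g1 [:: 0; 1 - T / 2; ut; - T / 2]) /=; last first.
    by move=> x; rewrite /g1 /za /=; field.
  by field.
have E2g : E1 g2 = 3 * T.
  rewrite (@E1_hpoly_eq g2 [:: - 1 + 5 / 2 * T; - ut; - 1 + T; - ut; T / 2]) /=;
    last first.
    by move=> x; rewrite /g2 /za /=; field.
  by field.
have M0' : E1 (fun x => wz ut X x * g0 x) = 1 by [].
have M1' : E1 (fun x => wz ut X x * g1 x) = - ut by [].
have M2' : E1 (fun x => wz ut X x * g2 x) = 3 * T by [].
rewrite E1g M1' in B1; rewrite E2g M2' in B2.
have cancelX (m e : C) : m = (1 + X%:C * ut) * m + X%:C * e -> - (ut * m) = e.
  by move=> h; apply: (mulfI X0'); move: h; rewrite mulrDl mul1r -addrA => /eqP;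
    rewrite -subr_eq0 opprD addrA subrr sub0r oppr_eq0 addrC addr_eq0 => /eqP ->;
    rewrite mulrN mulrA.
have e1 : ut * ut = E1 (fun x => wz ut X x * (zvar x * g1 x)).
  by rewrite -(cancelX _ _ B1) mulrN opprK.
have e2 : - (3 * ut * T) = E1 (fun x => wz ut X x * (zvar x * g2 x)).
  by rewrite -(cancelX _ _ B2); ring.
have tS : temp1 (fun x => stress_p ut T (zvar x)).
  by rewrite (funext (fun x => stress_csE ut T (zvar x))); exact: temp1_hpoly.
have tQ : temp1 (fun x => heat_p ut T (zvar x)).
  by rewrite (funext (fun x => heat_csE ut T (zvar x))); exact: temp1_hpoly.
split.
  suff -> : ut * ut = - E1 (fun x => wz ut X x * g0 x)
      - 1 / 3 * E1 (fun x => wz ut X x * g2 x)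
      - E1 (fun x => wz ut X x * stress_p ut T (zvar x)).
    by rewrite M0' M2'; field.
  rewrite e1.
  transitivity (E1 (fun x => -1 * (wz ut X x * g0 x +
     1 / 3 * (wz ut X x * g2 x) + wz ut X x * stress_p ut T (zvar x)))).
    by apply: eq_wexp => x; rewrite /g0 /g1 /g2 /stress_p; field.
  have T0 : temp1 (fun x => wz ut X x * g0 x) by exact: temp1M.
  have T2 : temp1 (fun x => 1 / 3 * (wz ut X x * g2 x)).
    by apply: temp1M => //; exact: temp1M.
  have TS : temp1 (fun x => wz ut X x * stress_p ut T (zvar x)) by exact: temp1M.
  rewrite E1Z; last by apply: temp1D => //; exact: temp1D.
  rewrite E1D //; last exact: temp1D.
  rewrite E1D // E1Z; last exact: temp1M.
  by field.
suff -> : ut * T = - (2 / 3) * E1 (fun x => wz ut X x * g1 x)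
    + 1 / 3 * E1 (fun x => wz ut X x * heat_p ut T (zvar x)).
  by rewrite M1'; field.
have -> : ut * T = - (1 / 3) * E1 (fun x => wz ut X x * (zvar x * g2 x)).
  by rewrite -e2; field.
have T1 : temp1 (fun x => wz ut X x * g1 x) by exact: temp1M.
have T2 : temp1 (fun x => wz ut X x * (zvar x * g2 x)).
  by apply: temp1M => //; exact: temp1M.
have TQ : temp1 (fun x => wz ut X x * heat_p ut T (zvar x)) by exact: temp1M.
have -> : E1 (fun x => wz ut X x * (zvar x * g2 x)) =
   E1 (fun x => 2 * (wz ut X x * g1 x) + -1 * (wz ut X x * heat_p ut T (zvar x))).
  by apply: eq_wexp => x; rewrite /g1 /g2 /heat_p; field.
rewrite E1D ?E1Z //; try by apply: temp1M.
by field.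
Qed.

End Closure.

(** * Neumann series of the deviators *)

Section Remainder.
Variable R : realType.
Local Notation C := R[i].
Implicit Types (ut T : C) (X x : R).

(** The geometric series of the resolvent, stopped after [N] terms, with its exact remainder. *)
Lemma deviator_expansion (p : C -> C) cs ut X N : 0 < cRe (1 + X%:C * ut) ->
  (forall z, p z = hpoly cs z) ->
  deviator p ut X =
  \sum_(n < N) (- X%:C) ^+ n * zsum 0 (iter n (mul_shift ut 0) cs)
  + (- X%:C) ^+ N * E1 (fun x => wz ut X x * ((ut + zvar x) ^+ N * p (zvar x))).
Proof.
move=> s0 pE.
have tw := temp1_wz s0; have tz := @temp1_zvar R.
have ty : temp1 (fun x => ut + zvar x).
  by apply: temp1D => //; exact: temp1_cst.
have tp n : temp1 (fun x => (ut + zvar x) ^+ n * hpoly cs (zvar x)).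
  by apply: temp1M; [exact: temp1X|exact: temp1_hpoly].
rewrite /deviator (_ : p = hpoly cs); last exact/funext.
elim: N => [|N IH].
  by rewrite big_ord0 add0r mul1r; apply: eq_wexp => x; rewrite mul1r.
rewrite IH big_ord_recr /= -addrA; congr (_ + _).
rewrite exprSr -mulrA -mulrDr -E1_shift_pow; congr (_ * _).
rewrite -E1Z; last exact: temp1M.
rewrite -E1D //; last by apply: temp1M; [exact: temp1_cst|exact: temp1M].
apply: eq_wexp => x.
transitivity (wz ut X x * (1 + X%:C * (ut + zvar x) - X%:C * (ut + zvar x)) *
              ((ut + zvar x) ^+ N * hpoly cs (zvar x))).
  by rewrite addrK mulr1.
by rewrite mulrBr wz_mul // exprS; ring.
Qed.

Lemma normc_zvar x : normc (zvar x) <= q1 x.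
Proof.
rewrite /zvar normcM normc_i mul1r normc_real.
by have := monomial_le x 1; rewrite !expr1.
Qed.

Lemma hpoly_le cs x :
  normc (hpoly cs (zvar x)) <= (\sum_(c <- cs) normc c) * q1 x ^+ (size cs).
Proof.
have q0 : 1 <= q1 x by exact: q1_ge1.
have q00 := le_trans ler01 q0.
elim: cs => [|c cs IH]; rewrite [hpoly _ _]/=.
  by rewrite normc0 big_nil mul0r.
rewrite big_cons [size _]/= (le_trans (normcD _ _)) // mulrDl lerD //.
  by rewrite ler_peMr ?normc_ge0 // exprn_ege1.
by rewrite normcM exprS mulrCA ler_pM ?normc_ge0 // normc_zvar.
Qed.

(** The powers of the unbounded velocity in the remainder are dominated by Gaussian
    moments, uniformly in the wave number. *)
Lemma remainder_le N m (L : R) : 0 <= L -> exists2 K : R, 0 <= K &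
  forall ut X cs, normc ut <= L -> 2^-1 <= cRe (1 + X%:C * ut) ->
  size cs = m ->
  normc (E1 (fun x => wz ut X x * ((ut + zvar x) ^+ N * hpoly cs (zvar x))))
  <= K * \sum_(c <- cs) normc c.
Proof.
move=> L0; have [K0 K00 HK] := E1_bound R (N + m).
exists (K0 * (2 * (L + 1) ^+ N)); first by rewrite !mulr_ge0 // exprn_ge0 ?addr_ge0.
move=> ut X cs utL s2 sz.
have s0 : 0 < cRe (1 + X%:C * ut) by rewrite (lt_le_trans _ s2) // invr_gt0.
rewrite -mulrA; apply: HK.
  apply: temp1M; first exact: temp1_wz.
  apply: temp1M; last exact: temp1_hpoly.
  by apply: temp1X; apply: temp1D; [exact: temp1_cst|exact: temp1_zvar].
move=> x; have q0 : 1 <= q1 x by exact: q1_ge1.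
have q00 := le_trans ler01 q0.
rewrite !normcM normcX exprD -!mulrA; apply: ler_pM.
- exact: normc_ge0.
- by rewrite mulr_ge0 ?exprn_ge0 ?normc_ge0.
- rewrite wz_resolv (le_trans (resolv_le X x s0)) //.
  by rewrite -[leRHS]invrK lef_pV2 ?posrE ?invr_gt0.
rewrite (mulrCA (\sum_(_ <- _) _)) [leRHS]mulrA -exprMn.
have yq : normc (ut + zvar x) <= (L + 1) * q1 x.
  rewrite (le_trans (normcD _ _)) // mulrDl mul1r lerD ?normc_zvar //.
  by rewrite (le_trans utL) // ler_peMr.
apply: ler_pM; rewrite ?exprn_ge0 ?normc_ge0 //.
  by rewrite lerXn2r ?nnegrE ?normc_ge0 // (le_trans _ yq) ?normc_ge0.
by rewrite -sz hpoly_le.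
Qed.

Lemma stress_cs_le ut T (L : R) : normc ut <= L ->
  \sum_(c <- stress_cs ut T) normc c <= 3 * (1 + L) * (1 + normc T).
Proof.
move=> utL; have T0 := normc_ge0 T; have u0 := normc_ge0 ut.
have nat_norm n : normc (n%:R : C) = n%:R by rewrite -realC_nat normc_real normr_nat.
have e1 : normc (1 + T / 2) <= 1 + normc T / 2.
  by rewrite (le_trans (normcD _ _)) // normcM normcV normc1 nat_norm.
have e2 : normc (1 - T) <= 1 + normc T.
  by rewrite (le_trans (normcD _ _)) // normcN normc1.
rewrite /stress_cs !big_cons big_nil !normcM !normcN !normcM !normcV !nat_norm.
have : 0 <= L * normc T by rewrite mulr_ge0 // (le_trans u0).
lra.
Qed.

Lemma heat_cs_le ut T (L : R) : normc ut <= L ->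
  \sum_(c <- heat_cs ut T) normc c <= 7 * (1 + L) * (1 + normc T).
Proof.
move=> utL; have T0 := normc_ge0 T; have u0 := normc_ge0 ut.
have nat_norm n : normc (n%:R : C) = n%:R by rewrite -realC_nat normc_real normr_nat.
have e1 : normc (3 - 7 / 2 * T) <= 3 + 7 / 2 * normc T.
  by rewrite (le_trans (normcD _ _)) // normcN !normcM normcV !nat_norm.
have e2 : normc (1 - 2 * T) <= 1 + 2 * normc T.
  by rewrite (le_trans (normcD _ _)) // normcN normcM normc1 nat_norm.
rewrite /heat_cs !big_cons big_nil normc0 !normcM !normcN !normcV !nat_norm.
have : 0 <= L * normc T by rewrite mulr_ge0 // (le_trans u0).
lra.
Qed.

(** The expectations of $z^j$ times [stress_p], and below of $z^j$ times [heat_p]. They are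
    linear in the moments $(1, \tilde u, T)$, which makes a closure possible. *)
Definition stress_mom ut T (j : nat) : C :=
  nth 0 [:: 0; - (4 / 3) * ut; - (4 / 3) - 8 / 3 * T; 8 * ut; 8 + 24 * T] j.
Definition heat_mom ut T (j : nat) : C :=
  nth 0 [:: 0; 5 * T; - 6 * ut; - 6 - 33 * T; 60 * ut] j.

Definition binom_mom (mom : nat -> C) ut (n : nat) : C :=
  \sum_(j < n.+1) 'C(n, j)%:R * (ut ^+ (n - j) * mom j).

Lemma zsum_stress ut T n : (n < 5)%N ->
  zsum 0 (iter n (mul_shift ut 0) (stress_cs ut T)) =
  binom_mom (stress_mom ut T) ut n.
Proof.
rewrite /binom_mom.
case: n => [|[|[|[|[|//]]]]] _; rewrite !big_ord_recl big_ord0 /= /stress_mom /=.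
all: by rewrite ?/bump /= ?/binomial /=; field.
Qed.

Lemma zsum_heat ut T n : (n < 5)%N ->
  zsum 0 (iter n (mul_shift ut 0) (heat_cs ut T)) =
  binom_mom (heat_mom ut T) ut n.
Proof.
rewrite /binom_mom.
case: n => [|[|[|[|[|//]]]]] _; rewrite !big_ord_recl big_ord0 /= /heat_mom /=.
all: by rewrite ?/bump /= ?/binomial /=; field.
Qed.

End Remainder.

(** * Calculus of orders at zero *)

Section BigO.
Variable R : realType.
Local Notation C := R[i].
Implicit Types f g : R -> C.

Lemma bigO_near_eq n f g : (\forall k \near 0^'+, f k = g k) ->
  bigO_at0 n g -> bigO_at0 n f.
Proof.
move=> fg [M gM]; exists M.
by apply: filterS2 fg gM => k ->.
Qed.

Lemma bigO_eq n f g : f =1 g -> bigO_at0 n g -> bigO_at0 n f.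
Proof. by move=> /funext ->. Qed.

Lemma bigO_add n f g : bigO_at0 n f -> bigO_at0 n g ->
  bigO_at0 n (fun k => f k + g k).
Proof.
move=> [M fM] [N gN]; exists (M + N).
apply: filterS2 fM gN => k fM gN.
by rewrite (le_trans (normcD _ _)) // mulrDl lerD.
Qed.

Lemma bigO_mul n m f g : bigO_at0 n f -> bigO_at0 m g ->
  bigO_at0 (n + m) (fun k => f k * g k).
Proof.
move=> [M fM] [N gN]; exists (M * N).
apply: filterS2 fM gN => k fM gN.
by rewrite normcM exprD mulrACA ler_pM ?normc_ge0.
Qed.

Lemma bigO_cst c : bigO_at0 0 (fun=> c : C).
Proof. by exists (normc c); apply: nearW => k; rewrite expr0 mulr1. Qed.

Lemma bigO_id : bigO_at0 1 (fun k : R => k%:C).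
Proof.
exists 1; apply: filterS (nbhs_right_ge 0) => k k0.
by rewrite mul1r expr1 normc_real ger0_norm.
Qed.

Lemma bigO_opp n f : bigO_at0 n f -> bigO_at0 n (fun k => - f k).
Proof. by move=> [M fM]; exists M; apply: filterS fM => k; rewrite normcN. Qed.

Lemma bigO_sub n f g : bigO_at0 n f -> bigO_at0 n g ->
  bigO_at0 n (fun k => f k - g k).
Proof. by move=> Of Og; apply: bigO_add => //; exact: bigO_opp. Qed.

Lemma bigO_weak n m f : (m <= n)%N -> bigO_at0 n f -> bigO_at0 m f.
Proof.
move=> mn [M fM]; exists `|M|; near=> k.
have k0 : 0 <= k by near: k; exact: nbhs_right_ge.
have k1 : k <= 1 by near: k; exact: nbhs_right_le.
have fk : normc (f k) <= M * k ^+ n by near: k.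
rewrite (le_trans fk) // (le_trans (ler_norm _)) // normrM ler_wpM2l //.
by rewrite ger0_norm ?exprn_ge0 // ler_wiXn2l.
Unshelve. all: by end_near. Qed.

Lemma bigO_mul0l n f g : bigO_at0 0 f -> bigO_at0 n g ->
  bigO_at0 n (fun k => f k * g k).
Proof. exact: bigO_mul. Qed.

Lemma bigO_mul0r n f g : bigO_at0 n f -> bigO_at0 0 g ->
  bigO_at0 n (fun k => f k * g k).
Proof. by move=> Of Og; rewrite -(addn0 n); exact: bigO_mul. Qed.

Lemma bigO_scale n (c : C) f : bigO_at0 n f -> bigO_at0 n (fun k => c * f k).
Proof. by apply: bigO_mul0l; exact: bigO_cst. Qed.

Lemma bigO_exp n m f : bigO_at0 n f -> bigO_at0 (n * m) (fun k => f k ^+ m).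
Proof.
move=> Of; elim: m => [|m IH].
  by rewrite muln0; apply: (@bigO_eq _ _ (fun=> 1)) => //; exact: bigO_cst.
rewrite mulnS; apply: (@bigO_eq _ _ (fun k => f k * f k ^+ m)).
  by move=> k; rewrite exprS.
exact: bigO_mul.
Qed.

Lemma bigO_sum n (I : Type) (r : seq I) (F : I -> R -> C) :
  (forall i, bigO_at0 n (F i)) -> bigO_at0 n (fun k => \sum_(i <- r) F i k).
Proof.
move=> OF; elim: r => [|i r IH].
  apply: (@bigO_eq _ _ (fun=> 0)); first by move=> k; rewrite big_nil.
  exists 0; apply: nearW => k; by rewrite normc0 mul0r.
apply: (@bigO_eq _ _ (fun k => F i k + \sum_(i <- r) F i k)).
  by move=> k; rewrite big_cons.
exact: bigO_add.
Qed.

Lemma bigO_0 n : bigO_at0 n (fun=> 0 : C).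
Proof. by exists 0; apply: nearW => k; rewrite normc0 mul0r. Qed.

Lemma bigO_trans n f g h : bigO_at0 n (fun k => f k - g k) ->
  bigO_at0 n (fun k => g k - h k) -> bigO_at0 n (fun k => f k - h k).
Proof.
move=> fg gh; apply: (bigO_eq _ (bigO_add fg gh)) => k.
by rewrite addrA subrK.
Qed.

Lemma bigO0_of_sub n f g : bigO_at0 n (fun k => f k - g k) -> bigO_at0 0 g ->
  bigO_at0 0 f.
Proof.
move=> /(bigO_weak (leq0n n)) fg Og; apply: (bigO_eq _ (bigO_add fg Og)) => k.
by rewrite subrK.
Qed.

Lemma bigO_inv (f : R -> C) (c : C) : c != 0 ->
  bigO_at0 1 (fun k => f k - c) -> bigO_at0 0 (fun k => (f k)^-1) /\
  \forall k \near 0^'+, f k != 0.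
Proof.
move=> c0 [M fM].
have nc0 : 0 < normc c by rewrite normc_gt0.
have low : \forall k \near 0^'+, normc c / 2 <= normc (f k).
  near=> k; have fk : normc (f k - c) <= M * k ^+ 1 by near: k.
  have k0 : 0 <= k by near: k; exact: nbhs_right_ge.
  have kM : k <= normc c / 2 / (`|M| + 1).
    by near: k; apply: nbhs_right_le; rewrite !divr_gt0 // ltr_wpDl.
  have : M * k ^+ 1 <= normc c / 2.
    rewrite expr1 (le_trans (ler_norm _)) // normrM (ger0_norm k0).
    rewrite (@le_trans _ _ ((`|M| + 1) * k)) // ?ler_wpM2r ?lerDl //.
    by rewrite mulrC -ler_pdivlMr // ltr_wpDl.
  have nD : normc c <= normc (f k - c) + normc (f k).
    by have := normcD (- (f k - c)) (f k); rewrite normcN opprB subrK.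
  move: fk nD; lra.
split; last first.
  by apply: filterS low => k lk; rewrite -normc_gt0 (lt_le_trans _ lk) // divr_gt0.
exists (normc c / 2)^-1; apply: filterS low => k lk.
rewrite expr0 mulr1 normcV lef_pV2 ?posrE ?divr_gt0 //.
by rewrite (lt_le_trans _ lk) // divr_gt0.
Unshelve. all: by end_near. Qed.

Section Matrices.
Variables p q r : nat.

Definition bigOmx p q n (F : R -> 'M[C]_(p, q)) : Prop :=
  forall i j, bigO_at0 n (fun k => F k i j).

Lemma bigOmx_mul n m (F : R -> 'M[C]_(p, q)) (G : R -> 'M[C]_(q, r)) :
  bigOmx n F -> bigOmx m G -> bigOmx (n + m) (fun k => F k *m G k).
Proof.
move=> OF OG i j; apply: (@bigO_eq _ _ (fun k => \sum_l F k i l * G k l j)).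
  by move=> k; rewrite mxE.
by apply: bigO_sum => l; exact: bigO_mul.
Qed.

Lemma bigOmx_add n (F G : R -> 'M[C]_(p, q)) :
  bigOmx n F -> bigOmx n G -> bigOmx n (fun k => F k + G k).
Proof.
move=> OF OG i j; apply: (bigO_eq _ (bigO_add (OF i j) (OG i j))) => k.
by rewrite mxE.
Qed.

Lemma bigOmx_scale n m (f : R -> C) (F : R -> 'M[C]_(p, q)) :
  bigO_at0 n f -> bigOmx m F -> bigOmx (n + m) (fun k => f k *: F k).
Proof.
move=> Of OF i j; apply: (bigO_eq _ (bigO_mul Of (OF i j))) => k.
by rewrite mxE.
Qed.

Lemma bigOmx_sum n (I : Type) (s : seq I) (F : I -> R -> 'M[C]_(p, q)) :
  (forall i, bigOmx n (F i)) -> bigOmx n (fun k => \sum_(i <- s) F i k).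
Proof.
move=> OF i j; apply: (bigO_eq _ (bigO_sum s (fun l => OF l i j))) => k.
by rewrite summxE.
Qed.

Lemma bigOmx_eq n (F G : R -> 'M[C]_(p, q)) :
  F =1 G -> bigOmx n G -> bigOmx n F.
Proof. by move=> /funext ->. Qed.

Lemma bigOmx_weak n m (F : R -> 'M[C]_(p, q)) :
  (m <= n)%N -> bigOmx n F -> bigOmx m F.
Proof. by move=> mn OF i j; exact: bigO_weak mn (OF i j). Qed.

Lemma bigOmx_cst (A : 'M[C]_(p, q)) : bigOmx 0 (fun=> A).
Proof. by move=> i j; exact: bigO_cst. Qed.

Lemma bigOmx_0 n : bigOmx n (fun=> 0 : 'M[C]_(p, q)).
Proof. by move=> i j; apply: (bigO_eq _ (bigO_0 n)) => k; rewrite mxE. Qed.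

End Matrices.

Section Powers.
Variables (p n : nat) (A B : R -> 'M[C]_p.+1).
Hypotheses (OA : bigOmx 0 A) (OB : bigOmx 0 B).

Lemma bigOmx_exp l : bigOmx 0 (fun k => A k ^+ l).
Proof.
elim: l => [|l IH]; first exact: (bigOmx_cst 1).
apply: (@bigOmx_eq _ _ _ _ (fun k => A k *m A k ^+ l)).
  by move=> k; rewrite exprS.
exact: (bigOmx_mul OA IH).
Qed.

End Powers.

Lemma bigOmx_exp_sub p n l (A B : R -> 'M[C]_p.+1) :
  bigOmx 0 A -> bigOmx 0 B -> bigOmx n (fun k => A k - B k) ->
  bigOmx n (fun k => A k ^+ l - B k ^+ l).
Proof.
move=> OA OB OAB; elim: l => [|l IH].
  apply: (@bigOmx_eq _ _ _ _ (fun=> 0)); first by move=> k; rewrite !expr0 subrr.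
  exact: bigOmx_0.
apply: (@bigOmx_eq _ _ _ _ (fun k => A k *m (A k ^+ l - B k ^+ l) +
                                     (A k - B k) *m B k ^+ l)).
  by move=> k; rewrite !exprS /= mulmxBr mulmxBl addrA subrK.
apply: bigOmx_add; first exact: (bigOmx_mul OA IH).
by rewrite -(addn0 n); apply: (bigOmx_mul OAB); exact: bigOmx_exp.
Qed.

End BigO.

(** * Slow modes and their temperature *)

Section ChapmanEnskog.
Variable R : realType.
Local Notation C := R[i].
Implicit Types (ut T : R -> C).

Definition row3 (a b c : C) : 'rV[C]_3 := \row_j [:: a; b; c]`_j.
Definition moments (u t : C) : 'cV[C]_3 := \col_j [:: 1; u; t]`_j.
(** The generator acting on (density, velocity, temperature), scaled by the wave number;
    its first row is the conservation of mass. *)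
Definition closure_mx (b1 b2 b3 b4 b5 b6 : C) : 'M[C]_3 :=
  \matrix_(i, j)
    (nth [::] [:: [:: 0; 1; 0]; [:: b1; b2; b3]; [:: b4; b5; b6]] i)`_j.

Lemma row3_moments a b c u t : (row3 a b c *m moments u t) 0 0 = a + b * u + c * t.
Proof. by rewrite mxE !big_ord_recl big_ord0 !mxE /= mulr1 addr0 addrA. Qed.

Lemma row3_eta (r : 'rV[C]_3) : r = row3 (r 0 0) (r 0 1) (r 0 2%:R).
Proof.
apply/rowP => j; rewrite mxE.
by case: j => -[|[|[|//]]] p /=; congr (r _ _); exact: val_inj.
Qed.

Lemma row3_closure a b c b1 b2 b3 b4 b5 b6 :
  row3 a b c *m closure_mx b1 b2 b3 b4 b5 b6 =
  row3 (b * b1 + c * b4) (a + b * b2 + c * b5) (b * b3 + c * b6).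
Proof.
apply/rowP => j; rewrite mxE !big_ord_recl big_ord0 !mxE /=.
by case: j => -[|[|[|//]]] p /=; rewrite ?mulr0 ?mulr1 ?add0r ?addr0 ?addrA.
Qed.

Lemma row3D a b c a' b' c' :
  row3 a b c + row3 a' b' c' = row3 (a + a') (b + b') (c + c').
Proof. by apply/rowP => j; rewrite !mxE; case: j => -[|[|[|//]]]. Qed.

Lemma row3Z x a b c : x *: row3 a b c = row3 (x * a) (x * b) (x * c).
Proof. by apply/rowP => j; rewrite !mxE; case: j => -[|[|[|//]]]. Qed.

Lemma row3N a b c : - row3 a b c = row3 (- a) (- b) (- c).
Proof. by apply/rowP => j; rewrite !mxE; case: j => -[|[|[|//]]]. Qed.

Definition stress_rows : nat -> 'rV[C]_3 := nth 0
  [:: 0; row3 0 (- (4 / 3)) 0; row3 (- (4 / 3)) 0 (- (8 / 3));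
      row3 0 8 0; row3 8 0 24].
Definition heat_rows : nat -> 'rV[C]_3 := nth 0
  [:: 0; row3 0 0 5; row3 0 (- 6) 0; row3 (- 6) 0 (- 33); row3 0 60 0].

Lemma stress_rowsE u t j : (j < 5)%N ->
  stress_mom u t j = (stress_rows j *m moments u t) 0 0.
Proof.
case: j => [|[|[|[|[|//]]]]] _; rewrite /stress_mom /stress_rows [nth _ _ _]/= [nth _ _ _]/=.
  by rewrite mul0mx mxE.
all: by rewrite row3_moments; field.
Qed.

Lemma heat_rowsE u t j : (j < 5)%N ->
  heat_mom u t j = (heat_rows j *m moments u t) 0 0.
Proof.
case: j => [|[|[|[|[|//]]]]] _; rewrite /heat_mom /heat_rows [nth _ _ _]/= [nth _ _ _]/=.
  by rewrite mul0mx mxE.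
all: by rewrite row3_moments; field.
Qed.

(** Four orders of the Neumann series, with powers of the eigenvalue replaced
    by powers of the closed generator [B]. *)
Definition neumann4 (L : nat -> 'rV[C]_3) (X : C) (B : 'M[C]_3) : 'rV[C]_3 :=
  \sum_(n < 5) (- X) ^+ n *:
    \sum_(j < n.+1) 'C(n, j)%:R *: (L j *m B ^+ (n - j)).

Lemma eigen_exp (B : 'M[C]_3) (v : 'cV[C]_3) u l :
  B *m v = u *: v -> B ^+ l *m v = u ^+ l *: v.
Proof.
move=> Bv; elim: l => [|l IH]; first by rewrite mul1mx scale1r.
by rewrite !exprS /= -mulmxA IH -scalemxAr Bv scalerA mulrC.
Qed.

(** On an eigenvector of [B] the powers of [B] become powers of the eigenvalue. *)
Lemma neumann4_moments (L : nat -> 'rV[C]_3) (mom : nat -> C) X B u t :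
  (forall j, (j < 5)%N -> mom j = (L j *m moments u t) 0 0) ->
  B *m moments u t = u *: moments u t ->
  (neumann4 L X B *m moments u t) 0 0 =
  \sum_(n < 5) (- X) ^+ n * binom_mom mom u n.
Proof.
move=> momE Bm; rewrite /neumann4 mulmx_suml summxE.
apply: eq_bigr => n _; rewrite -scalemxAl mxE; congr (_ * _).
rewrite mulmx_suml summxE; apply: eq_bigr => j _.
rewrite -scalemxAl mxE -mulmxA (eigen_exp _ Bm) -scalemxAr mxE momE //.
by rewrite (leq_trans (ltn_ord j)).
Qed.

(** The matrix enters [neumann4] only from the term quadratic in [X] on, because [L 0 = 0];
    this is the gain of two orders on which the bootstrap rests. *)
Lemma neumann4_sub L (A B : R -> 'M[C]_3) (X : R -> C) n : L 0%N = 0 ->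
  bigO_at0 1 X -> bigOmx 0 A -> bigOmx 0 B ->
  bigOmx n (fun k => A k - B k) ->
  bigOmx n.+2 (fun k => neumann4 L (X k) (A k) - neumann4 L (X k) (B k)).
Proof.
move=> L0 OX OA OB OAB.
apply: (@bigOmx_eq _ _ _ _ _ (fun k => \sum_(m < 5) (- X k) ^+ m *:
    \sum_(j < m.+1) 'C(m, j)%:R *: (L j *m (A k ^+ (m - j) - B k ^+ (m - j))))).
  move=> k; rewrite /neumann4 -sumrB; apply: eq_bigr => m _.
  rewrite -scalerBr -sumrB; congr (_ *: _); apply: eq_bigr => j _.
  by rewrite -scalerBr mulmxBr.
apply: bigOmx_sum => m.
have Om : bigO_at0 m (fun k => (- X k) ^+ m).
  by have := bigO_exp m (bigO_opp OX); rewrite mul1n.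
have [m2|m2] := leqP 2 m.
  apply: (@bigOmx_weak _ _ _ (m + n)); first by rewrite -addn2 addnC leq_add2r.
  apply: bigOmx_scale => //; apply: bigOmx_sum => j.
  rewrite -(add0n n); apply: bigOmx_scale; first exact: bigO_cst.
  rewrite -(add0n n); apply: bigOmx_mul; first exact: bigOmx_cst.
  exact: bigOmx_exp_sub.
apply: (@bigOmx_eq _ _ _ _ _ (fun=> 0)); last exact: bigOmx_0.
move=> k; rewrite big1 ?scaler0 // => j _.
case: m m2 j {Om} => -[|[|//]] /= _ _ [[|[|//]] //= _];
  by rewrite ?expr0 ?subrr ?mulmx0 ?L0 ?mul0mx ?scaler0.
Qed.

Section Modes.
Variable tau : R.
Hypothesis tau_gt0 : 0 < tau.

(** A branch of eigenvalues with phase velocity [ut] tending to [c], together with the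
    exact balance of momentum and energy along it. *)
Definition slow_mode (c : C) ut T : Prop :=
  bigO_at0 1 (fun k => ut k - c) /\
  \forall k \near 0^'+,
    ut k * ut k = - (1 + T k)
      - deviator (stress_p (ut k) (T k)) (ut k) (tau * k) /\
    ut k * T k = 2 / 3 * ut k
      + 1 / 3 * deviator (heat_p (ut k) (T k)) (ut k) (tau * k).

Lemma bigO_bound0 (f : R -> C) : bigO_at0 0 f ->
  exists2 M : R, 0 <= M & \forall k \near 0^'+, normc (f k) <= M.
Proof.
move=> [M fM]; exists `|M| => //; apply: filterS fM => k.
by rewrite expr0 mulr1 => /le_trans; apply; exact: ler_norm.
Qed.

Lemma mode_bounded c ut T : slow_mode c ut T -> bigO_at0 0 ut.
Proof. by move=> [uc _]; apply: bigO0_of_sub uc _; exact: bigO_cst. Qed.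

(** For small [k] the resolvent stays away from its singularities. *)
Lemma near_half ut : bigO_at0 0 ut ->
  \forall k \near 0^'+, 2^-1 <= cRe (1 + (tau * k)%:C * ut k).
Proof.
move=> /bigO_bound0[M M0 uM]; near=> k.
have k0 : 0 <= k by near: k; exact: nbhs_right_ge.
have uk : normc (ut k) <= M by near: k.
have kM : k <= 2^-1 / (tau * (M + 1)).
  by near: k; apply: nbhs_right_le; rewrite divr_gt0 ?invr_gt0 ?mulr_gt0 ?ltr_wpDl.
have small : normc ((tau * k)%:C * ut k) <= 2^-1.
  rewrite normcM normc_real ger0_norm ?mulr_ge0 ?(ltW tau_gt0) //.
  apply: (@le_trans _ _ (tau * k * (M + 1))).
    by rewrite ler_wpM2l ?mulr_ge0 ?(ltW tau_gt0) // (le_trans uk) // lerDl.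
  by rewrite mulrAC mulrC -ler_pdivlMr ?mulr_gt0 ?ltr_wpDl.
have := le_trans (Re_le_normc _) small; rewrite ler_norml => /andP[+ _].
rewrite Re_add /=; lra.
Unshelve. all: by end_near. Qed.

(** [deviator_expansion] along a branch, with a bound on the remainder that depends on the
    branch only through its temperature. *)
Lemma deviator_approx (p : C -> C -> C -> C) (cs : C -> C -> seq C)
    (mom : C -> C -> nat -> C) (K0 : R) N ut T :
  (forall u t z, p u t z = hpoly (cs u t) z) ->
  (forall u t, size (cs u t) = size (cs 0 0)) ->
  (forall u t L, normc u <= L ->
     \sum_(c <- cs u t) normc c <= K0 * (1 + L) * (1 + normc t)) ->
  (forall u t n, (n < 5)%N -> zsum 0 (iter n (mul_shift u 0) (cs u t)) =
     binom_mom (mom u t) u n) ->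
  (N <= 5)%N -> bigO_at0 0 ut ->
  exists2 K : R, 0 <= K & \forall k \near 0^'+,
    normc (deviator (p (ut k) (T k)) (ut k) (tau * k) -
       \sum_(n < N) (- (tau * k)%:C) ^+ n * binom_mom (mom (ut k) (T k)) (ut k) n)
    <= K * k ^+ N * (1 + normc (T k)).
Proof.
move=> pE szE csE zE N5 Ou; have [M M0 uM] := bigO_bound0 Ou.
have half := near_half Ou.
have [K1 K10 HK] := @remainder_le R N (size (cs 0 0)) M M0.
exists (tau ^+ N * (K1 * `|K0 * (1 + M)|)).
  by rewrite !mulr_ge0 ?exprn_ge0 ?(ltW tau_gt0).
near=> k.
have k0 : 0 <= k by near: k; exact: nbhs_right_ge.
have uk : normc (ut k) <= M by near: k.
have hk : 2^-1 <= cRe (1 + (tau * k)%:C * ut k) by near: k.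
have s0 : 0 < cRe (1 + (tau * k)%:C * ut k).
  by rewrite (lt_le_trans _ hk) // invr_gt0.
rewrite (deviator_expansion N s0 (pE (ut k) (T k))).
rewrite (eq_bigr (fun n : 'I_N => (- (tau * k)%:C) ^+ n *
   binom_mom (mom (ut k) (T k)) (ut k) n)); last first.
  by move=> n _; rewrite zE // (leq_trans (ltn_ord n)).
rewrite addrAC subrr add0r normcM normcX normcN normc_real.
rewrite ger0_norm ?mulr_ge0 ?(ltW tau_gt0) // exprMn.
rewrite [leRHS](_ : _ = tau ^+ N * k ^+ N *
  (K1 * (`|K0 * (1 + M)| * (1 + normc (T k))))); last by ring.
rewrite ler_wpM2l ?mulr_ge0 ?exprn_ge0 ?(ltW tau_gt0) //.
have -> : E1 (fun x => wz (ut k) (tau * k) x *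
     ((ut k + zvar x) ^+ N * p (ut k) (T k) (zvar x))) =
   E1 (fun x => wz (ut k) (tau * k) x *
     ((ut k + zvar x) ^+ N * hpoly (cs (ut k) (T k)) (zvar x))).
  by apply: eq_wexp => x; rewrite pE.
apply: le_trans (HK _ _ _ uk hk (szE _ _)) _.
rewrite ler_wpM2l // (le_trans (csE _ _ _ uk)) //.
by rewrite ler_wpM2r ?addr_ge0 ?normc_ge0 // ler_norm.
Unshelve. all: by end_near. Qed.

Lemma stress_approx N ut T : (N <= 5)%N -> bigO_at0 0 ut ->
  exists2 K : R, 0 <= K & \forall k \near 0^'+,
    normc (deviator (stress_p (ut k) (T k)) (ut k) (tau * k) -
       \sum_(n < N) (- (tau * k)%:C) ^+ n *
         binom_mom (stress_mom (ut k) (T k)) (ut k) n)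
    <= K * k ^+ N * (1 + normc (T k)).
Proof.
by apply: (@deviator_approx _ (@stress_cs R) _ 3) => //;
  [exact: stress_csE|exact: stress_cs_le|exact: zsum_stress].
Qed.

Lemma heat_approx N ut T : (N <= 5)%N -> bigO_at0 0 ut ->
  exists2 K : R, 0 <= K & \forall k \near 0^'+,
    normc (deviator (heat_p (ut k) (T k)) (ut k) (tau * k) -
       \sum_(n < N) (- (tau * k)%:C) ^+ n *
         binom_mom (heat_mom (ut k) (T k)) (ut k) n)
    <= K * k ^+ N * (1 + normc (T k)).
Proof.
by apply: (@deviator_approx _ (@heat_cs R) _ 7) => //;
  [exact: heat_csE|exact: heat_cs_le|exact: zsum_heat].
Qed.

(** To leading order the pressure of a slow mode is that of an ideal gas, which
    fixes its temperature in terms of its phase velocity. *)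
Lemma mode_temperature c ut T : slow_mode c ut T ->
  bigO_at0 0 T /\ bigO_at0 1 (fun k => T k - (- (1 + c * c))).
Proof.
move=> [uc eqs]; have Ou : bigO_at0 0 ut by apply: mode_bounded; split; eassumption.
have [K K0 HK] := @stress_approx 1 ut T isT Ou.
have dev1 : \forall k \near 0^'+,
    normc (T k + (1 + ut k * ut k)) <= K * k * (1 + normc (T k)).
  apply: filterS2 eqs HK => k [e _].
  rewrite big_ord1 expr0 mul1r /binom_mom big_ord1 [stress_mom _ _ _]/= !mulr0 subr0.
  rewrite expr1 (_ : deviator _ _ _ = - (T k + (1 + ut k * ut k))) ?normcN //.
  by rewrite e; ring.
have [M M0 uM] := bigO_bound0 (bigO_mul Ou Ou).
have OT : bigO_at0 0 T.
  exists (2 * (2 + M)); near=> k; rewrite expr0 mulr1.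
  have k0 : 0 <= k by near: k; exact: nbhs_right_ge.
  have uk : normc (ut k * ut k) <= M by near: k.
  have dk : normc (T k + (1 + ut k * ut k)) <= K * k * (1 + normc (T k)) by near: k.
  have kK : k <= 2^-1 / (K + 1).
    by near: k; apply: nbhs_right_le; rewrite divr_gt0 ?invr_gt0 ?ltr_wpDl.
  have Kk : K * k <= 2^-1.
    apply: (@le_trans _ _ ((K + 1) * k)); first by rewrite ler_wpM2r // lerDl.
    by rewrite mulrC -ler_pdivlMr ?ltr_wpDl.
  have T0 := normc_ge0 (T k).
  have t1 : normc (T k) <= normc (T k + (1 + ut k * ut k)) + normc (1 + ut k * ut k).
    have := normcD (T k + (1 + ut k * ut k)) (- (1 + ut k * ut k)).
    by rewrite addrK normcN.
  have t2 : normc (1 + ut k * ut k) <= 1 + M.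
    by rewrite (le_trans (normcD _ _)) // normc1 lerD2l.
  have t3 : K * k * (1 + normc (T k)) <= 2^-1 * (1 + normc (T k)).
    by rewrite ler_wpM2r // addr_ge0.
  move: t1 t2 t3 dk T0; lra.
split=> //.
have [M' M'0 TM] := bigO_bound0 OT.
apply: (@bigO_trans _ _ _ (fun k => - (1 + ut k * ut k))).
  exists (K * (1 + M')); near=> k.
  have k0 : 0 <= k by near: k; exact: nbhs_right_ge.
  have dk : normc (T k + (1 + ut k * ut k)) <= K * k * (1 + normc (T k)) by near: k.
  have Tk : normc (T k) <= M' by near: k.
  rewrite opprK expr1 (le_trans dk) // mulrAC.
  by rewrite ler_wpM2r // ler_wpM2l // lerD2l.
apply: (@bigO_eq _ _ _ (fun k => - ((ut k - c) * (ut k + c)))).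
  by move=> k; ring.
apply: bigO_opp; apply: bigO_mul0r => //.
by apply: bigO_add => //; exact: bigO_cst.
Unshelve. all: by end_near. Qed.

End Modes.
End ChapmanEnskog.

(** * Closure of the three slow modes *)

Section ThreeModes.
Variable R : realType.
Local Notation C := R[i].
Implicit Types u t : R -> C.

Lemma bigO_mul_sub (f g : R -> C) a b : bigO_at0 1 (fun k => f k - a) ->
  bigO_at0 1 (fun k => g k - b) -> bigO_at0 1 (fun k => f k * g k - a * b).
Proof.
move=> fa gb; have Og : bigO_at0 0 g by apply: bigO0_of_sub gb (bigO_cst b).
apply: (bigO_eq _ (bigO_add (bigO_mul0r fa Og) (bigO_scale a gb))) => k.
by ring.
Qed.

Variable tau : R.
Hypothesis tau_gt0 : 0 < tau.
Variables (w : C) (ud ua uc td ta tc : R -> C).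
Hypotheses (w_neq0 : w != 0) (w_sqr : w * w = - (5 / 3)).
Hypothesis Md : slow_mode tau 0 ud td.
Hypothesis Ma : slow_mode tau w ua ta.
Hypothesis Mc : slow_mode tau (- w) uc tc.

Let Oud : bigO_at0 0 ud := mode_bounded Md.
Let Oua : bigO_at0 0 ua := mode_bounded Ma.
Let Ouc : bigO_at0 0 uc := mode_bounded Mc.
Let Otd : bigO_at0 0 td := (mode_temperature tau_gt0 Md).1.
Let Ota : bigO_at0 0 ta := (mode_temperature tau_gt0 Ma).1.
Let Otc : bigO_at0 0 tc := (mode_temperature tau_gt0 Mc).1.

Let det3 k := (ua k * tc k - uc k * ta k) - (ud k * tc k - uc k * td k)
              + (ud k * ta k - ua k * td k).

(** In the limit the three slow eigenvectors are independent, so a row vector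
    is controlled by its values on them. *)
Lemma three_modes n (r : R -> 'rV[C]_3) :
  bigO_at0 n (fun k => (r k *m moments (ud k) (td k)) 0 0) ->
  bigO_at0 n (fun k => (r k *m moments (ua k) (ta k)) 0 0) ->
  bigO_at0 n (fun k => (r k *m moments (uc k) (tc k)) 0 0) ->
  bigOmx n r.
Proof.
set e1 := fun k => (r k *m moments (ud k) (td k)) 0 0.
set e2 := fun k => (r k *m moments (ua k) (ta k)) 0 0.
set e3 := fun k => (r k *m moments (uc k) (tc k)) 0 0.
move=> O1 O2 O3.
have Td := (mode_temperature tau_gt0 Md).2; have Ta := (mode_temperature tau_gt0 Ma).2.
have Tc := (mode_temperature tau_gt0 Mc).2.
have [Ud _] := Md; have [Ua _] := Ma; have [Uc _] := Mc.
have D0 : bigO_at0 1 (fun k => det3 k - 10 / 3 * w).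
  have S1 := bigO_sub (bigO_mul_sub Ua Tc) (bigO_mul_sub Uc Ta).
  have S2 := bigO_sub (bigO_mul_sub Ud Tc) (bigO_mul_sub Uc Td).
  have S3 := bigO_sub (bigO_mul_sub Ud Ta) (bigO_mul_sub Ua Td).
  apply: (bigO_eq _ (bigO_add (bigO_sub S1 S2) S3)) => k.
  have cE : 10 / 3 * w = - (2 * w * (1 + w * w)) + 2 * w by rewrite w_sqr; field.
  by rewrite /det3 cE; ring.
have c0 : 10 / 3 * w != 0 by rewrite !mulf_neq0 ?invr_eq0 ?pnatr_eq0.
have [OD Dn0] := bigO_inv c0 D0.
have rE k : r k = row3 (r k 0 0) (r k 0 1) (r k 0 2%:R) by exact: row3_eta.
have e1E k : e1 k = r k 0 0 + r k 0 1 * ud k + r k 0 2%:R * td k.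
  by rewrite /e1 {1}rE row3_moments.
have e2E k : e2 k = r k 0 0 + r k 0 1 * ua k + r k 0 2%:R * ta k.
  by rewrite /e2 {1}rE row3_moments.
have e3E k : e3 k = r k 0 0 + r k 0 1 * uc k + r k 0 2%:R * tc k.
  by rewrite /e3 {1}rE row3_moments.
(* Cramer's rule *)
have cramer (x p1 p2 p3 : R -> C) : bigO_at0 0 p1 -> bigO_at0 0 p2 -> bigO_at0 0 p3 ->
    (forall k, x k * det3 k = e1 k * p1 k + e2 k * p2 k + e3 k * p3 k) ->
    bigO_at0 n x.
  move=> P1 P2 P3 xE.
  have OE := bigO_mul0r (bigO_add (bigO_add (bigO_mul0r O1 P1) (bigO_mul0r O2 P2))
                          (bigO_mul0r O3 P3)) OD.
  apply: (bigO_near_eq _ OE).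
  by apply: filterS Dn0 => k Dk; rewrite -xE mulfK.
have OMM f g f' g' : bigO_at0 0 f -> bigO_at0 0 g -> bigO_at0 0 f' -> bigO_at0 0 g' ->
    bigO_at0 0 (fun k => f k * g k - f' k * g' k : C).
  by move=> *; apply: bigO_sub; exact: bigO_mul0l.
have r0 : bigO_at0 n (fun k => r k 0 0).
  apply: (cramer _ (fun k => ua k * tc k - uc k * ta k)
    (fun k => uc k * td k - ud k * tc k) (fun k => ud k * ta k - ua k * td k));
    try exact: OMM.
  by move=> k; rewrite e1E e2E e3E /det3; ring.
have r1 : bigO_at0 n (fun k => r k 0 1).
  apply: (cramer _ (fun k => ta k - tc k) (fun k => tc k - td k)
    (fun k => td k - ta k)); try exact: bigO_sub.
  by move=> k; rewrite e1E e2E e3E /det3; ring.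
have r2 : bigO_at0 n (fun k => r k 0 2%:R).
  apply: (cramer _ (fun k => uc k - ua k) (fun k => ud k - uc k)
    (fun k => ua k - ud k)); try exact: bigO_sub.
  by move=> k; rewrite e1E e2E e3E /det3; ring.
move=> i j; rewrite (ord1 i).
case: j => -[|[|[|//]]] p.
- by apply: (bigO_eq _ r0) => k; congr (r k _ _); exact: val_inj.
- by apply: (bigO_eq _ r1) => k; congr (r k _ _); exact: val_inj.
- by apply: (bigO_eq _ r2) => k; congr (r k _ _); exact: val_inj.
Qed.

Variables b1 b2 b3 b4 b5 b6 : R -> C.
Let solves_row (u t : R -> C) : Prop := \forall k \near 0^'+,
  b1 k + b2 k * u k + b3 k * t k = u k * u k /\
  b4 k + b5 k * u k + b6 k * t k = u k * t k.
Hypotheses (Bd : solves_row ud td) (Ba : solves_row ua ta) (Bc : solves_row uc tc).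

Let B k := closure_mx (b1 k) (b2 k) (b3 k) (b4 k) (b5 k) (b6 k).
Let X k : C := (tau * k)%:C.

Let OX : bigO_at0 1 X.
Proof.
by apply: (bigO_eq _ (bigO_scale tau%:C (@bigO_id R))) => k; rewrite /X rmorphM.
Qed.

Let row2 k := row3 (b1 k) (b2 k) (b3 k).
Let row4 k := row3 (b4 k) (b5 k) (b6 k).

Let rows_bounded : bigOmx 0 row2 /\ bigOmx 0 row4.
Proof.
have E u t : solves_row u t -> bigO_at0 0 u -> bigO_at0 0 t ->
    bigO_at0 0 (fun k => (row2 k *m moments (u k) (t k)) 0 0) /\
    bigO_at0 0 (fun k => (row4 k *m moments (u k) (t k)) 0 0).
  move=> S Ou Ot; split.
    apply: (bigO_near_eq _ (bigO_mul0l Ou Ou)).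
    by apply: filterS S => k [e _]; rewrite /row2 row3_moments e.
  apply: (bigO_near_eq _ (bigO_mul0l Ou Ot)).
  by apply: filterS S => k [_ e]; rewrite /row4 row3_moments e.
have [d2 d4] := E _ _ Bd Oud Otd; have [a2 a4] := E _ _ Ba Oua Ota.
have [c2 c4] := E _ _ Bc Ouc Otc.
by split; exact: three_modes.
Qed.

Lemma closure_mx_moments k (u t : C) :
  b1 k + b2 k * u + b3 k * t = u * u -> b4 k + b5 k * u + b6 k * t = u * t ->
  B k *m moments u t = u *: moments u t.
Proof.
move=> e2 e3; apply/colP => i; rewrite !mxE !big_ord_recl big_ord0 !mxE /=.
case: i => -[|[|[|//]]] p /=.
- by ring.
- by rewrite -e2; ring.
- by rewrite -e3; ring.
Qed.

Let defect2 k := row2 k + row3 1 0 1 + neumann4 (@stress_rows R) (X k) (B k).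
Let defect4 k := row4 k - row3 0 (2 / 3) 0 - (1 / 3) *: neumann4 (@heat_rows R) (X k) (B k).

Let mode_residual c u t (F dv sm : R -> C) (a : C) K : slow_mode tau c u t ->
  normc a <= 1 -> 0 <= K -> (\forall k \near 0^'+, F k = a * (dv k - sm k)) ->
  (\forall k \near 0^'+, normc (dv k - sm k) <= K * k ^+ 5 * (1 + normc (t k))) ->
  bigO_at0 5 F.
Proof.
move=> M a1 K0 FE A; have [Ot _] := mode_temperature tau_gt0 M.
have [T0 T00 HT] := bigO_bound0 Ot; exists (K * (1 + T0)); near=> k.
have k0 : 0 <= k by near: k; exact: nbhs_right_ge.
have tk : normc (t k) <= T0 by near: k.
have Fk : F k = a * (dv k - sm k) by near: k.
have ak : normc (dv k - sm k) <= K * k ^+ 5 * (1 + normc (t k)) by near: k.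
rewrite Fk normcM (le_trans (ler_piMl (normc_ge0 _) a1)) // (le_trans ak) //.
by rewrite [leRHS]mulrAC ler_wpM2l ?mulr_ge0 ?exprn_ge0 // lerD2l.
Unshelve. all: by end_near. Qed.

(** On each mode the residual is the remainder of the Neumann series after five terms; a
    row that is small on the three modes is small. *)
Let defects : bigOmx 5 defect2 /\ bigOmx 5 defect4.
Proof.
have E c u t : slow_mode tau c u t -> solves_row u t ->
    bigO_at0 5 (fun k => (defect2 k *m moments (u k) (t k)) 0 0) /\
    bigO_at0 5 (fun k => (defect4 k *m moments (u k) (t k)) 0 0).
  move=> M S; have Ou := mode_bounded M; have [_ eqs] := M.
  have [K2 K20 A2] := stress_approx tau_gt0 t (leqnn 5) Ou.
  have [K4 K40 A4] := heat_approx tau_gt0 t (leqnn 5) Ou.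
  split.
    apply: (mode_residual M (a := -1) _ K20 _ A2); first by rewrite normcN normc1.
    apply: filterS2 eqs S => k [q2 _] [s2 s4].
    rewrite /defect2 !mulmxDl mxE mxE /row2 !row3_moments.
    rewrite (neumann4_moments (X k) (@stress_rowsE R (u k) (t k))
              (closure_mx_moments s2 s4)).
    by rewrite s2 q2 /X; ring.
  apply: (mode_residual M (a := 1 / 3) _ K40 _ A4).
    rewrite normcM normcV normc1 mul1r -realC_nat normc_real normr_nat.
    by rewrite invf_le1 // ler1n.
  apply: filterS2 eqs S => k [_ q4] [s2 s4].
  rewrite /defect4 !mulmxBl -scalemxAl !mxE -!/(fun_of_matrix _ _ _) /row4.
  have -> : \sum_j row3 (b4 k) (b5 k) (b6 k) 0 j * moments (u k) (t k) j 0 = u k * t k.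
    by rewrite -s4 -row3_moments mxE.
  have -> : \sum_j row3 0 (2 / 3) 0 0 j * moments (u k) (t k) j 0 = 2 / 3 * u k.
    by have := row3_moments 0 (2 / 3) 0 (u k) (t k); rewrite mxE => ->; ring.
  have := neumann4_moments (X k) (@heat_rowsE R (u k) (t k))
            (closure_mx_moments s2 s4).
  by rewrite mxE => ->; rewrite q4 /X; ring.
have [d2 d4] := E _ _ _ Md Bd; have [a2 a4] := E _ _ _ Ma Ba.
have [c2 c4] := E _ _ _ Mc Bc.
by split; exact: three_modes.
Qed.

(** The entries of the Chapman-Enskog closure, as polynomials in $x=\tau k$. *)
Definition ce1 (x : C) : C := - 1 - 4 / 3 * x ^+ 2.
Definition ce2 (x : C) : C := - (4 / 3) * x + 16 / 9 * x ^+ 3.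
Definition ce3 (x : C) : C := - 1.
Definition ce4 (x : C) : C := - (2 / 3) * x ^+ 3.
Definition ce5 (x : C) : C := 2 / 3 + 2 / 9 * x ^+ 2.
Definition ce6 (x : C) : C := - (5 / 3) * x + 25 / 9 * x ^+ 3.
Definition ce_mx (x : C) := closure_mx (ce1 x) (ce2 x) (ce3 x) (ce4 x) (ce5 x) (ce6 x).

Lemma bigO_hpoly cs : bigO_at0 0 (fun k => hpoly cs (X k)).
Proof.
elim: cs => [|c cs IH] /=; first exact: bigO_cst.
apply: bigO_add; first exact: bigO_cst.
by apply: bigO_mul0l => //; exact: bigO_weak OX.
Qed.

(** The residuals in [ce_stress] and [ce_heat] of the Chapman-Enskog polynomials, divided by
    their leading powers of [x]. *)
Definition rest1 : seq C :=
  [:: 16 / 3; 0; 248 / 9; 0; 320 / 9; 0; 832 / 3 ^+ 5; 0; - (2 ^+ 14 / 3 ^+ 6)].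
Definition rest2 : seq C :=
  [:: 856 / 27; 0; - (64 * 29 / 81); 0; 64 / 3; 0; - (2 ^+ 14 / 3 ^+ 5); 0; 2 ^+ 16 / 3 ^+ 7].
Definition rest3 : seq C :=
  [:: - (4 / 9); 0; 244 / 27; 0; - (1024 / 27); 0; 352 / 9].
Definition rest4 : seq C :=
  [:: - (22 / 3); 0; 2 * 1079 / 81; 0; 2 * 541 / 3 ^+ 5; 0; 80 * 293 / 3 ^+ 6; 0; - (8 * 5 ^+ 5 / 3 ^+ 6)].
Definition rest5 : seq C :=
  [:: - 2; 0; 94 / 9; 0; - (98 * 47 / 3 ^+ 5); 0; - (16 * 281 / 3 ^+ 5); 0; 40 * 427 / 3 ^+ 6].
Definition rest6 : seq C :=
  [:: 491 / 9; 0; - (2 * 2971 / 81); 0; 5 * 1699 / 81; 0; - (4 * 5 ^+ 6 / 3 ^+ 5); 0; 4 * 5 ^+ 7 / 3 ^+ 7].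
Definition stress_rest (x : C) : 'rV[C]_3 := row3
  (x ^+ 4 * hpoly rest1 x) (x ^+ 5 * hpoly rest2 x) (x ^+ 4 * hpoly rest3 x).
Definition heat_rest (x : C) : 'rV[C]_3 := row3
  (x ^+ 5 * hpoly rest4 x) (x ^+ 4 * hpoly rest5 x) (x ^+ 5 * hpoly rest6 x).

(** The matrix powers are unfolded on row vectors, so that evaluating [neumann4] on an
    explicit closure costs only products of rows with matrices. *)
Lemma neumann4E (L : nat -> 'rV[C]_3) x (M : 'M[C]_3) : L 0%N = 0 ->
  neumann4 L x M =
    (- x) *: L 1%N + x ^+ 2 *: (2 *: (L 1%N *m M) + L 2%N)
    + (- x ^+ 3) *: (3 *: (L 1%N *m M *m M) + 3 *: (L 2%N *m M) + L 3%N)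
    + x ^+ 4 *: (4 *: (L 1%N *m M *m M *m M) + 6 *: (L 2%N *m M *m M)
                 + 4 *: (L 3%N *m M) + L 4%N).
Proof.
move=> L0.
have M2 r : r *m M ^+ 2 = r *m M *m M :> 'rV[C]_3 by rewrite expr2 mulmxA.
have M3 r : r *m M ^+ 3 = r *m M *m M *m M :> 'rV[C]_3.
  by rewrite exprS mulmxA M2.
rewrite /neumann4 !big_ord_recr !big_ord0 /= L0 !mul0mx !scaler0 !addr0 !add0r.
rewrite ?expr0 ?mulmx1 ?expr1 ?M2 ?M3.
have [c21 c31 c32] : [/\ 'C(2, 1) = 2, 'C(3, 1) = 3 & 'C(3, 2) = 3]%N by [].
have [c41 c42 c43] : [/\ 'C(4, 1) = 4, 'C(4, 2) = 6 & 'C(4, 3) = 4]%N by [].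
rewrite !binn c21 c31 c32 c41 c42 c43.
move: (L 1 *m M *m M *m M) (L 1 *m M *m M) (L 1 *m M) (L 2 *m M *m M) (L 2 *m M)
  (L 3 *m M) (L 1) (L 2) (L 3) (L 4) => *.
by apply/rowP => j; rewrite !mxE; ring.
Qed.

(** The polynomials solve the fixed point equation of the closure up to order four, and up
    to order five in the entries of even order in the wave number. *)
Lemma ce_stress x :
  row3 (ce1 x) (ce2 x) (ce3 x) + row3 1 0 1 + neumann4 (@stress_rows R) x (ce_mx x)
  = - stress_rest x.
Proof.
rewrite neumann4E // /stress_rows [nth _ _ _]/= [nth _ _ _]/= [nth _ _ _]/= [nth _ _ _]/=.
rewrite /ce_mx !row3_closure !row3Z !row3D !row3Z !row3D /stress_rest row3N.
by congr row3; rewrite /ce1 /ce2 /ce3 /ce4 /ce5 /ce6 /rest1 /rest2 /rest3 /=; field.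
Qed.

Lemma ce_heat x :
  row3 (ce4 x) (ce5 x) (ce6 x) - row3 0 (2 / 3) 0
    - (1 / 3) *: neumann4 (@heat_rows R) x (ce_mx x)
  = - heat_rest x.
Proof.
rewrite neumann4E // /heat_rows [nth _ _ _]/= [nth _ _ _]/= [nth _ _ _]/= [nth _ _ _]/=.
rewrite /ce_mx !row3_closure !row3Z !row3D !row3Z !row3D row3Z !row3N !row3D.
by congr row3; rewrite /ce1 /ce2 /ce3 /ce4 /ce5 /ce6 /rest4 /rest5 /rest6 /=; field.
Qed.

Let CE k := ce_mx (X k).
Let diff2 k := row2 k - row3 (ce1 (X k)) (ce2 (X k)) (ce3 (X k)).
Let diff4 k := row4 k - row3 (ce4 (X k)) (ce5 (X k)) (ce6 (X k)).

Let diff2E k : diff2 k = defect2 k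
  - (neumann4 (@stress_rows R) (X k) (B k) - neumann4 (@stress_rows R) (X k) (CE k))
  + stress_rest (X k).
Proof.
have aux (a c r m n : 'rV[C]_3) : a - c = a + r + m - (m - n) - (c + r + n).
  by apply/rowP => j; rewrite !mxE; ring.
by rewrite -[stress_rest _]opprK -ce_stress; exact: aux.
Qed.

Let diff4E k : diff4 k = defect4 k
  + (1 / 3) *: (neumann4 (@heat_rows R) (X k) (B k) - neumann4 (@heat_rows R) (X k) (CE k))
  + heat_rest (X k).
Proof.
have aux (a c r m n : 'rV[C]_3) (e : C) :
    a - c = a - r - e *: m + e *: (m - n) - (c - r - e *: n).
  by apply/rowP => j; rewrite !mxE; ring.
by rewrite -[heat_rest _]opprK -ce_heat; exact: aux.
Qed.

Lemma bigO_X_hpoly n cs : bigO_at0 n (fun k => X k ^+ n * hpoly cs (X k)).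
Proof.
apply: bigO_mul0r; last exact: bigO_hpoly.
by have := bigO_exp n OX; rewrite mul1n.
Qed.

Lemma bigOmx_row3 n (f g h : R -> C) : bigO_at0 n f -> bigO_at0 n g ->
  bigO_at0 n h -> bigOmx n (fun k => row3 (f k) (g k) (h k)).
Proof.
move=> Of Og Oh i j; case: j => -[|[|[|//]]] p.
- by apply: (bigO_eq _ Of) => k; rewrite mxE.
- by apply: (bigO_eq _ Og) => k; rewrite mxE.
- by apply: (bigO_eq _ Oh) => k; rewrite mxE.
Qed.

Lemma rests : bigOmx 4 (fun k => stress_rest (X k)) /\
  bigOmx 4 (fun k => heat_rest (X k)).
Proof.
have O5 cs : bigO_at0 4 (fun k => X k ^+ 5 * hpoly cs (X k)).
  exact: (bigO_weak (leqnSn 4) (bigO_X_hpoly 5 cs)).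
by split; apply: bigOmx_row3 => //; exact: bigO_X_hpoly.
Qed.

Let OCE : bigOmx 0 CE.
Proof.
have Oce (c d : C) m : bigO_at0 0 (fun k => c + d * X k ^+ m).
  apply: bigO_add; first exact: bigO_cst.
  apply: bigO_scale; apply: (@bigO_weak _ (1 * m)) => //; exact: bigO_exp.
have Oc (c d : C) m : bigO_at0 0 (fun k => c * X k + d * X k ^+ m).
  apply: bigO_add; first by apply: bigO_scale; exact: bigO_weak OX.
  apply: bigO_scale; apply: (@bigO_weak _ (1 * m)) => //; exact: bigO_exp.
move=> i j; case: i => -[|[|[|//]]] pi; case: j => -[|[|[|//]]] pj.
- by apply: (bigO_eq _ (bigO_0 R 0)) => k; rewrite mxE.
- by apply: (bigO_eq _ (bigO_cst (1 : C))) => k; rewrite mxE.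
- by apply: (bigO_eq _ (bigO_0 R 0)) => k; rewrite mxE.
- by apply: (bigO_eq _ (Oce (-1) (- (4 / 3)) 2)) => k; rewrite mxE /= /ce1 mulNr.
- by apply: (bigO_eq _ (Oc (- (4 / 3)) (16 / 9) 3)) => k; rewrite mxE.
- by apply: (bigO_eq _ (bigO_cst (-1 : C))) => k; rewrite mxE.
- by apply: (bigO_eq _ (Oce 0 (- (2 / 3)) 3)) => k; rewrite mxE /= /ce4 add0r.
- by apply: (bigO_eq _ (Oce (2 / 3) (2 / 9) 2)) => k; rewrite mxE.
- by apply: (bigO_eq _ (Oc (- (5 / 3)) (25 / 9) 3)) => k; rewrite mxE.
Qed.

Let rows_to_mx n (F2 F4 : R -> 'rV[C]_3) (M : R -> 'M[C]_3) :
  bigOmx n F2 -> bigOmx n F4 ->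
  (forall k j, M k 0 j = 0) -> (forall k j, M k 1 j = F2 k 0 j) ->
  (forall k j, M k 2%:R j = F4 k 0 j) -> bigOmx n M.
Proof.
move=> O2 O4 M0 M1 M2 i j; case: i => -[|[|[|//]]] p.
- apply: (bigO_eq _ (bigO_0 R n)) => k; rewrite -[RHS](M0 k j).
  by congr (M k _ _); exact: val_inj.
- apply: (bigO_eq _ (O2 0 j)) => k; rewrite -M1.
  by congr (M k _ _); exact: val_inj.
- apply: (bigO_eq _ (O4 0 j)) => k; rewrite -M2.
  by congr (M k _ _); exact: val_inj.
Qed.

Let OB : bigOmx 0 B.
Proof.
have [rb2 rb4] := rows_bounded.
move=> i j; case: i => -[|[|[|//]]] p.
- case: j => -[|[|[|//]]] q.
  + by apply: (bigO_eq _ (bigO_0 R 0)) => k; rewrite mxE.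
  + by apply: (bigO_eq _ (bigO_cst (1 : C))) => k; rewrite mxE.
  + by apply: (bigO_eq _ (bigO_0 R 0)) => k; rewrite mxE.
- by apply: (bigO_eq _ (rb2 0 j)) => k; rewrite !mxE.
- by apply: (bigO_eq _ (rb4 0 j)) => k; rewrite !mxE.
Qed.

(** The closure is a fixed point, up to fifth order, of a map that gains two powers of
    the wave number, so the agreement with the Chapman-Enskog polynomials improves
    until the residual of the polynomials is reached. *)
Let improve n : (n <= 4)%N -> bigOmx n (fun k => B k - CE k) ->
  let m := minn 4 n.+2 in bigOmx m (fun k => B k - CE k).
Proof.
move=> n4 On m; have [D2 D4] := defects; have [S2 S4] := rests.
have m4 : (m <= 4)%N by exact: geq_minl.
have N2 : bigOmx m (fun k => neumann4 (@stress_rows R) (X k) (B k)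
                           - neumann4 (@stress_rows R) (X k) (CE k)).
  by apply: (bigOmx_weak (geq_minr 4 n.+2)); exact: neumann4_sub.
have N4 : bigOmx m (fun k => neumann4 (@heat_rows R) (X k) (B k)
                           - neumann4 (@heat_rows R) (X k) (CE k)).
  by apply: (bigOmx_weak (geq_minr 4 n.+2)); exact: neumann4_sub.
have O2 : bigOmx m diff2.
  apply: (bigOmx_eq diff2E); apply: bigOmx_add; last exact: bigOmx_weak m4 S2.
  apply: bigOmx_add; first exact: bigOmx_weak (leq_trans m4 (leqnSn 4)) D2.
  apply: (@bigOmx_eq _ _ _ _ _ (fun k => -1 *: (neumann4 (@stress_rows R) (X k) (B k)
                           - neumann4 (@stress_rows R) (X k) (CE k)))).
    by move=> k; rewrite scaleN1r.
  exact: (bigOmx_scale (bigO_cst _) N2).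
have O4 : bigOmx m diff4.
  apply: (bigOmx_eq diff4E); apply: bigOmx_add; last exact: bigOmx_weak m4 S4.
  apply: bigOmx_add; first exact: bigOmx_weak (leq_trans m4 (leqnSn 4)) D4.
  exact: (bigOmx_scale (bigO_cst _) N4).
apply: (rows_to_mx O2 O4) => k j; rewrite !mxE /= ?subrr //.
Qed.

(** Two improvements give order four in all entries. After a third one only the residuals
    of the polynomials remain, and these are of order five in the second, fourth and
    sixth entries. *)
Lemma closure_expansion :
  [/\ bigO_at0 4 (fun k => b1 k - ce1 (X k)),
      bigO_at0 5 (fun k => b2 k - ce2 (X k)) &
      bigO_at0 4 (fun k => b3 k - ce3 (X k))] /\
  [/\ bigO_at0 5 (fun k => b4 k - ce4 (X k)),
      bigO_at0 4 (fun k => b5 k - ce5 (X k)) &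
      bigO_at0 5 (fun k => b6 k - ce6 (X k))].
Proof.
have O0 : bigOmx 0 (fun k => B k - CE k).
  move=> i j; apply: (bigO_eq _ (bigO_sub (OB i j) (OCE i j))) => k.
  by rewrite !mxE.
have O4 : bigOmx 4 (fun k => B k - CE k).
  by have /improve := improve (leq0n 4) O0; apply.
have N2 := neumann4_sub (L := @stress_rows R) erefl OX OB OCE O4.
have N4 := neumann4_sub (L := @heat_rows R) erefl OX OB OCE O4.
have [D2 D4] := defects.
have fine2 j : bigO_at0 5 (fun k => stress_rest (X k) 0 j) ->
    bigO_at0 5 (fun k => diff2 k 0 j).
  move=> S2; apply: (bigO_eq _ (bigO_add (bigO_sub (D2 0 j)
     (bigO_weak (leqnSn 5) (N2 0 j))) S2)) => k.
  by rewrite diff2E !mxE.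
have fine4 j : bigO_at0 5 (fun k => heat_rest (X k) 0 j) ->
    bigO_at0 5 (fun k => diff4 k 0 j).
  move=> S4; apply: (bigO_eq _ (bigO_add (bigO_add (D4 0 j)
     (bigO_scale (1 / 3) (bigO_weak (leqnSn 5) (N4 0 j)))) S4)) => k.
  by rewrite diff4E !mxE.
split; split.
- by apply: (bigO_eq _ (O4 1 0)) => k; rewrite !mxE.
- apply: (@bigO_eq _ _ _ (fun k => diff2 k 0 1)); first by move=> k; rewrite !mxE.
  by apply: fine2; apply: (bigO_eq _ (bigO_X_hpoly 5 rest2)) => k; rewrite mxE.
- by apply: (bigO_eq _ (O4 1 2%:R)) => k; rewrite !mxE.
- apply: (@bigO_eq _ _ _ (fun k => diff4 k 0 0)); first by move=> k; rewrite !mxE.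
  by apply: fine4; apply: (bigO_eq _ (bigO_X_hpoly 5 rest4)) => k; rewrite mxE.
- by apply: (bigO_eq _ (O4 2%:R 1)) => k; rewrite !mxE.
- apply: (@bigO_eq _ _ _ (fun k => diff4 k 0 2%:R)); first by move=> k; rewrite !mxE.
  by apply: fine4; apply: (bigO_eq _ (bigO_X_hpoly 5 rest6)) => k; rewrite mxE.
Qed.

End ThreeModes.

(** * From eigenfunctions to slow modes *)

Section SlowModeOfEigenfunction.
Variable R : realType.
Local Notation C := R[i].
Local Notation i_u0 := (i_u (@ord0 2)).
Local Notation i_u1 := (i_u (lift ord0 (@ord0 1))).
Local Notation i_u2 := (i_u (lift ord0 (lift ord0 (@ord0 0)))).
Variables (tau k : R) (lam : C) (f : Vel R -> C) (T : C).
Hypotheses (tau_gt0 : 0 < tau) (k_gt0 : 0 < k).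
Hypothesis lam_gt : - tau^-1 < cRe lam.
Hypothesis Hf : is_eigenfunction tau (wave_e1 k) lam f.
Let ut := lam / k%:C.
Hypothesis f_rho : ip f (basis_e i_rho) = 1.
Hypothesis f_u0 : ip f (basis_e i_u0) = 'i * ut.
Hypothesis f_u1 : ip f (basis_e i_u1) = 0.
Hypothesis f_u2 : ip f (basis_e i_u2) = 0.
Hypothesis f_T : ip f (basis_e i_T) = (Num.sqrt (3 / 2))%:C * T.

Let X := tau * k.

Lemma scaled_resolvent : 1 + tau%:C * lam = 1 + X%:C * ut.
Proof.
have k0 : k%:C != 0 :> C by rewrite eq_complex /= gt_eqF.
by rewrite /ut /X rmorphM; congr (_ + _); field.
Qed.

(** [eigen_moment] in the scaled variables. *)
Lemma eigen_deviator (e : Vel R -> R) (g0 g1 p : C -> C) (c : C) :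
  measurable_fun setT e ->
  (forall v, (e v)%:C = g0 (zvar v.1.1) + g1 (zvar v.1.1) * (rperp v)%:C) ->
  temp1 (fun x => g0 (zvar x)) -> temp1 (fun x => g1 (zvar x)) ->
  (forall z, p z = c * (g0 z * (za ut T z + T) + g1 z * (2 * za ut T z + 4 * T))) ->
  temp1 (fun x => p (zvar x)) ->
  deviator p ut X = c * ip f (fun v => (e v)%:C).
Proof.
move=> me eE t0 t1 pE tp.
rewrite (eigen_moment tau_gt0 lam_gt Hf f_rho f_u0 f_u1 f_u2 f_T me eE t0 t1).
have s0 := Re_resolv_gt0 tau_gt0 lam_gt.
rewrite -E1Z; last first.
  have tw := temp1_resolv (tau * k) s0; have ta := temp1_profile k lam T.
  apply: temp1M => //; apply: temp1D; apply: temp1M => //.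
    by apply: temp1D => //; exact: temp1_cst.
  by apply: temp1D; [apply: temp1M => //; exact: temp1_cst|exact: temp1_cst].
apply: eq_wexp => x; rewrite pE wz_resolv -scaled_resolvent profile_za; ring.
Qed.

(** The hypotheses of [conservation] are the given density, momentum and energy moments of
    the eigenfunction. *)
Lemma eigen_conservation :
  ut * ut = - (1 + T) - deviator (stress_p ut T) ut X /\
  ut * T = 2 / 3 * ut + 1 / 3 * deviator (heat_p ut T) ut X.
Proof.
have X0 : 0 < X by rewrite mulr_gt0.
have s0 : 0 < cRe (1 + X%:C * ut).
  by rewrite -scaled_resolvent Re_resolv_gt0.
have tz := @temp1_zvar R.
have tc c : temp1 (fun=> c : C) by exact: temp1_cst.
have ta : temp1 (fun x => za ut T (zvar x)).
  by apply: temp1B; [apply: temp1D => //; exact: temp1M|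
    apply: temp1M => //; apply: temp1M => //; apply: temp1D => //; exact: temp1X].
have tz2 : temp1 (fun x => zvar x ^+ 2 : C) by exact: temp1X.
have r6 : Num.sqrt 6 != 0 :> R by rewrite gt_eqF // sqrtr_gt0.
have r6c : (Num.sqrt 6)%:C != 0 :> C by rewrite eq_complex /= negb_and r6.
apply: conservation => //.
- rewrite (@eigen_deviator (fun=> 1) (fun=> 1) (fun=> 0) _ 1) //.
  + rewrite mul1r -[RHS]f_rho; congr ip.
    by apply/funext => v; rewrite basis_rho.
  + by move=> v; rewrite mul0r addr0.
  + by move=> z; ring.
  + by apply: temp1D.
- rewrite (@eigen_deviator (fun v => v.1.1) (fun z => - 'i%C * z) (fun=> 0) _ 'i%C) //.
  + rewrite (_ : (fun v => _) = basis_e i_u0); last first.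
      by apply/funext => v; rewrite basis_u.
    by rewrite f_u0 mulrA -expr2 sqr_i mulN1r.
  + exact: measurable_v1.
  + by move=> v; rewrite mul0r addr0 /zvar mulrA mulNr -expr2 sqr_i opprK mul1r.
  + by apply: temp1M.
  + move=> z; transitivity (- 'i%C ^+ 2 * (z * (za ut T z + T))); last by ring.
    by rewrite sqr_i opprK mul1r.
  + by apply: temp1M => //; exact: temp1D.
rewrite (@eigen_deviator (fun v => (vel_sqr v - 3) / Num.sqrt 6)
   (fun z => (- z ^+ 2 - 3) / (Num.sqrt 6)%:C) (fun=> (Num.sqrt 6)%:C^-1) _
   (Num.sqrt 6)%:C) //.
- rewrite (_ : (fun v => _) = basis_e i_T); last first.
    by apply/funext => v; rewrite basis_T.
  rewrite f_T mulrA -rmorphM /= -sqrtrM // (_ : 6 * (3 / 2) = 3 ^+ 2); last by field.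
  by rewrite sqrtr_sqr ger0_norm // realC_nat.
- apply: measurable_funM => //; apply: measurable_funB => //.
  exact: measurable_vel_sqr.
- move=> v; rewrite rmorphM fmorphV /= vel_sqrE rmorphB /= realC_nat zvar_sqr opprK.
  by rewrite /rperp -addrA !rmorphD !rmorphXn /=; field.
- apply: temp1M => //; apply: temp1B => //.
  by under eq_fun do rewrite zvar_sqr opprK; apply: temp1X; exact: temp1_x.
- by move=> z; field.
apply: temp1D; apply: temp1M => //.
  under eq_fun do rewrite zvar_sqr.
  rewrite (_ : (fun x => _) = (fun x => x%:C ^+ 2 - 1 : C)); last first.
    by apply/funext => x; rewrite opprD opprK.
  by apply: temp1B => //; apply: temp1X; exact: temp1_x.
by apply: temp1B.
Qed.

End SlowModeOfEigenfunction.

(** * Block form of the generator *)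

Section Generator.
Variable R : realType.
Local Notation C := R[i].

(** Sums over the moments split according to density, velocity and temperature. *)
Lemma sum_blocks (V : nmodType) (F : 'I_5 -> V) :
  \sum_(i < 5) F i = F i_rho + (\sum_(m < 3) F (i_u m) + F i_T).
Proof.
rewrite (@big_split_ord _ _ _ 1 4) big_ord1; congr (_ + _).
by rewrite (@big_split_ord _ _ _ 3 1) big_ord1.
Qed.

Definition Qreal (Q : 'M[R]_3) : 'M[R]_(1 + (3 + 1)) :=
  block_mx 1%:M 0 0 (block_mx Q 0 0 1%:M).

Lemma Qreal_orth (Q : 'M[R]_3) : Q *m Q^T = 1%:M -> Qreal Q *m (Qreal Q)^T = 1%:M.
Proof.
move=> QQ; rewrite /Qreal !tr_block_mx !trmx0 !trmx1 !mulmx_block.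
by rewrite !(mulmx0, mul0mx, addr0, add0r, mulmx1) QQ -!scalar_mx_block.
Qed.

Lemma QtildeE (Q : 'M[R]_3) : Qtilde Q = map_mx (real_complex R) (Qreal Q).
Proof. by []. Qed.

Lemma Qtilde_orth (Q : 'M[R]_3) : Q *m Q^T = 1%:M ->
  Qtilde Q *m (Qtilde Q)^T = 1%:M.
Proof.
move=> QQ; have := congr1 (map_mx (real_complex R)) (Qreal_orth QQ).
by rewrite map_mxM map_trmx map_mx1.
Qed.

Lemma Qtilde_orthV (Q : 'M[R]_3) : Q *m Q^T = 1%:M ->
  (Qtilde Q)^T *m Qtilde Q = 1%:M.
Proof. by move=> QQ; exact/mulmx1C/Qtilde_orth. Qed.

Lemma Qtilde_entry (Q : 'M[R]_3) (i j : 'I_5) : Qtilde Q i j = (Qreal Q i j)%:C.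
Proof. by rewrite mxE. Qed.

Lemma Qreal_rho (Q : 'M[R]_3) :
  (Qreal Q i_rho i_rho = 1) * (forall m, Qreal Q i_rho (i_u m) = 0)
  * (Qreal Q i_rho i_T = 0).
Proof.
by split; first split; [rewrite block_mxEul mxE eqxx|
  move=> m; rewrite block_mxEur mxE|rewrite block_mxEur mxE].
Qed.

Lemma Qreal_u (Q : 'M[R]_3) l :
  (Qreal Q (i_u l) i_rho = 0) * (forall m, Qreal Q (i_u l) (i_u m) = Q l m)
  * (Qreal Q (i_u l) i_T = 0).
Proof.
by split; first split; [rewrite block_mxEdl mxE|
  move=> m; rewrite block_mxEdr block_mxEul|rewrite block_mxEdr block_mxEur mxE].
Qed.

Lemma Qreal_T (Q : 'M[R]_3) :
  (Qreal Q i_T i_rho = 0) * (forall m, Qreal Q i_T (i_u m) = 0)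
  * (Qreal Q i_T i_T = 1).
Proof.
by split; first split; [rewrite block_mxEdl mxE|
  move=> m; rewrite block_mxEdr block_mxEdl mxE|rewrite block_mxEdr block_mxEdr mxE eqxx].
Qed.

Lemma Qtilde_rho n (Q : 'M[R]_3) (M : 'M[C]_(5, n)) j :
  (Qtilde Q *m M) i_rho j = M i_rho j.
Proof.
rewrite mxE sum_blocks !Qtilde_entry !Qreal_rho mul1r mul0r addr0.
by rewrite big1 ?addr0 // => m _; rewrite Qtilde_entry Qreal_rho mul0r.
Qed.

Lemma Qtilde_u n (Q : 'M[R]_3) (M : 'M[C]_(5, n)) l j :
  (Qtilde Q *m M) (i_u l) j = \sum_(m < 3) (Q l m)%:C * M (i_u m) j.
Proof.
rewrite mxE sum_blocks !Qtilde_entry !Qreal_u !mul0r addr0 add0r.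
by apply: eq_bigr => m _; rewrite Qtilde_entry Qreal_u.
Qed.

Lemma Qtilde_T n (Q : 'M[R]_3) (M : 'M[C]_(5, n)) j :
  (Qtilde Q *m M) i_T j = M i_T j.
Proof.
rewrite mxE sum_blocks !Qtilde_entry !Qreal_T mul1r mul0r add0r.
by rewrite big1 ?add0r // => m _; rewrite Qtilde_entry Qreal_T mul0r.
Qed.

Section Block.
Variables (u t l : 'I_3 -> C) (k : R) (ls : C).
Definition mode_mx : 'M[C]_5 := mx_of_rows
  [:: [:: 1; 1; 1; 0; 0];
      [:: u 0; u 1; u 2%:R; 0; 0];
      [:: 0; 0; 0; 1; 0];
      [:: 0; 0; 0; 0; 1];
      [:: t 0; t 1; t 2%:R; 0; 0]].
Definition mode_diag : 'M[C]_5 :=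
  diag_mx (\row_(j < 5) [:: l 0; l 1; l 2%:R; ls; ls]`_j).
Hypothesis Hunit : mode_mx \in unitmx.
Hypothesis mass : forall j, l j = - ('i * k%:C) * u j.

Local Notation H := mode_mx.
Local Notation L := mode_diag.
Let A := H *m L *m invmx H.
Let o n (np : (n < 5)%N) : 'I_5 := Ordinal np.
Let o0 := @o 0 isT. Let o1 := @o 1 isT. Let o2 := @o 2 isT.
Let o3 := @o 3 isT. Let o4 := @o 4 isT.

Let A_H : A *m H = H *m L.
Proof. by rewrite /A -mulmxA mulVmx // mulmx1. Qed.

(* If a row of H L is a multiple of a row of H, then so is that row of A of a row of 1. *)
Let row_eigen i i' c : (forall j, (H *m L) i j = c * H i' j) ->
  forall j, A i j = c * (1%:M : 'M[C]_5) i' j.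
Proof.
move=> E j; rewrite /A mxE.
under eq_bigr do rewrite E -mulrA.
by rewrite -mulr_sumr -(mulmxV Hunit) mxE.
Qed.

Let HLE i j : (H *m L) i j = H i j * [:: l 0; l 1; l 2%:R; ls; ls]`_j.
Proof. by rewrite mul_mx_diag !mxE. Qed.

Let A_row0 j : A o0 j = - ('i * k%:C) * (1%:M : 'M[C]_5) o1 j.
Proof.
move: j; apply: row_eigen => j; rewrite HLE !mxE.
case: j => -[|[|[|[|[|//]]]]] p /=; rewrite ?mass; ring.
Qed.

Let A_shear_row (i j : 'I_5) : (1 < i < 4)%N -> A i j = ls * (1%:M : 'M[C]_5) i j.
Proof.
move=> hi; move: j; apply: row_eigen => j; rewrite HLE !mxE.
case: i hi => -[|[|[|[|[|//]]]]] // p _; case: j => -[|[|[|[|[|//]]]]] q /=; ring.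
Qed.

Let sum5o (F : 'I_5 -> C) : \sum_(i < 5) F i = F o0 + (F o1 + (F o2 + (F o3 + F o4))).
Proof.
rewrite !big_ord_recl big_ord0 addr0.
by congr (F _ + (F _ + (F _ + (F _ + F _)))); exact: val_inj.
Qed.

Let A_col2 i : A i o2 = ls * H i o3.
Proof.
have := congr1 (fun M : 'M[C]_5 => M i o3) A_H; rewrite /= HLE mxE sum5o !mxE /=.
by rewrite !mulr0 !add0r !addr0 mulr1 => ->; rewrite mulrC.
Qed.

Let A_col3 i : A i o3 = ls * H i o4.
Proof.
have := congr1 (fun M : 'M[C]_5 => M i o4) A_H; rewrite /= HLE mxE sum5o !mxE /=.
by rewrite !mulr0 !add0r !addr0 mulr1 => ->; rewrite mulrC.
Qed.

Definition block_gen : 'M[C]_5 := H *m L *m invmx H.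

(** The first row is the conservation of mass, which is the hypothesis [mass]; the
    shear columns and rows of [mode_mx] are unit vectors, so the shear modes decouple. *)
Lemma block_gen_hydro : block_gen =
  hydro_mx k (block_gen o1 o0) (block_gen o1 o1) (block_gen o1 o4)
    (block_gen o4 o0) (block_gen o4 o1) (block_gen o4 o4) ls.
Proof.
rewrite /block_gen -/A.
have dense (i : 'I_5) : H i o3 = 0 -> H i o4 = 0 ->
    forall j : 'I_5, A i j = [:: A i o0; A i o1; 0; 0; A i o4]`_j.
  move=> Hi3 Hi4 j; case: j => -[|[|[|[|[|//]]]]] q /=.
  + by congr (A _ _); exact: val_inj.
  + by congr (A _ _); exact: val_inj.
  + by rewrite (_ : Ordinal q = o2) ?A_col2 ?Hi3 ?mulr0 //; exact: val_inj.
  + by rewrite (_ : Ordinal q = o3) ?A_col3 ?Hi4 ?mulr0 //; exact: val_inj.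
  + by congr (A _ _); exact: val_inj.
apply/matrixP => i j; rewrite [RHS]mxE.
case: i => -[|[|[|[|[|//]]]]] p.
- rewrite (_ : Ordinal p = o0); last exact: val_inj.
  by rewrite A_row0 mxE; case: j => -[|[|[|[|[|//]]]]] q /=; rewrite ?mulr0 ?mulr1 ?mulNr.
- by rewrite (_ : Ordinal p = o1); [rewrite dense ?mxE|exact: val_inj].
- rewrite (_ : Ordinal p = o2); last exact: val_inj.
  by rewrite A_shear_row // mxE; case: j => -[|[|[|[|[|//]]]]] q /=; rewrite ?mulr0 ?mulr1.
- rewrite (_ : Ordinal p = o3); last exact: val_inj.
  by rewrite A_shear_row // mxE; case: j => -[|[|[|[|[|//]]]]] q /=; rewrite ?mulr0 ?mulr1.
- by rewrite (_ : Ordinal p = o4); [rewrite dense ?mxE|exact: val_inj].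
Qed.

Lemma block_gen_eigen (j : 'I_3) :
  block_gen o1 o0 + block_gen o1 o1 * u j + block_gen o1 o4 * t j = u j * l j /\
  block_gen o4 o0 + block_gen o4 o1 * u j + block_gen o4 o4 * t j = t j * l j.
Proof.
have E i (p : (j < 5)%N) : A i o0 * 1 + (A i o1 * u j + (A i o2 * 0 + (A i o3 * 0 + A i o4 * t j))) =
    H i (Ordinal p) * l j.
  have := congr1 (fun M : 'M[C]_5 => M i (Ordinal p)) A_H.
  rewrite /= HLE mxE sum5o !(mxE _ _ o0) !(mxE _ _ o1).
  rewrite !mxE /=.
  case: j p => -[|[|[|//]]] q p /=.
  - by rewrite (_ : Ordinal q = 0) //; exact: val_inj.
  - by rewrite (_ : Ordinal q = 1) //; exact: val_inj.
  - by rewrite (_ : Ordinal q = 2%:R) //; exact: val_inj.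
have p : (j < 5)%N by rewrite (leq_trans (ltn_ord j)).
have nth3 (f : 'I_3 -> C) a b : [:: f 0; f 1; f 2%:R; a; b]`_j = f j.
  by case: (j) => -[|[|[|//]]] q /=; congr (f _); exact: val_inj.
have E1 := E o1 p; have E4 := E o4 p.
rewrite /block_gen -/A; split.
  have <- : H o1 (Ordinal p) * l j = u j * l j by rewrite mxE /= nth3.
  by rewrite -E1; ring.
have <- : H o4 (Ordinal p) * l j = t j * l j by rewrite mxE /= nth3.
by rewrite -E4; ring.
Qed.

End Block.

Lemma conj_gen (Qt H L : 'M[C]_5) : Qt *m Qt^T = 1%:M -> Qt *m H \in unitmx ->
  H \in unitmx /\
  (Qt *m H) *m L *m invmx (Qt *m H) = Qt *m (H *m L *m invmx H) *m Qt^T.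
Proof.
move=> QQ; rewrite unitmx_mul => /andP[uQ uH]; split=> //.
have QV : Qt^T = invmx Qt.
  by rewrite -[LHS]mul1mx -(mulVmx uQ) -mulmxA QQ mulmx1.
have inv1 : (invmx H *m invmx Qt) *m (Qt *m H) = 1%:M.
  by rewrite mulmxA -(mulmxA (invmx H)) mulVmx // mulmx1 mulVmx.
have -> : invmx (Qt *m H) = invmx H *m invmx Qt.
  by rewrite -[LHS]mul1mx -inv1 -mulmxA mulmxV ?mulmx1 // unitmx_mul uQ.
by rewrite QV !mulmxA.
Qed.

End Generator.

(** * Expansion of the exact coefficients *)

Section ExactHydrodynamics.
Variable R : realType.
Local Notation C := R[i].
Variables (tau : R) (lam_diff lam_shear : R -> R) (lam_ac : R -> C).
Variable Q : 'cV[R]_3 -> 'M[R]_3.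
Hypothesis tau_gt0 : 0 < tau.
Hypothesis Hspec : spectrum_spec tau lam_diff lam_shear lam_ac.
Hypothesis Hexp : lam_expansions tau lam_diff lam_shear lam_ac.
Hypothesis HQ : wave_rotation Q.
Hypothesis Hbasis : spectral_basis_spec tau lam_diff lam_shear lam_ac Q.

Definition slow_lam (k : R) (j : 'I_3) : C :=
  [:: (lam_diff k)%:C; lam_ac k; (lam_ac k)^*]`_j.
Definition slow_u (k : R) (j : 'I_3) : C := 'i%C / k%:C * slow_lam k j.
Definition slow_t (k : R) (j : 'I_3) : C := theta tau k (slow_lam k j).

Lemma Hmx_block kk : Hmx tau lam_diff lam_ac Q kk =
  Qtilde (Q kk) *m mode_mx (slow_u (enorm kk)) (slow_t (enorm kk)).
Proof. by []. Qed.

Lemma slow_mass k j : 0 < k -> slow_lam k j = - ('i%C * k%:C) * slow_u k j.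
Proof.
move=> k0; have k0' : k%:C != 0 :> C by rewrite eq_complex /= gt_eqF.
rewrite /slow_u (_ : - ('i%C * k%:C) * ('i%C / k%:C * slow_lam k j) =
   - 'i%C ^+ 2 * (k%:C / k%:C) * slow_lam k j); last by ring.
by rewrite sqr_i opprK mul1r divff // mul1r.
Qed.

Definition exact_block (k : R) : 'M[C]_5 :=
  block_gen (slow_u k) (slow_t k) (slow_lam k) (lam_shear k)%:C.
Definition coef (i j : nat) (k : R) : C := exact_block k (inord i) (inord j).

Lemma exact_gen_block kk : admissible tau kk ->
  mode_mx (slow_u (enorm kk)) (slow_t (enorm kk)) \in unitmx /\
  exact_gen tau lam_diff lam_shear lam_ac Q kk =
  Qtilde (Q kk) *m exact_block (enorm kk) *m (Qtilde (Q kk))^T.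
Proof.
move=> adm; have [uH _] := Hbasis adm.
have [[QQ _] _] := HQ kk.
rewrite /exact_gen; rewrite Hmx_block in uH *.
have [uB E] := conj_gen (Lambda lam_diff lam_shear lam_ac (enorm kk))
     (Qtilde_orth QQ) uH.
by split=> //; exact: E.
Qed.

Lemma exact_block_hydro kk : admissible tau kk -> let k := enorm kk in
  exact_block k = hydro_mx k (coef 1 0 k) (coef 1 1 k) (coef 1 4 k)
    (coef 4 0 k) (coef 4 1 k) (coef 4 4 k) (lam_shear k)%:C.
Proof.
move=> adm k; have [uB _] := exact_gen_block adm.
have k0 : 0 < k by have /andP[] := adm.
rewrite {1}/exact_block (block_gen_hydro _ uB (fun j => slow_mass j k0)).
have E i (p : (i < 5)%N) : inord i = Ordinal p by apply: ord_inj; rewrite inordK.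
by rewrite /coef /exact_block !(E 0%N isT, E 1%N isT, E 4%N isT).
Qed.

Lemma exact_block_eigen kk (j : 'I_3) : admissible tau kk ->
  let k := enorm kk in
  coef 1 0 k + coef 1 1 k * slow_u k j + coef 1 4 k * slow_t k j
    = slow_u k j * slow_lam k j /\
  coef 4 0 k + coef 4 1 k * slow_u k j + coef 4 4 k * slow_t k j
    = slow_t k j * slow_lam k j.
Proof.
move=> adm k; have [uB _] := exact_gen_block adm.
have [] := block_gen_eigen (slow_lam k) (lam_shear k)%:C uB j.
have E i (p : (i < 5)%N) : inord i = Ordinal p by apply: ord_inj; rewrite inordK.
by rewrite /coef /exact_block !(E 0%N isT, E 1%N isT, E 4%N isT).
Qed.

Lemma near_admissible : \forall k \near 0^'+, admissible tau (wave_e1 k).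
Proof.
have b0 : 0 < Num.sqrt (pi / 2) / tau :> R.
  by rewrite divr_gt0 // sqrtr_gt0 divr_gt0 // pi_gt0.
near=> k.
have k0 : 0 < k by near: k; exact: nbhs_right_gt.
rewrite /admissible enorm_wave_e1 ?ltW // k0 /=.
by near: k; exact: nbhs_right_lt.
Unshelve. all: by end_near. Qed.

(** Eigenvalues off the essential spectrum lie to its right, where the resolvent is bounded. *)
Lemma slow_lam_gt kk j : admissible tau kk -> - tau^-1 < cRe (slow_lam (enorm kk) j).
Proof.
move=> adm; have [S1 S2 _ _ _] := Hspec adm.
have : slow_lam (enorm kk) j \in [:: (lam_diff (enorm kk))%:C; lam_ac (enorm kk);
    (lam_ac (enorm kk))^*; (lam_shear (enorm kk))%:C].
  by rewrite !inE; case: j => -[|[|[|//]]] p; rewrite /slow_lam /= eqxx ?orbT.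
by move=> /(S2 _).2[ev ne]; have /andP[] := S1 _ ev ne.
Qed.

(** The rotation fixes the first axis, although it need not be the identity. *)
Lemma rotation_e1 k l : 0 < k -> Q (wave_e1 k) l 0 = (l == 0)%:R.
Proof.
move=> k0; have [_] := HQ (wave_e1 k).
rewrite enorm_wave_e1 ?ltW // -/(wave_e1 k) => /colP /(_ l).
rewrite /wave_e1 -scalemxAr mxE [RHS]mxE => /(mulfI (lt0r_neq0 k0)).
rewrite mxE !mxE eqxx andbT => <-.
rewrite (bigD1 0) //= mxE !eqxx mulr1 big1 ?addr0 // => m m0.
by rewrite mxE (negbTE m0) mulr0.
Qed.

(** The mode [j] in the variables of [slow_mode]: the phase velocity, and the temperature
    of the mode of unit density. *)
Definition scaled_u (j : 'I_3) (k : R) : C := slow_lam k j / k%:C.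
Definition scaled_t (j : 'I_3) (k : R) : C :=
  slow_t k j / (Num.sqrt (3 / 2))%:C.

Lemma sqrt32_neq0 : (Num.sqrt (3 / 2))%:C != 0 :> C.
Proof. by rewrite eq_complex /= negb_and gt_eqF // sqrtr_gt0 divr_gt0. Qed.

(** The branches depend on the wave number only, so they are tested on the wave vectors
    [wave_e1 k]. *)
Lemma slow_modes (c : C) (j : 'I_3) : bigO_at0 1 (fun k => scaled_u j k - c) ->
  slow_mode tau c (scaled_u j) (scaled_t j).
Proof.
move=> Oc; split=> //.
apply: filterS2 near_admissible (nbhs_right_gt 0) => k adm k0.
have ek : enorm (wave_e1 k) = k by rewrite enorm_wave_e1 ?ltW.
have [_ /(_ (widen_ord (isT : (3 <= 5)%N) j))[f Hf Hm]] := Hbasis adm.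
have lamE : (lam_seq lam_diff lam_shear lam_ac (enorm (wave_e1 k)))`_
    (widen_ord (isT : (3 <= 5)%N) j) = slow_lam k j.
  by rewrite ek /slow_lam; case: (j) => -[|[|[|//]]] p.
rewrite lamE in Hf.
have blk (i i' : 'I_5) : val i = val i' ->
   mode_mx (slow_u k) (slow_t k) i (widen_ord (isT : (3 <= 5)%N) j) =
   mode_mx (slow_u k) (slow_t k) i' (widen_ord (isT : (3 <= 5)%N) j).
  by move=> /val_inj ->.
have bu m : mode_mx (slow_u k) (slow_t k) (i_u m)
      (widen_ord (isT : (3 <= 5)%N) j) = if m == 0 then slow_u k j else 0.
  rewrite mxE; case: m => -[|[|[|//]]] p; case: (j) => -[|[|[|//]]] q //=;
    by congr (slow_u k _); exact: val_inj.
have mu l : ip f (basis_e (i_u l)) = (Q (wave_e1 k) l 0)%:C * slow_u k j.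
  rewrite Hm Hmx_block ek Qtilde_u (bigD1 0) //= bu /= big1 ?addr0 // => m m0.
  by rewrite bu (negbTE m0) mulr0.
have lam_gt : - tau^-1 < cRe (slow_lam k j)
  by have := slow_lam_gt j adm; rewrite ek.
apply: (eigen_conservation tau_gt0 k0 lam_gt Hf).
- rewrite Hm Hmx_block ek Qtilde_rho mxE.
  by case: (j) => -[|[|[|//]]] p.
- by rewrite mu rotation_e1 //= mul1r /slow_u mulrAC mulrA.
- by rewrite mu rotation_e1 // mul0r.
- by rewrite mu rotation_e1 // mul0r.
rewrite Hm Hmx_block ek Qtilde_T mxE /scaled_t mulrC divfK ?sqrt32_neq0 //.
by case: (j) => -[|[|[|//]]] p //=; congr (slow_t k _); exact: val_inj.
Qed.

Lemma bigO_div n (f : R -> C) : bigO_at0 n.+1 f -> bigO_at0 n (fun k => f k / k%:C).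
Proof.
move=> [M fM]; exists M; apply: filterS2 fM (nbhs_right_gt 0) => k fk k0.
by rewrite normcM normcV normc_real gtr0_norm // ler_pdivrMr // -mulrA -exprSr.
Qed.

Lemma bigO_conj n (f : R -> C) : bigO_at0 n f -> bigO_at0 n (fun k => (f k)^*).
Proof. by move=> [M fM]; exists M; apply: filterS fM => k; rewrite normc_conj. Qed.

(** The limit of $\lambda_{\rm ac}/k$. *)
Definition sound : C := 'i%C * (Num.sqrt (5 / 3))%:C.

Lemma bigO_monomial (c : C) n m : (n <= m)%N -> bigO_at0 n (fun k : R => c * k%:C ^+ m).
Proof.
move=> nm; apply: (bigO_weak nm); apply: bigO_scale.
by have := bigO_exp m (@bigO_id R); rewrite mul1n.
Qed.

Lemma scaled_u_diff : bigO_at0 1 (fun k => scaled_u 0 k - 0).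
Proof.
have [Od _ _] := Hexp.
apply: (@bigO_eq _ _ _ (fun k => (lam_diff k)%:C / k%:C)).
  by move=> k; rewrite subr0.
apply: bigO_div; have O2 := bigO_weak (isT : (2 <= 6)%N) Od.
have Op := bigO_add (bigO_monomial (- tau)%:C (isT : (2 <= 2)%N))
                    (bigO_monomial (9 / 5 * tau ^+ 3)%:C (isT : (2 <= 4)%N)).
apply: (bigO_eq _ (bigO_add O2 Op)) => k.
by rewrite -!rmorphXn -!rmorphM -rmorphD /= subrK.
Qed.

Lemma scaled_u_ac : bigO_at0 1 (fun k => scaled_u 1 k - sound).
Proof.
have [_ _ Oa] := Hexp.
have O2 := bigO_weak (isT : (2 <= 5)%N) Oa.
have Op := bigO_add (bigO_add (bigO_monomial (- tau)%:C (isT : (2 <= 2)%N))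
   (bigO_monomial ('i%C * (7 * tau ^+ 2 / (6 * Num.sqrt 15))%:C) (isT : (2 <= 3)%N)))
   (bigO_monomial (62 / 45 * tau ^+ 3)%:C (isT : (2 <= 4)%N)).
apply: (bigO_near_eq _ (bigO_div (bigO_add O2 Op))).
apply: filterS (nbhs_right_gt 0) => k k0.
have k0' : k%:C != 0 :> C by rewrite eq_complex /= gt_eqF.
rewrite /scaled_u /sound /slow_lam /=; apply: (mulIf k0'); rewrite divfK // mulrBl divfK //.
by rewrite !(rmorphXn, rmorphN, rmorphM) /= -?complexiE; ring.
Qed.

Lemma scaled_u_conj : bigO_at0 1 (fun k => scaled_u 2%:R k - - sound).
Proof.
apply: (bigO_eq _ (bigO_conj scaled_u_ac)) => k.
rewrite /scaled_u /sound /slow_lam [nth _ _ _]/= [nth _ _ _]/=.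
rewrite -[(k%:C)^-1](fmorphV (real_complex R)) /=; case: (lam_ac k) => a b.
by apply/eqP; rewrite eq_complex /=; apply/andP; split; apply/eqP; ring.
Qed.

Lemma sound_neq0 : sound != 0.
Proof.
rewrite mulf_neq0 //; first by rewrite eq_complex /= oner_eq0 andbF.
by rewrite eq_complex /= negb_and gt_eqF // sqrtr_gt0 divr_gt0.
Qed.

Lemma sound_sqr : sound * sound = - (5 / 3).
Proof.
rewrite /sound mulrACA -expr2 sqr_i mulN1r -rmorphM -expr2 sqr_sqrtr ?divr_ge0 //.
by rewrite rmorphM fmorphV /= !realC_nat.
Qed.

Let s32 : C := (Num.sqrt (3 / 2))%:C.

(** Powers of $\mathrm i$ and of $\sqrt{3/2}$ turn the two nontrivial rows of the exact block into
    the rows of a closure in the scaled variables. *)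
Lemma scaled_rows (j : 'I_3) : \forall k \near 0^'+,
  coef 1 0 k / ('i%C * k%:C) + coef 1 1 k / k%:C * scaled_u j k
    + coef 1 4 k * s32 / ('i%C * k%:C) * scaled_t j k = scaled_u j k * scaled_u j k /\
  coef 4 0 k / (k%:C * s32) + 'i%C * coef 4 1 k / (k%:C * s32) * scaled_u j k
    + coef 4 4 k / k%:C * scaled_t j k = scaled_u j k * scaled_t j k.
Proof.
apply: filterS2 near_admissible (nbhs_right_gt 0) => k adm k0.
have ek : enorm (wave_e1 k) = k by rewrite enorm_wave_e1 ?ltW.
have k0' : k%:C != 0 :> C by rewrite eq_complex /= gt_eqF.
have i0 : 'i%C != 0 :> C by rewrite eq_complex /= oner_eq0 andbF.
have [] := exact_block_eigen j adm; rewrite ek.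
have tE : slow_t k j = s32 * scaled_t j k by rewrite mulrC divfK // sqrt32_neq0.
have lE : slow_lam k j = k%:C * scaled_u j k by rewrite mulrC divfK.
have uE : slow_u k j = 'i%C * scaled_u j k by rewrite /slow_u /scaled_u mulrAC mulrA.
rewrite uE tE lE; move: (scaled_u j k) (scaled_t j k) => u t e1 e4.
have s0 : s32 != 0 := sqrt32_neq0.
split.
  have ik0 : 'i%C * k%:C != 0 :> C by rewrite mulf_neq0.
  apply: (mulIf ik0); rewrite (_ : u * u * ('i%C * k%:C) = 'i%C * u * (k%:C * u)); last by ring.
  by rewrite -e1; field; rewrite k0' i0.
have ks0 : k%:C * s32 != 0 :> C by rewrite mulf_neq0.
apply: (mulIf ks0); rewrite (_ : u * t * (k%:C * s32) = s32 * t * (k%:C * u)); last by ring.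
by rewrite -e4; field; rewrite k0' s0.
Qed.

Lemma sqrt23E : (Num.sqrt (2 / 3))%:C = s32^-1.
Proof.
rewrite /s32 -fmorphV; congr (_%:C).
by rewrite -sqrtrV ?divr_ge0 // invf_div.
Qed.

(** [closure_expansion] multiplied by the wave number. *)
Lemma coefs_expansion : coef_expansions tau
  (coef 1 0) (coef 1 1) (coef 1 4) (coef 4 0) (coef 4 1) (coef 4 4).
Proof.
have Md := slow_modes scaled_u_diff.
have Ma := slow_modes scaled_u_ac.
have Mc := slow_modes scaled_u_conj.
have [[c1 c2 c3] [c4 c5 c6]] := closure_expansion tau_gt0 sound_neq0 sound_sqr
  Md Ma Mc (scaled_rows 0) (scaled_rows 1) (scaled_rows 2%:R).
have Oid := @bigO_id R.
have near_k0 : \forall k \near 0^'+, k%:C != 0 :> C.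
  by apply: filterS (nbhs_right_gt 0) => k k0; rewrite eq_complex /= gt_eqF.
have i0 : 'i%C != 0 :> C by rewrite eq_complex /= oner_eq0 andbF.
have s0 : s32 != 0 := sqrt32_neq0.
have s2 : s32 ^+ 2 = 3 / 2.
  by rewrite /s32 -rmorphXn /= sqr_sqrtr ?divr_ge0 // rmorphM fmorphV /= !realC_nat -?complexiE.
split; split; rewrite ?sqrt23E.
- apply: (bigO_near_eq _ (bigO_scale 'i%C (bigO_mul Oid c1))).
  apply: filterS near_k0 => k k0; rewrite /ce1.
  rewrite !(realC_nat, rmorphXn, fmorphV, rmorphM) /= -?complexiE.
  by field; rewrite k0 i0.
- apply: (bigO_near_eq _ (bigO_mul Oid c2)).
  apply: filterS near_k0 => k k0; rewrite /ce2.
  rewrite !(realC_nat, rmorphXn, fmorphV, rmorphN, rmorphM, rmorphD) /= -?complexiE.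
  by field; rewrite k0.
- apply: (bigO_near_eq _ (bigO_scale ('i%C / s32) (bigO_mul Oid c3))).
  apply: filterS near_k0 => k k0; rewrite /ce3.
  rewrite rmorphM /= sqrt23E -?complexiE.
  by field; rewrite k0 i0 s0.
- apply: (bigO_near_eq _ (bigO_scale s32 (bigO_mul Oid c4))).
  apply: filterS near_k0 => k k0; rewrite /ce4.
  rewrite !(realC_nat, rmorphXn, fmorphV, rmorphN, rmorphM, rmorphD) /= sqrt23E.
  rewrite (_ : 2 / 3 = s32 ^- 2); last by rewrite s2 invf_div.
  by field; rewrite k0 s0.
- apply: (bigO_near_eq _ (bigO_scale (s32 / 'i%C) (bigO_mul Oid c5))).
  apply: filterS near_k0 => k k0; rewrite /ce5.
  rewrite !(realC_nat, rmorphXn, fmorphV, rmorphM) /= sqrt23E -?complexiE.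
  have iV : 'i%C^-1 = - 'i%C :> C.
    by apply: (mulfI i0); rewrite divff // mulrN -expr2 sqr_i opprK.
  have e1 : s32 * (2 / 3) = s32^-1.
    by apply: (mulfI s0); rewrite mulrA -expr2 s2 divff //; field.
  transitivity (coef 4 1 k + 'i%C * k%:C * (s32 * (2 / 3)) +
     1 / 3 * 'i%C * (s32 * (2 / 3)) * tau%:C ^+ 2 * k%:C ^+ 3).
    by rewrite e1; field.
  rewrite -[RHS]mulrA iV.
  transitivity (coef 4 1 k * ('i%C * - 'i%C) +  'i%C * k%:C * (s32 * (2 / 3)) +
     1 / 3 * 'i%C * (s32 * (2 / 3)) * tau%:C ^+ 2 * k%:C ^+ 3).
    by rewrite mulrN -expr2 sqr_i opprK mulr1.
  by field; rewrite k0 s0.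
apply: (bigO_near_eq _ (bigO_mul Oid c6)).
apply: filterS near_k0 => k k0; rewrite /ce6.
rewrite !(realC_nat, rmorphXn, fmorphV, rmorphN, rmorphM, rmorphD) /= -?complexiE.
by field; rewrite k0.
Qed.

End ExactHydrodynamics.

(** * Macroscopic variables and truncated generators *)

Section MacroscopicVariables.
Variable R : realType.
Local Notation C := R[i].

(** The diagonal of [Dmacro]. *)
Definition macro_scale (j : 'I_5) : R := [:: 1; 1; 1; 1; Num.sqrt (3 / 2)]`_j.

Lemma macro_scale_gt0 j : 0 < macro_scale j.
Proof.
by rewrite /macro_scale; case: j => -[|[|[|[|[|//]]]]] p /=; rewrite ?ltr01.
Qed.

Lemma DmacroE : Dmacro R = diag_mx (\row_j (macro_scale j)%:C).
Proof.
congr diag_mx; apply/rowP => j; rewrite !mxE /macro_scale.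
by case: j => -[|[|[|[|[|//]]]]] p.
Qed.

Definition macro_inv : 'M[C]_5 := diag_mx (\row_j (macro_scale j)^-1%:C).

Lemma Dmacro_inv : Dmacro R *m macro_inv = 1%:M.
Proof.
rewrite DmacroE /macro_inv mul_diag_mx; apply/matrixP => i j; rewrite !mxE.
case: eqP => [->|_]; last by rewrite !mulr0n mulr0.
by rewrite !mulr1n -rmorphM divff // gt_eqF // macro_scale_gt0.
Qed.

Lemma invmx_Dmacro : invmx (Dmacro R) = macro_inv.
Proof.
have [uD _] := mulmx1_unit Dmacro_inv.
by rewrite -[LHS]mulmx1 -Dmacro_inv mulmxA mulVmx // mul1mx.
Qed.

Lemma Cderivable_scale (f : R -> C) (c t : R) : Cderivable f t 1 ->
  Cderivable (fun s => c%:C * f s) t 1 /\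
  Cderive (fun s => c%:C * f s) t 1 = c%:C * Cderive f t 1.
Proof.
move=> [dr di]; rewrite /Cderivable /Cderive.
have rE : (fun s => cRe (c%:C * f s)) = c *: (fun s => cRe (f s)).
  by apply/funext => s; rewrite mulrC Re_mulr_real mulrC.
have iE : (fun s => cIm (c%:C * f s)) = c *: (fun s => cIm (f s)).
  by apply/funext => s; rewrite mulrC Im_mulr_real mulrC.
rewrite rE iE; split; first by split; exact: derivableZ.
rewrite !deriveZ //; apply/eqP; rewrite eq_complex /=.
by rewrite !mul0r subr0 addr0 !eqxx.
Qed.

Lemma solves_diag (c : 'I_5 -> R) (I : set R) (A : 'M[C]_5) (h : R -> 'cV[C]_5) :
  (forall j, c j != 0) -> solves I A h ->
  solves I (diag_mx (\row_j (c j)%:C) *m A *m diag_mx (\row_j (c j)^-1%:C))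
    (fun t => diag_mx (\row_j (c j)%:C) *m h t).
Proof.
move=> c0 S t It j; have [d E] := S t It j.
have -> : (fun s => (diag_mx (\row_j (c j)%:C) *m h s) j 0) =
          (fun s => (c j)%:C * h s j 0).
  by apply/funext => s; rewrite mul_diag_mx !mxE.
have [d' E'] := Cderivable_scale (c j) d; split=> //.
rewrite E' E; set D := diag_mx _; set D' := diag_mx _.
have D'D : D' *m D = 1%:M.
  rewrite mul_diag_mx; apply/matrixP => i k; rewrite !mxE.
  case: eqP => [->|_]; last by rewrite !mulr0n mulr0.
  by rewrite !mulr1n -rmorphM mulVf.
by rewrite -!mulmxA (mulmxA D') D'D mul1mx mul_diag_mx !mxE.
Qed.

Lemma solves_macro (I : set R) (A : 'M[C]_5) (w : R -> 'cV[C]_5) :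
  solves I A (fun t => Dmacro R *m w t) <->
  solves I (invmx (Dmacro R) *m A *m Dmacro R) w.
Proof.
have s0 j : macro_scale j != 0 by rewrite gt_eqF // macro_scale_gt0.
have [uD _] := mulmx1_unit Dmacro_inv.
split=> S.
  have := solves_diag (fun j => invr_neq0 (s0 j)) S.
  rewrite -/macro_inv (_ : diag_mx (\row_j ((macro_scale j)^-1)^-1%:C) = Dmacro R).
    rewrite (_ : (fun t => macro_inv *m (Dmacro R *m w t)) = w) ?invmx_Dmacro //.
    by apply/funext => t; rewrite mulmxA -invmx_Dmacro mulVmx // mul1mx.
  by rewrite DmacroE; congr diag_mx; apply/rowP => j; rewrite !mxE invrK.
have := solves_diag s0 S; rewrite -/macro_inv -DmacroE -invmx_Dmacro.
by rewrite !mulmxA mulmxV // mul1mx -mulmxA mulmxV // mulmx1.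
Qed.

Lemma i5P (i : 'I_5) : [\/ i = i_rho, exists l, i = i_u l | i = i_T].
Proof.
case: i => -[|[|[|[|[|//]]]]] p.
- by constructor 1; exact: val_inj.
- by constructor 2; exists 0; exact: val_inj.
- by constructor 2; exists 1; exact: val_inj.
- by constructor 2; exists 2%:R; exact: val_inj.
- by constructor 3; exact: val_inj.
Qed.

(** [Dmacro] is scalar on the velocity block, the only one on which the rotation acts. *)
Lemma Dmacro_comm (Q : 'M[R]_3) : Dmacro R *m Qtilde Q = Qtilde Q *m Dmacro R.
Proof.
have su l : macro_scale (i_u l) = 1.
  by rewrite /macro_scale; case: l => -[|[|[|//]]] p.
have rE j : (\row_j (macro_scale j)%:C) 0 j = (macro_scale j)%:C by rewrite mxE.
rewrite DmacroE mul_diag_mx mul_mx_diag; apply/matrixP => i j.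
rewrite [LHS]mxE [RHS]mxE !rE Qtilde_entry.
have [->|[l ->]|->] := i5P i; have [->|[m ->]|->] := i5P j;
  rewrite ?Qreal_rho ?Qreal_u ?Qreal_T ?su ?mulr0 ?mul0r // mulrC //.
Qed.

(** Finitely many entries share a constant and a radius. *)
Lemma bigO_uniform n (E : R -> 'M[C]_5) : bigOmx n E ->
  exists M d : R, 0 < d /\ forall k, 0 < k < d -> forall i j,
    normc (E k i j) <= M * k ^+ n.
Proof.
move=> OE.
have /choice[M HM] : forall ij : 'I_5 * 'I_5, exists M : R,
    \forall k \near 0^'+, normc (E k ij.1 ij.2) <= M * k ^+ n.
  by move=> [i j]; exact: OE.
have : \forall k \near 0^'+, forall ij : 'I_5 * 'I_5,
    normc (E k ij.1 ij.2) <= M ij * k ^+ n.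
  exact: filter_forall.
rewrite near_withinE => -[/= d d0 Hd].
exists (\sum_ij `|M ij|), d; split=> // k /andP[k0 kd] i j.
have := Hd k; rewrite /ball /= sub0r normrN gtr0_norm // => /(_ kd k0 (i, j)) /=.
move=> /le_trans; apply; rewrite ler_wpM2r ?exprn_ge0 ?(ltW k0) //.
rewrite (bigD1 (i, j)) //= (le_trans (ler_norm _)) // lerDl.
exact: sumr_ge0.
Qed.

(** The coefficients of the entries as polynomials in the wave number; cutting these lists
    gives the lower truncations. *)
Definition burnett_rows (tau : R) : seq (seq (seq C)) :=
  [:: [:: [::];         [:: 0; - 'i%C];            [::]; [::]; [::]];
      [:: [:: 0; - 'i%C; 0; - ((4 / 3 * tau ^+ 2)%:C * 'i%C)];
          [:: 0; 0; - (4 / 3 * tau)%:C]; [::]; [::]; [:: 0; - 'i%C]];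
      [:: [::]; [::]; [:: 0; 0; - tau%:C]; [::]; [::]];
      [:: [::]; [::]; [::]; [:: 0; 0; - tau%:C]; [::]];
      [:: [::]; [:: 0; - ((2 / 3)%:C * 'i%C); 0; - ((2 / 9 * tau ^+ 2)%:C * 'i%C)];
          [::]; [::]; [:: 0; 0; - (5 / 3 * tau)%:C]]].

Definition truncated_poly (tau : R) (n : nat) : 'M[{poly C}]_5 :=
  \matrix_(i, j) Poly (take n.+1 (nth [::] (nth [::] (burnett_rows tau) i) j)).

Lemma truncated_poly_size tau n i j : (size (truncated_poly tau n i j) <= n.+1)%N.
Proof. by rewrite mxE (leq_trans (size_Poly _)) // size_take; case: ltnP. Qed.

Lemma euler_polyE tau k i j : euler_mx k i j = (truncated_poly tau 1 i j).[k%:C].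
Proof.
rewrite !mxE horner_Poly.
by case: i => -[|[|[|[|[|//]]]]] p; case: j => -[|[|[|[|[|//]]]]] q //=;
  rewrite -?complexiE ?rmorphM ?rmorphXn /=; ring.
Qed.

Lemma navier_stokes_polyE tau k i j :
  navier_stokes_mx tau k i j = (truncated_poly tau 2 i j).[k%:C].
Proof.
rewrite !mxE horner_Poly.
by case: i => -[|[|[|[|[|//]]]]] p; case: j => -[|[|[|[|[|//]]]]] q //=;
  rewrite -?complexiE ?rmorphM ?rmorphXn /=; ring.
Qed.

Lemma burnett_polyE tau k i j :
  burnett_mx tau k i j = (truncated_poly tau 3 i j).[k%:C].
Proof.
rewrite !mxE horner_Poly.
by case: i => -[|[|[|[|[|//]]]]] p; case: j => -[|[|[|[|[|//]]]]] q //=;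
  rewrite -?complexiE ?rmorphM ?rmorphXn /=; ring.
Qed.

End MacroscopicVariables.

(** * Truncation of the exact generator *)

Section Truncations.
Variable R : realType.
Local Notation C := R[i].
Variables (tau : R) (lam_diff lam_shear : R -> R) (lam_ac : R -> C).
Variable Q : 'cV[R]_3 -> 'M[R]_3.
Hypothesis tau_gt0 : 0 < tau.
Hypothesis Hspec : spectrum_spec tau lam_diff lam_shear lam_ac.
Hypothesis Hexp : lam_expansions tau lam_diff lam_shear lam_ac.
Hypothesis HQ : wave_rotation Q.
Hypothesis Hbasis : spectral_basis_spec tau lam_diff lam_shear lam_ac Q.

Definition macro_block (k : R) : 'M[C]_5 :=
  macro_inv R *m exact_block tau lam_diff lam_shear lam_ac k *m Dmacro R.

Lemma macro_gen_block kk : admissible tau kk ->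
  (Qtilde (Q kk))^T *m macro_gen tau lam_diff lam_shear lam_ac Q kk
    *m Qtilde (Q kk) = macro_block (enorm kk).
Proof.
move=> adm; have [_ E] := exact_gen_block HQ Hbasis adm.
have [[QQ _] _] := HQ kk.
have QV := Qtilde_orthV QQ.
have DQ := Dmacro_comm (Q kk).
have DQT : macro_inv R *m (Qtilde (Q kk)) = Qtilde (Q kk) *m macro_inv R.
  have [uD _] := mulmx1_unit (Dmacro_inv R).
  rewrite -[LHS]mulmx1 -(Dmacro_inv R) -invmx_Dmacro.
  by rewrite mulmxA -(mulmxA (invmx _)) -DQ mulmxA mulVmx // mul1mx.
rewrite /macro_gen E invmx_Dmacro /macro_block.
move: (Qtilde _) (Qtilde _)^T (macro_inv R) (Dmacro R) (exact_block _ _ _ _ _)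
  QV DQ DQT => P PT V D A QV DQ DQT.
transitivity (PT *m (V *m P) *m A *m PT *m (D *m P)); first by rewrite !mulmxA.
rewrite DQ DQT.
transitivity ((PT *m P) *m V *m A *m (PT *m P) *m D); first by rewrite !mulmxA.
by rewrite QV mul1mx mulmx1.
Qed.

Lemma truncation_of_bigO n (T : R -> 'M[C]_5) :
  (forall k i j, T k i j = (truncated_poly tau n i j).[k%:C]) ->
  bigOmx n.+1 (fun k => macro_block k - T k) ->
  truncation Q n (macro_gen tau lam_diff lam_shear lam_ac Q) T.
Proof.
move=> TE OT; split.
  by exists (truncated_poly tau n) => // i j; exact: truncated_poly_size.
have [M [d [d0 HM]]] := bigO_uniform OT.
pose K := Num.sqrt (pi / 2) / tau.
have K0 : 0 < K by rewrite divr_gt0 // sqrtr_gt0 divr_gt0 // pi_gt0.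
exists M, (Num.min d K); split; first by rewrite lt_min d0 K0.
move=> kk /andP[k0]; rewrite lt_min => /andP[kd kK] i j.
have adm : admissible tau kk by rewrite /admissible k0.
by rewrite macro_gen_block //; apply: HM; rewrite k0.
Qed.

Local Notation c10 := (coef tau lam_diff lam_shear lam_ac 1 0).
Local Notation c11 := (coef tau lam_diff lam_shear lam_ac 1 1).
Local Notation c14 := (coef tau lam_diff lam_shear lam_ac 1 4).
Local Notation c40 := (coef tau lam_diff lam_shear lam_ac 4 0).
Local Notation c41 := (coef tau lam_diff lam_shear lam_ac 4 1).
Local Notation c44 := (coef tau lam_diff lam_shear lam_ac 4 4).
Let s32 : C := (Num.sqrt (3 / 2))%:C.

(* The difference between the exact block and the Burnett matrix, entry by entry, in
   the form in which coefs_expansion bounds it. *)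
Let err (k : R) : 'M[C]_5 := mx_of_rows
   [:: [:: 0; 0; 0; 0; 0];
       [:: c10 k - (- ('i%C * k%:C) - 'i%C * (4 / 3 * tau ^+ 2 * k ^+ 3)%:C);
           c11 k - (- (4 / 3) * tau * k ^+ 2)%:C; 0; 0;
           s32 * (c14 k - (- ('i%C * (Num.sqrt (2 / 3) * k)%:C)))];
       [:: 0; 0; (lam_shear k)%:C - (- tau * k ^+ 2)%:C; 0; 0];
       [:: 0; 0; 0; (lam_shear k)%:C - (- tau * k ^+ 2)%:C; 0];
       [:: s32^-1 * c40 k;
           s32^-1 * (c41 k - (- ('i%C * (Num.sqrt (2 / 3) * k)%:C)
              - 'i%C * (1 / 3 * Num.sqrt (2 / 3) * tau ^+ 2 * k ^+ 3)%:C));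
           0; 0; c44 k - (- (5 / 3) * tau * k ^+ 2)%:C]].

Let macro_block_entry k i j : macro_block k i j =
  (macro_scale R i)^-1%:C * exact_block tau lam_diff lam_shear lam_ac k i j
   * (macro_scale R j)%:C.
Proof.
rewrite /macro_block DmacroE mul_mx_diag /macro_inv mul_diag_mx.
by rewrite [LHS]mxE [X in X * _]mxE; congr (_ * _ * _); rewrite mxE.
Qed.

Let near_err : \forall k \near 0^'+, macro_block k - burnett_mx tau k = err k.
Proof.
apply: filterS2 (near_admissible tau_gt0) (nbhs_right_gt 0) => k adm k0.
have ek : enorm (wave_e1 k) = k by rewrite enorm_wave_e1 ?ltW.
have := exact_block_hydro HQ Hbasis adm; rewrite ek /= => hE.
have s0 : s32 != 0 := sqrt32_neq0 R.
have s2 : s32 ^- 2 = 2 / 3 :> C.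
  rewrite -exprVn -(sqrt23E R) -rmorphXn /= sqr_sqrtr ?divr_ge0 //.
  by rewrite rmorphM fmorphV /= !realC_nat.
have sV : (Num.sqrt (3 / 2))^-1%:C = s32^-1 :> C by rewrite /s32 -fmorphV.
have s1 : (1^-1 : R)%:C = 1 :> C by rewrite invr1.
apply/matrixP => i j; rewrite [LHS]mxE [X in _ + X]mxE macro_block_entry hE !mxE.
rewrite /macro_scale.
case: i => -[|[|[|[|[|//]]]]] p; case: j => -[|[|[|[|[|//]]]]] q /=;
  rewrite ?s1 ?sV -/s32 ?mul1r ?mulr1 ?mulr0 ?mul0r ?subr0 ?subrr -?complexiE //.
- by rewrite !(realC_nat, rmorphXn, fmorphV, rmorphN, rmorphM) /=; ring.
- by rewrite !(realC_nat, rmorphXn, fmorphV, rmorphN, rmorphM) /=; ring.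
- by rewrite rmorphM /= sqrt23E; field; rewrite s0.
- by rewrite !(realC_nat, rmorphXn, fmorphV, rmorphN, rmorphM) /=; ring.
- by rewrite !(realC_nat, rmorphXn, fmorphV, rmorphN, rmorphM) /=; ring.
- rewrite !(realC_nat, rmorphXn, fmorphV, rmorphN, rmorphM) /= sqrt23E -/s32.
  rewrite !realC_nat (_ : 2 / 9 = 1 / 3 * s32 ^- 2); last by rewrite s2; field.
  by rewrite -s2; field; rewrite s0.
- have -> : s32^-1 * c44 k * s32 = c44 k by rewrite mulrAC mulVf // mul1r.
  by rewrite !(realC_nat, rmorphXn, fmorphV, rmorphN, rmorphM) /=; ring.
Qed.

(** The fourth-order terms of the coefficients are part of the error. *)
Lemma burnett_error : bigOmx 4 (fun k => macro_block k - burnett_mx tau k).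
Proof.
have [[a1 a2 a3] [a4 a5 a6]] := coefs_expansion tau_gt0 Hspec Hexp HQ Hbasis.
have [_ Os _] := Hexp.
have O0 := @bigO_0 R 4.
have drop (f : R -> C) (a b : R) m : (4 <= m)%N ->
    bigO_at0 m (fun k => f k - (a * k ^+ 2 + b * k ^+ 4)%:C) ->
    bigO_at0 4 (fun k => f k - (a * k ^+ 2)%:C).
  move=> m4 Of; have Ob := bigO_monomial b%:C (leqnn 4).
  apply: (bigO_eq _ (bigO_add (bigO_weak m4 Of) Ob)) => k.
  by rewrite rmorphD -rmorphXn -rmorphM /=; ring.
move=> i j; apply: (@bigO_near_eq _ _ _ (fun k => err k i j)).
  by apply: filterS near_err => k ->.
apply: (@bigO_eq _ _ _ (fun k => nth 0 (nth [::] _ i) j)).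
  by move=> k; rewrite mxE; reflexivity.
case: i => -[|[|[|[|[|//]]]]] p; case: j => -[|[|[|[|[|//]]]]] q //=.
- exact: bigO_weak (leqnSn 4) a1.
- exact: drop a2.
- by apply: bigO_scale; exact: bigO_weak (leqnSn 4) a3.
- exact: drop Os.
- exact: drop Os.
- apply: bigO_scale.
  apply: (bigO_eq _ (bigO_add (bigO_weak (isT : (4 <= 6)%N) a4)
     (bigO_monomial (- Num.sqrt (2 / 3) * tau ^+ 3)%:C (leqnn 4)))) => k.
  by rewrite -rmorphXn -rmorphM /= subrK.
- by apply: bigO_scale; exact: bigO_weak (leqnSn 4) a5.
- exact: drop a6.
Qed.

Lemma navier_stokes_error : bigOmx 3 (fun k => macro_block k - navier_stokes_mx tau k).
Proof.
apply: (@bigOmx_eq _ _ _ _ _ (fun k => (macro_block k - burnett_mx tau k) +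
          (burnett_mx tau k - navier_stokes_mx tau k))).
  by move=> k; rewrite addrA subrK.
apply: bigOmx_add; first exact: bigOmx_weak burnett_error.
move=> i j; pose c : C := nth 0 (nth [::] [:: [::];
  [:: - (4 / 3 * tau ^+ 2)%:C * 'i%C]; [::]; [::];
  [:: 0; - (2 / 9 * tau ^+ 2)%:C * 'i%C]] i) j.
apply: (bigO_eq _ (bigO_monomial c (leqnn 3))) => k; rewrite !mxE /c.
case: i {c} => -[|[|[|[|[|//]]]]] p; case: j => -[|[|[|[|[|//]]]]] q /=;
  rewrite ?nth_nil ?mul0r ?subrr // -?complexiE.
all: by rewrite !(realC_nat, rmorphXn, fmorphV, rmorphN, rmorphM) /=; ring.
Qed.

Lemma euler_error : bigOmx 2 (fun k => macro_block k - euler_mx k).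
Proof.
apply: (@bigOmx_eq _ _ _ _ _ (fun k => (macro_block k - navier_stokes_mx tau k) +
          (navier_stokes_mx tau k - euler_mx k))).
  by move=> k; rewrite addrA subrK.
apply: bigOmx_add; first exact: bigOmx_weak navier_stokes_error.
move=> i j; pose c : C := nth 0 (nth [::] [:: [::];
  [:: 0; - (4 / 3 * tau)%:C]; [:: 0; 0; - tau%:C]; [:: 0; 0; 0; - tau%:C];
  [:: 0; 0; 0; 0; - (5 / 3 * tau)%:C]] i) j.
apply: (bigO_eq _ (bigO_monomial c (leqnn 2))) => k; rewrite !mxE /c.
case: i {c} => -[|[|[|[|[|//]]]]] p; case: j => -[|[|[|[|[|//]]]]] q /=;
  rewrite ?nth_nil ?mul0r ?subrr //.
all: by rewrite !(realC_nat, rmorphXn, fmorphV, rmorphN, rmorphM) /=; ring.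
Qed.

Lemma truncations :
  [/\ truncation Q 1 (macro_gen tau lam_diff lam_shear lam_ac Q) (@euler_mx R),
      truncation Q 2 (macro_gen tau lam_diff lam_shear lam_ac Q) (navier_stokes_mx tau) &
      truncation Q 3 (macro_gen tau lam_diff lam_shear lam_ac Q) (burnett_mx tau)].
Proof.
split.
- apply: truncation_of_bigO; [exact: euler_polyE|exact: euler_error].
- apply: truncation_of_bigO; [exact: navier_stokes_polyE|exact: navier_stokes_error].
- apply: truncation_of_bigO; [exact: burnett_polyE|exact: burnett_error].
Qed.

End Truncations.

(** * Termwise differentiation of series *)

Section TermwiseDerivative.
Variable R : realType.

Lemma dominated_series_cvg (r b : nat -> R) : (forall n, `|r n| <= b n) ->
  cvgn (series b) -> cvgn (series r).
Proof.
move=> rb cb; apply: normed_cvg; apply: (series_le_cvg _ _ rb cb) => n //=.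
exact: le_trans (rb n).
Qed.

(** The first [N] terms are kept, since they will be small for a reason of their own; the
    others are bounded by the tail of the dominating series. *)
Lemma series_tail_le (r b : nat -> R) N : (forall n, `|r n| <= b n) ->
  cvgn (series b) ->
  `|limn (series r)| <= \sum_(0 <= n < N) `|r n| + (limn (series b) - series b N).
Proof.
move=> rb cb.
have b0 n : 0 <= b n by exact: le_trans (rb n).
have cr : cvgn (series r) by exact: dominated_series_cvg cb.
have cnr : cvgn (fun n => `|series r n|) by exact: is_cvg_norm.
rewrite -lim_norm //; apply: limr_le => //.
near=> n.
have Nn : (N <= n)%N by near: n; exact: nbhs_infty_ge.
rewrite /series /= (big_cat_nat (n := N)) //= (le_trans (ler_normD _ _)) //.
apply: lerD; first exact: ler_norm_sum.
apply: (@le_trans _ _ (series b n - series b N)).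
  rewrite /series /= [X in _ <= X - _](big_cat_nat (n := N)) //= addrAC subrr add0r.
  by rewrite (le_trans (ler_norm_sum _ _ _)) // ler_sum.
rewrite lerD2r; apply: nondecreasing_cvgn_le => //.
by apply: nondecreasing_series => i _ _; exact: b0.
Unshelve. all: by end_near. Qed.

(** The mean value theorem. *)
Lemma derivative_bound (g dg : R -> R) (e B h : R) :
  (forall x, `|x| < e -> is_derive x (1 : R) g (dg x)) ->
  (forall x, `|x| < e -> `|dg x| <= B) -> `|h| < e ->
  `|g h - g 0| <= B * `|h|.
Proof.
move=> Dg dgB he.
have cg x : `|x| < e -> {for x, continuous g}.
  move=> xe; apply: differentiable_continuous; apply/derivable1_diffP.
  by have [] := Dg x xe.
have e0 : 0 < e by exact: le_lt_trans he.
have mvt a b : a < b -> `|a| < e -> `|b| < e ->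
    `|g b - g a| <= B * (b - a).
  move=> ab ae be.
  have inside x : x \in `[a, b] -> `|x| < e.
    rewrite in_itv /= => /andP[ax xb]; rewrite ltr_norml.
    move: ae be; rewrite !ltr_norml => /andP[ae _] /andP[_ be].
    by rewrite (lt_le_trans ae ax) (le_lt_trans xb be).
  have [c cab ->] : exists2 c, c \in `]a, b[%R & g b - g a = dg c * (b - a).
    apply: (@MVT _ g dg) => // [x xab|].
      by apply: Dg; apply: inside; exact: subset_itv_oo_cc.
    by apply: continuous_in_subspaceT => x; rewrite inE /= => /inside/cg.
  have ba : 0 < b - a by rewrite subr_gt0.
  rewrite normrM (gtr0_norm ba); apply: ler_wpM2r; first exact: ltW.
  by apply: dgB; apply: inside; exact: subset_itv_oo_cc.
have [h0|h0|->] := ltgtP h 0.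
- by rewrite distrC (ltr0_norm h0) -[- h]sub0r; apply: mvt; rewrite ?normr0.
- by rewrite (gtr0_norm h0) -[h in B * h]subr0; apply: mvt; rewrite ?normr0.
- by rewrite subrr normr0 mulr0.
Qed.

(** Termwise differentiation: the difference quotients are dominated by the
    bound on the derivatives, so the tail of their series is uniformly small. *)
Lemma is_derive_series0 (g dg : nat -> R -> R) (B : nat -> R) (e : R) :
  0 < e -> cvgn (series B) ->
  (forall n x, `|x| < e -> is_derive x (1 : R) (g n) (dg n x)) ->
  (forall n x, `|x| < e -> `|dg n x| <= B n) ->
  (forall x, `|x| < e -> cvgn (series (g^~ x))) ->
  is_derive (0 : R) (1 : R) (fun x => limn (series (g^~ x))) (limn (series (dg^~ 0))).
Proof.
move=> e0 cB Dg dgB cg.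
pose G x := limn (series (g^~ x)).
have n0e : `|0 : R| < e by rewrite normr0.
have B0 n : 0 <= B n by exact: le_trans (dgB n 0 n0e).
have cdg : cvgn (series (dg^~ 0)) by apply: dominated_series_cvg cB => n; exact: (dgB n 0 n0e).
pose r h n := h^-1 * (g n h - g n 0) - dg n 0.
have quot h : `|h| < e -> h^-1 * (G h - G 0) - limn (series (dg^~ 0)) =
    limn (series (r h)).
  move=> he; apply/esym/cvg_lim => //.
  have -> : series (r h) = (fun n => h^-1 * (series (g^~ h) n - series (g^~ 0) n) -
      series (dg^~ 0) n).
    by apply/funext => n; rewrite /series /= /r sumrB -mulr_sumr sumrB.
  by apply: cvgB => //; apply: cvgMr; apply: cvgB; exact: cg.
have rB h n : h != 0 -> `|h| < e -> `|r h n| <= 2 * B n.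
  move=> h0 he; rewrite /r (le_trans (ler_normB _ _)) // mulr2n mulrDl mul1r lerD //.
    rewrite normrM normfV ler_pdivrMl ?normr_gt0 // mulrC.
    exact: (derivative_bound (Dg n) (dgB n) he).
  exact: (dgB n 0 n0e).
have c2B : cvgn (series (fun n => 2 * B n)).
  have -> : series (fun n => 2 * B n) = (fun n => 2 * series B n).
    by apply/funext => n; rewrite /series /= mulr_sumr.
  exact: is_cvgMr.
have rto0 n : r h n @[h --> 0^'] --> (0 : R).
  have [dn En] := Dg n 0 n0e.
  have : h^-1 *: ((g n \o shift 0) (h *: (1 : R)) - g n 0) @[h --> 0^'] --> dg n 0.
    by rewrite -En; exact: dn.
  move=> /(cvgB)/(_ (cvg_cst (dg n 0))); rewrite subrr; apply: cvg_trans.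
  apply: near_eq_cvg; apply: nearW => h.
  by rewrite /r /= !fctE /= addr0 /GRing.scale /= mulr1.
have lim0 : h^-1 *: ((G \o shift 0) (h *: (1 : R)) - G 0) @[h --> 0^']
     --> limn (series (dg^~ 0)).
  apply/cvgrPdist_le => eps eps0.
  have eps20 : 0 < eps / 2 by rewrite divr_gt0.
  have /cvgrPdist_le/(_ _ eps20)[N _ /(_ N (leqnn N)) /=] := c2B.
  move=> tail.
  have fin : \forall h \near 0^', \sum_(0 <= n < N) `|r h n| <= eps / 2.
    have : \sum_(0 <= n < N) `|r h n| @[h --> 0^'] --> \sum_(0 <= n < N) `|0 : R|.
      by apply: cvg_big => // [|n _]; [exact: add_continuous|exact: cvg_norm].
    rewrite big1 ?normr0 // => /cvgrPdist_le/(_ _ eps20); apply: filterS => h.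
    by rewrite sub0r normrN; apply: le_trans; exact: ler_norm.
  near=> h.
  have h0 : h != 0 by near: h; exact: (nbhs_dnbhs_neq (0 : R)).
  have he : `|h| < e.
    by near: h; apply: dnbhs0_lt.
  rewrite distrC /= addr0 /GRing.scale /= mulr1 quot //.
  apply: (le_trans (series_tail_le N (fun n => rB h n h0 he) c2B)).
  rewrite [leRHS]splitr; apply: lerD; first by near: h.
  exact: le_trans (ler_norm _) tail.
apply: DeriveDef.
  by apply/cvg_ex; exists (limn (series (dg^~ 0))).
exact: (cvg_lim _ lim0).
Unshelve. all: by end_near. Qed.

End TermwiseDerivative.

(** * Series of complex functions *)

Section ComplexSeries.
Variables (R : realType) (V : normedModType R).
Local Notation C := R[i].

(** Reduces directional derivatives to derivatives of a function of one variable. *)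
Lemma is_derive_line (f : V -> R) (a v : V) (s df : R) :
  is_derive s (1 : R) (fun r => f (r *: v + a)) df <-> is_derive (s *: v + a) v f df.
Proof.
have E : (fun h : R => h^-1 *: ((f \o shift (s *: v + a)) (h *: v) - f (s *: v + a))) =
   (fun h : R => h^-1 *: (((fun r => f (r *: v + a)) \o shift s) (h *: (1 : R))
       - f (s *: v + a))).
  apply/funext => h /=; congr (_ *: (f _ - _)).
  by rewrite /GRing.scale /= mulr1 addrA -scalerDl.
split=> -[D <-]; apply: DeriveDef.
- by rewrite /derivable E.
- by rewrite /derive E.
- by rewrite /derivable -E.
- by rewrite /derive -E.
Qed.

Definition is_Cderive (f : V -> C) (a v : V) (d : C) : Prop :=
  is_derive a v (fun x => cRe (f x)) (cRe d) /\ is_derive a v (fun x => cIm (f x)) (cIm d).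

Lemma is_CderiveP f a v d : is_Cderive f a v d ->
  Cderivable f a v /\ Cderive f a v = d.
Proof.
by move=> [[D1 E1] [D2 E2]]; split=> //; rewrite /Cderive E1 E2; case: (d).
Qed.

Lemma is_derive_series (f df : nat -> V -> R) (B : nat -> R) (e : R) (a v : V) :
  0 < e -> cvgn (series B) ->
  (forall n s, `|s| < e -> is_derive (s *: v + a) v (f n) (df n (s *: v + a))) ->
  (forall n s, `|s| < e -> `|df n (s *: v + a)| <= B n) ->
  (forall s, `|s| < e -> cvgn (series (fun n => f n (s *: v + a)))) ->
  is_derive a v (fun x => limn (series (f^~ x))) (limn (series (df^~ a))).
Proof.
move=> e0 cB D dB cf.
have D0 := is_derive_series0 e0 cB
  (fun n s se => (is_derive_line (f n) a v s _).2 (D n s se)) dB cf.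
have := (is_derive_line (fun x => limn (series (f^~ x))) a v 0 _).1 D0.
by rewrite scale0r add0r.
Qed.

Definition Csummable (u : nat -> C) : Prop :=
  exists2 B : nat -> R, cvgn (series B) & forall n, normc (u n) <= B n.

Lemma Csummable_Re u : Csummable u -> cvgn (series (fun n => cRe (u n))).
Proof.
case=> B cB uB; apply: dominated_series_cvg cB => n.
exact: le_trans (Re_le_normc _) (uB n).
Qed.

Lemma Csummable_Im u : Csummable u -> cvgn (series (fun n => cIm (u n))).
Proof.
case=> B cB uB; apply: dominated_series_cvg cB => n.
exact: le_trans (Im_le_normc _) (uB n).
Qed.

Lemma is_Cderive_series (f df : nat -> V -> C) (B : nat -> R) (e : R) (a v : V) :
  0 < e -> cvgn (series B) ->
  (forall n s, `|s| < e -> is_Cderive (f n) (s *: v + a) v (df n (s *: v + a))) ->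
  (forall n s, `|s| < e -> normc (df n (s *: v + a)) <= B n) ->
  (forall s, `|s| < e -> Csummable (fun n => f n (s *: v + a))) ->
  is_Cderive (fun x => Cseries (f^~ x)) a v (Cseries (df^~ a)).
Proof.
move=> e0 cB D dB cf; split.
- apply: (@is_derive_series (fun n x => cRe (f n x)) (fun n x => cRe (df n x)) B e
      a v e0 cB (fun n s se => (D n s se).1)).
  + by move=> n s se; exact: le_trans (Re_le_normc _) (dB n s se).
  + by move=> s se; exact: (Csummable_Re (cf s se)).
- apply: (@is_derive_series (fun n x => cIm (f n x)) (fun n x => cIm (df n x)) B e
      a v e0 cB (fun n s se => (D n s se).2)).
  + by move=> n s se; exact: le_trans (Im_le_normc _) (dB n s se).
  + by move=> s se; exact: (Csummable_Im (cf s se)).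
Qed.

Lemma CseriesD u w : Csummable u -> Csummable w ->
  Cseries (fun n => u n + w n) = Cseries u + Cseries w.
Proof.
move=> su sw; rewrite /Cseries; apply/eqP; rewrite eq_complex; apply/andP; split; apply/eqP.
- rewrite Re_add /=; apply: cvg_lim => //.
  have -> : series (fun n => cRe (u n + w n)) =
      (fun n => series (fun n => cRe (u n)) n + series (fun n => cRe (w n)) n).
    apply/funext => n; rewrite /series /= -big_split.
    by apply: eq_bigr => i _; rewrite Re_add.
  by apply: cvgD; exact: Csummable_Re.
- rewrite Im_add /=; apply: cvg_lim => //.
  have -> : series (fun n => cIm (u n + w n)) =
      (fun n => series (fun n => cIm (u n)) n + series (fun n => cIm (w n)) n).
    apply/funext => n; rewrite /series /= -big_split.
    by apply: eq_bigr => i _; rewrite Im_add.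
  by apply: cvgD; exact: Csummable_Im.
Qed.

Lemma CseriesZ (c : C) u : Csummable u -> Cseries (fun n => c * u n) = c * Cseries u.
Proof.
move=> su; have [cr ci] := (Csummable_Re su, Csummable_Im su).
rewrite /Cseries; apply/eqP; rewrite eq_complex; apply/andP; split; apply/eqP.
- rewrite Re_mul /=; apply: cvg_lim => //.
  have -> : series (fun n => cRe (c * u n)) = (fun n => cRe c * series (fun n => cRe (u n)) n
      - cIm c * series (fun n => cIm (u n)) n).
    apply/funext => n; rewrite /series /= !mulr_sumr -sumrB.
    by apply: eq_bigr => i _; rewrite Re_mul.
  by apply: cvgB; apply: cvgMr.
- rewrite Im_mul /=; apply: cvg_lim => //.
  have -> : series (fun n => cIm (c * u n)) = (fun n => cRe c * series (fun n => cIm (u n)) n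
      + cIm c * series (fun n => cRe (u n)) n).
    apply/funext => n; rewrite /series /= !mulr_sumr -big_split.
    by apply: eq_bigr => i _; rewrite Im_mul.
  by apply: cvgD; apply: cvgMr.
Qed.

End ComplexSeries.

(** * Fourier sums *)

Section FourierSums.
Variable R : realType.
Local Notation C := R[i].
Variable kk : nat -> 'cV[R]_3.

Definition phase (q x : 'cV[R]_3) : R := \sum_(l < 3) q l 0 * x l 0.

Lemma normc_expi (y : R) : normc (expi y) = 1.
Proof. by rewrite /expi /= cos2Dsin2 sqrtr1. Qed.

Lemma phase_line (q x : 'cV[R]_3) l (s : R) :
  phase q (s *: delta_mx l 0 + x) = s * q l 0 + phase q x.
Proof.
rewrite /phase; under eq_bigr do rewrite !mxE mulrDr.
rewrite big_split /=; congr (_ + _).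
rewrite (bigD1 l) //= big1 => [|m ml]; first by rewrite eqxx mulr1 addr0 mulrC.
by rewrite (negbTE ml) !mulr0.
Qed.

Lemma is_Cderive_wave (q x : 'cV[R]_3) (c : C) (l : 'I_3) :
  is_Cderive (fun y => c * expi (phase q y)) x (delta_mx l 0)
    ('i%C * (q l 0)%:C * c * expi (phase q x)).
Proof.
case: c => a b.
have Dphase : is_derive (0 : R) (1 : R) (fun r => r * q l 0 + phase q x) (q l 0).
  by apply: is_derive_eq; rewrite addr0 scaler0 add0r /GRing.scale /= mulr1.
have p0 : phase q x = 0 * q l 0 + phase q x by rewrite mul0r add0r.
have Dcos : is_derive (0 : R) (1 : R) (fun r => cos (r * q l 0 + phase q x))
    (- sin (phase q x) * q l 0).
  by rewrite [in X in - sin X]p0; exact: (is_derive1_comp (is_derive_cos _) Dphase).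
have Dsin : is_derive (0 : R) (1 : R) (fun r => sin (r * q l 0 + phase q x))
    (cos (phase q x) * q l 0).
  by rewrite [in X in cos X * _]p0; exact: (is_derive1_comp (is_derive_sin _) Dphase).
have Dre : is_derive (0 : R) (1 : R) (fun r => a * cos (r * q l 0 + phase q x)
    - b * sin (r * q l 0 + phase q x))
    (cRe ('i%C * (q l 0)%:C * (a +i* b) * expi (phase q x))).
  apply: is_derive_eq; rewrite /GRing.scale /=.
  by ring.
have Dim : is_derive (0 : R) (1 : R) (fun r => a * sin (r * q l 0 + phase q x)
    + b * cos (r * q l 0 + phase q x))
    (cIm ('i%C * (q l 0)%:C * (a +i* b) * expi (phase q x))).
  apply: is_derive_eq; rewrite /GRing.scale /=.
  by ring.
split.
- have := (is_derive_line (fun y => cRe ((a +i* b) * expi (phase q y))) x (delta_mx l 0) 0 _).1.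
  rewrite scale0r add0r; apply.
  rewrite [X in is_derive _ _ X](_ : _ = fun r => a * cos (r * q l 0 + phase q x)
    - b * sin (r * q l 0 + phase q x)) //.
  by apply/funext => r; rewrite phase_line Re_mul.
- have := (is_derive_line (fun y => cIm ((a +i* b) * expi (phase q y))) x (delta_mx l 0) 0 _).1.
  rewrite scale0r add0r; apply.
  rewrite [X in is_derive _ _ X](_ : _ = fun r => a * sin (r * q l 0 + phase q x)
    + b * cos (r * q l 0 + phase q x)) //.
  by apply/funext => r; rewrite phase_line Im_mul.
Qed.

Definition fsum (c : nat -> C) (x : 'cV[R]_3) : C :=
  Cseries (fun n => c n * expi (phase (kk n) x)).

(** The coefficients of a sum that may be differentiated [m] times term by term. *)
Definition decay (m : nat) (c : nat -> C) : Prop :=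
  Csummable (fun n => ((1 + enorm (kk n)) ^+ m)%:C * c n).

(** The Fourier multiplier of the derivative in the direction [l]. *)
Definition Dcoef (l : 'I_3) (c : nat -> C) (n : nat) : C := 'i%C * (kk n l 0)%:C * c n.

Lemma enorm_ge0 (q : 'cV[R]_3) : 0 <= enorm q.
Proof. exact: sqrtr_ge0. Qed.

Lemma enorm_sqr (q : 'cV[R]_3) : enorm q ^+ 2 = \sum_(l < 3) q l 0 ^+ 2.
Proof. by rewrite sqr_sqrtr // sumr_ge0 // => l _; rewrite sqr_ge0. Qed.

Lemma coord_le_enorm (q : 'cV[R]_3) l : `|q l 0| <= enorm q.
Proof.
rewrite -ler_sqr ?nnegrE ?enorm_ge0 // enorm_sqr real_normK ?num_real //.
by rewrite (bigD1 l) //= lerDl sumr_ge0 // => m _; rewrite sqr_ge0.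
Qed.

Lemma Csummable_le (K : R) (u w : nat -> C) :
  (forall n, normc (u n) <= K * normc (w n)) -> Csummable w -> Csummable u.
Proof.
move=> uw [B cB wB]; exists (fun n => `|K| * B n).
  have -> : series (fun n => `|K| * B n) = (fun n => `|K| * series B n).
    by apply/funext => n; rewrite /series /= mulr_sumr.
  exact: is_cvgMr.
move=> n; apply: le_trans (uw n) _.
apply: (@le_trans _ _ (`|K| * normc (w n))).
  by apply: ler_wpM2r; [exact: normc_ge0|exact: ler_norm].
by apply: ler_wpM2l.
Qed.

Lemma CsummableD (u w : nat -> C) : Csummable u -> Csummable w ->
  Csummable (fun n => u n + w n).
Proof.
move=> [B cB uB] [B' cB' wB]; exists (fun n => B n + B' n).
  have -> : series (fun n => B n + B' n) = (fun n => series B n + series B' n).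
    by apply/funext => n; rewrite /series /= big_split.
  exact: is_cvgD.
by move=> n; apply: le_trans (normcD _ _) _; exact: lerD.
Qed.

Lemma normc_weight (q : 'cV[R]_3) m : normc ((1 + enorm q) ^+ m)%:C = (1 + enorm q) ^+ m.
Proof. by rewrite normc_real ger0_norm // exprn_ge0 // addr_ge0 // enorm_ge0. Qed.

Lemma decay_weak m m' c : (m' <= m)%N -> decay m c -> decay m' c.
Proof.
move=> mm'; apply: (Csummable_le (K := 1)) => n.
rewrite mul1r !normcM !normc_weight; apply: ler_wpM2r; first exact: normc_ge0.
by rewrite ler_weXn2l // lerDl enorm_ge0.
Qed.

Lemma decayD m c d : decay m c -> decay m d -> decay m (fun n => c n + d n).
Proof.
move=> dc dd; have := CsummableD dc dd.
by apply: (Csummable_le (K := 1)) => n; rewrite mul1r mulrDr.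
Qed.

Lemma decayZ m (a : C) c : decay m c -> decay m (fun n => a * c n).
Proof.
apply: (Csummable_le (K := normc a)) => n.
by rewrite !normcM mulrCA.
Qed.

Lemma decay_sum m (c : 'I_3 -> nat -> C) : (forall j, decay m (c j)) ->
  decay m (fun n => \sum_(j < 3) c j n).
Proof.
move=> dc.
have -> : (fun n => \sum_(j < 3) c j n) = (fun n => c ord0 n +
    (c (lift ord0 ord0) n + c (lift ord0 (lift ord0 ord0)) n)).
  by apply/funext => n; rewrite !big_ord_recl big_ord0 addr0.
by do !apply: decayD.
Qed.

Lemma decay_Dcoef m l c : decay m.+1 c -> decay m (Dcoef l c).
Proof.
apply: (Csummable_le (K := 1)) => n.
rewrite mul1r !normcM !normc_weight normc_i normc_real mul1r exprSr -mulrA.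
apply: ler_wpM2l; first by rewrite exprn_ge0 // addr_ge0 // enorm_ge0.
apply: ler_wpM2r; first exact: normc_ge0.
by rewrite (le_trans (coord_le_enorm _ l)) // lerDr.
Qed.

Lemma decay_summable c x : decay 0 c -> Csummable (fun n => c n * expi (phase (kk n) x)).
Proof.
apply: (Csummable_le (K := 1)) => n.
by rewrite mul1r expr0 !normcM normc_expi normc1 mul1r mulr1.
Qed.

Lemma is_Cderive_fsum c x l : decay 1 c ->
  is_Cderive (fsum c) x (delta_mx l 0) (fsum (Dcoef l c) x).
Proof.
move=> dc; have d0 := decay_weak (leq0n 1) dc.
have [B cB DB] := decay_Dcoef l dc.
apply: (@is_Cderive_series R _ (fun n y => c n * expi (phase (kk n) y))
  (fun n y => Dcoef l c n * expi (phase (kk n) y)) B 1 x (delta_mx l 0) ltr01 cB).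
- by move=> n s _; exact: is_Cderive_wave.
- by move=> n s _; have := DB n; rewrite expr0 mul1r normcM normc_expi mulr1.
- by move=> s _; exact: decay_summable.
Qed.

Lemma pd_fsum l c : decay 1 c -> pd l (fsum c) = fsum (Dcoef l c).
Proof.
by move=> dc; apply/funext => x; have [] := is_CderiveP (is_Cderive_fsum x l dc).
Qed.

Lemma fsum_partially_diff m c : decay m c -> partially_diff m (fsum c).
Proof.
elim: m c => [//|m IH] c dc j; have dc1 : decay 1 c by exact: decay_weak dc.
split; first by move=> x; have [] := is_CderiveP (is_Cderive_fsum x j dc1).
by rewrite pd_fsum //; apply: IH; exact: decay_Dcoef.
Qed.

Lemma fsumD c d : decay 0 c -> decay 0 d ->
  fsum (fun n => c n + d n) = (fun x => fsum c x + fsum d x).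
Proof.
move=> dc dd; apply/funext => x; rewrite /fsum -CseriesD; [|exact: decay_summable..].
by congr Cseries; apply/funext => n; rewrite mulrDl.
Qed.

Lemma eq_fsum c d x : (forall n, c n = d n) -> fsum c x = fsum d x.
Proof. by move=> cd; congr (fsum _ x); apply/funext. Qed.

Lemma fsumZ a c x : decay 0 c -> fsum (fun n => a * c n) x = a * fsum c x.
Proof.
move=> dc; rewrite /fsum -CseriesZ; last exact: decay_summable.
by congr Cseries; apply/funext => n; rewrite mulrA.
Qed.

Lemma fsum_sum (c : 'I_3 -> nat -> C) : (forall j, decay 0 (c j)) ->
  fsum (fun n => \sum_(j < 3) c j n) = (fun x => \sum_(j < 3) fsum (c j) x).
Proof.
move=> dc.
have -> : (fun n => \sum_(j < 3) c j n) = (fun n => c ord0 n +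
    (c (lift ord0 ord0) n + c (lift ord0 (lift ord0 ord0)) n)).
  by apply/funext => n; rewrite !big_ord_recl big_ord0 addr0.
rewrite !fsumD //; last exact: decayD.
by apply/funext => x; rewrite !big_ord_recl big_ord0 addr0.
Qed.

Lemma divg_fsum (c : 'I_3 -> nat -> C) : (forall j, decay 1 (c j)) ->
  divg (fun j => fsum (c j)) = fsum (fun n => \sum_(j < 3) Dcoef j (c j) n).
Proof.
move=> dc; rewrite fsum_sum; last by move=> j; exact: decay_Dcoef.
by apply/funext => x; apply: eq_bigr => j _; rewrite pd_fsum.
Qed.

Lemma lapl_fsum c : decay 2 c ->
  lapl (fsum c) = fsum (fun n => - (enorm (kk n) ^+ 2)%:C * c n).
Proof.
move=> dc; have dc1 : decay 1 c by exact: decay_weak dc.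
have -> : lapl (fsum c) = divg (fun j => fsum (Dcoef j c)).
  by apply/funext => x; apply: eq_bigr => j _; rewrite pd_fsum.
rewrite divg_fsum; last by move=> j; exact: decay_Dcoef.
congr fsum; apply/funext => n; rewrite enorm_sqr rmorph_sum /= -sumrN mulr_suml.
apply: eq_bigr => j _; rewrite /Dcoef rmorphXn /=.
have := sqr_i R; move: ('i%C : C) => z zz.
by rewrite -[X in - X]mul1r -mulNr -zz; ring.
Qed.

End FourierSums.

(** * Fluid equations in Fourier variables *)

Section FluidFields.
Variable R : realType.
Local Notation C := R[i].

(** The three truncated generators at once: $(\nu,\kappa)$ is $(0,0)$, $(\tau,0)$ and
    $(\tau,\tau^2)$ for the Euler, Navier-Stokes and Burnett equations. *)
Definition fluid_mx (nu kappa k : R) : 'M[C]_5 :=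
  let ik := 'i%C * k%:C in
  let nk2 := nu * k ^+ 2 in
  let ik3 := 'i%C * (kappa * k ^+ 3)%:C in
  mx_of_rows
   [:: [:: 0;     - ik;                 0;          0;          0];
       [:: - ik - (4 / 3)%:C * ik3;
                  - (4 / 3 * nk2)%:C;   0;          0;          - ik];
       [:: 0;     0;                    - nk2%:C;   0;          0];
       [:: 0;     0;                    0;          - nk2%:C;   0];
       [:: 0;     - ((2 / 3)%:C * ik) - (2 / 9)%:C * ik3;
                                        0;          0;
           - (5 / 3 * nk2)%:C]].

(** The equations in physical space with generator [fluid_mx]. *)
Definition fluid_pde (nu kappa : R) : pde_type R := fun rho u T t x =>
  [/\ dt rho t x = - divg (fun j => u j t) x,
      forall j, dt (u j) t x =
        - pd j (fun y => rho t y + T t y) x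
        + (4 / 3 * kappa)%:C * pd j (lapl (rho t)) x
        + nu%:C * lapl (u j t) x
        + (nu / 3)%:C * pd j (divg (fun i => u i t)) x &
      dt T t x = - ((2 / 3)%:C * divg (fun j => u j t) x)
        + (2 / 9 * kappa)%:C * lapl (divg (fun j => u j t)) x
        + (5 / 3 * nu)%:C * lapl (T t) x].

Lemma fluid_mx_euler : @euler_mx R = fluid_mx 0 0.
Proof.
apply/funext => k; apply/matrixP => i j; rewrite !mxE.
case: i => -[|[|[|[|[|//]]]]] p; case: j => -[|[|[|[|[|//]]]]] q //=;
  by rewrite ?(mul0r, mulr0, oppr0, subr0, addr0).
Qed.

Lemma fluid_mx_navier_stokes tau : navier_stokes_mx tau = fluid_mx tau 0.
Proof.
apply/funext => k; apply/matrixP => i j; rewrite !mxE.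
case: i => -[|[|[|[|[|//]]]]] p; case: j => -[|[|[|[|[|//]]]]] q //=;
  by rewrite ?(mul0r, mulr0, oppr0, subr0, addr0).
Qed.

Lemma fluid_mx_burnett tau : burnett_mx tau = fluid_mx tau (tau ^+ 2).
Proof. by []. Qed.

(** The Fourier symbol of the divergence of the velocity, up to a factor $\mathrm i$. *)
Definition wave_dot (q : 'cV[R]_3) (b : 'cV[C]_5) : C :=
  \sum_(l < 3) (q l 0)%:C * b (i_u l) 0.

(** The longitudinal velocity is damped by $4\nu/3$ and the transverse ones by $\nu$; the
    excess $\nu/3$ is written as a separate term. *)
Lemma fluid_mx_blocks (nu kappa k : R) (b : 'cV[C]_5) :
  let T := fluid_mx nu kappa k in
  let ik := 'i%C * k%:C in
  [/\ (T *m b) i_rho 0 = - ik * b (i_u 0) 0,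
      (forall m, (T *m b) (i_u m) 0 = - (nu * k ^+ 2)%:C * b (i_u m) 0 +
         (m == 0)%:R * (- ik * (b i_rho 0 + b i_T 0)
            - (4 / 3)%:C * ('i%C * (kappa * k ^+ 3)%:C) * b i_rho 0
            - (nu / 3 * k ^+ 2)%:C * b (i_u 0) 0)) &
      (T *m b) i_T 0 = (- ((2 / 3)%:C * ik)
          - (2 / 9)%:C * ('i%C * (kappa * k ^+ 3)%:C)) * b (i_u 0) 0
        - (5 / 3 * (nu * k ^+ 2))%:C * b i_T 0].
Proof.
move=> T ik; have -> : (0 : 'I_3) = ord0 by exact: val_inj.
split.
- rewrite mxE sum_blocks !big_ord_recl big_ord0 !mxE /=; rewrite -/ik.
  by rewrite !mul0r !addr0 add0r.
- move=> m; rewrite mxE sum_blocks !big_ord_recl big_ord0 !mxE.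
  case: m => -[|[|[|//]]] p; rewrite /=.
  + rewrite (_ : Ordinal p = ord0); last exact: val_inj.
    rewrite !(realC_nat, rmorphXn, fmorphV, rmorphN, rmorphM) /= -/ik.
    by field.
  + rewrite (_ : lift ord0 ord0 = Ordinal p); last exact: val_inj.
    by rewrite !(mul0r, addr0, add0r).
  + rewrite (_ : lift ord0 (lift ord0 ord0) = Ordinal p); last exact: val_inj.
    by rewrite !(mul0r, addr0, add0r).
- rewrite mxE sum_blocks !big_ord_recl big_ord0 !mxE /= -/ik.
  by rewrite !(mul0r, addr0, add0r) mulNr.
Qed.

(** The rotation sends $|q|e_1$ to $q$, so $|q|$ times the longitudinal velocity is
    $q\cdot u$. The isotropic damping commutes with the rotation, and each longitudinal
    term becomes a gradient or a divergence. *)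
Lemma fluid_mx_rotated (Q : 'cV[R]_3 -> 'M[R]_3) (nu kappa : R) (q : 'cV[R]_3)
    (a : 'cV[C]_5) : wave_rotation Q ->
  let M := Qtilde (Q q) *m fluid_mx nu kappa (enorm q) *m (Qtilde (Q q))^T in
  let k2 := (enorm q ^+ 2)%:C in
  [/\ (M *m a) i_rho 0 = - ('i%C * wave_dot q a),
      (forall j, (M *m a) (i_u j) 0 =
         - ('i%C * (q j 0)%:C * (a i_rho 0 + a i_T 0))
         + (4 / 3 * kappa)%:C * ('i%C * (q j 0)%:C * (- k2 * a i_rho 0))
         + nu%:C * (- k2 * a (i_u j) 0)
         + (nu / 3)%:C * ('i%C * (q j 0)%:C * ('i%C * wave_dot q a))) &
      (M *m a) i_T 0 = - ((2 / 3)%:C * ('i%C * wave_dot q a))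
         + (2 / 9 * kappa)%:C * (- k2 * ('i%C * wave_dot q a))
         + (5 / 3 * nu)%:C * (- k2 * a i_T 0)].
Proof.
move=> HQ M k2; have [[QQ _] Qe] := HQ q.
pose b := (Qtilde (Q q))^T *m a.
have bE : b = Qtilde (Q q)^T *m a.
  have QT : (Qreal (Q q))^T = Qreal (Q q)^T.
    by rewrite /Qreal !tr_block_mx !trmx0 !trmx1.
  have := congr1 (map_mx (real_complex R)) QT.
  by rewrite -map_trmx -!QtildeE /b => ->.
have brho : b i_rho 0 = a i_rho 0 by rewrite bE Qtilde_rho.
have bT : b i_T 0 = a i_T 0 by rewrite bE Qtilde_T.
have bu m : b (i_u m) 0 = \sum_(l < 3) (Q q l m)%:C * a (i_u l) 0.
  by rewrite bE Qtilde_u; apply: eq_bigr => l _; rewrite mxE.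
have Qq l : Q q l 0 * enorm q = q l 0.
  rewrite -[in RHS]Qe -scalemxAr -[in RHS]colE mulrC.
  by rewrite !mxE.
have kb : (enorm q)%:C * b (i_u 0) 0 = wave_dot q a.
  rewrite bu mulr_sumr; apply: eq_bigr => l _.
  by rewrite -Qq rmorphM /=; ring.
have Qb j : \sum_(m < 3) (Q q j m)%:C * b (i_u m) 0 = a (i_u j) 0.
  have : (Qtilde (Q q) *m b) (i_u j) 0 = a (i_u j) 0.
    by rewrite /b mulmxA Qtilde_orth // mul1mx.
  by rewrite Qtilde_u.
have MaE : M *m a = Qtilde (Q q) *m (fluid_mx nu kappa (enorm q) *m b).
  by rewrite /M /b !mulmxA.
have [Erho Eu ET] := fluid_mx_blocks nu kappa (enorm q) b.
split.
- by rewrite MaE Qtilde_rho Erho -kb; ring.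
- move=> j; rewrite MaE Qtilde_u.
  under eq_bigr do rewrite Eu mulrDr.
  rewrite big_split /= [X in _ + X](bigD1 0) //= [X in _ + (_ + X)]big1; last first.
    by move=> m m0; rewrite (negbTE m0) mul0r mulr0.
  rewrite -[in - (k2) * a (i_u j) 0](Qb j) brho bT -kb -Qq /k2.
  rewrite (eq_bigr (fun m => - (nu * enorm q ^+ 2)%:C * ((Q q j m)%:C * b (i_u m) 0))); last first.
    by move=> m _; ring.
  rewrite -mulr_sumr; move: (\sum_(m < 3) _) => s.
  rewrite !(realC_nat, rmorphXn, fmorphV, rmorphN, rmorphM) /=.
  have := sqr_i R; move: ('i%C : C) => z zz.
  rewrite (_ : forall x y w v, x * (z * y * (z * (w * v))) = - (x * y * w * v)); last first.
    by move=> x y w v; rewrite -[in RHS]mulN1r -zz; ring.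
  by field.
- rewrite MaE Qtilde_T ET bT -kb /k2.
  rewrite !(realC_nat, rmorphXn, fmorphV, rmorphN, rmorphM) /=.
  by field.
Qed.

End FluidFields.

(** * Fluid equations in physical space *)

Section PhysicalForms.
Variable R : realType.
Local Notation C := R[i].

Lemma is_CderiveZ (V : normedModType R) (c : C) (f : V -> C) (a v : V) (d : C) :
  is_Cderive f a v d -> is_Cderive (fun x => f x * c) a v (d * c).
Proof.
case: c d => p q [d1 d2] [Dr Di]; split => /=.
- have -> : (fun x => cRe (f x * (p +i* q))) = (fun x => cRe (f x) * p - cIm (f x) * q).
    by apply/funext => x; rewrite Re_mul.
  by apply: is_derive_eq; rewrite /GRing.scale /=; ring.
- have -> : (fun x => cIm (f x * (p +i* q))) = (fun x => cRe (f x) * q + cIm (f x) * p).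
    by apply/funext => x; rewrite Im_mul.
  by apply: is_derive_eq; rewrite /GRing.scale /=; ring.
Qed.

Lemma normc_sum (n : nat) (F : 'I_n -> C) : normc (\sum_(i < n) F i) <= \sum_(i < n) normc (F i).
Proof.
elim/big_ind2 : _ => // [|x a y b xa yb]; first by rewrite normc0.
exact: le_trans (normcD _ _) (lerD xa yb).
Qed.

Lemma normc_mulmx n p q (A : 'M[C]_(n, p)) (B : 'M[C]_(p, q)) (a b : R) i j :
  (forall l, normc (A i l) <= a) -> (forall l, normc (B l j) <= b) ->
  normc ((A *m B) i j) <= p%:R * (a * b).
Proof.
move=> Aa Bb; rewrite mxE (le_trans (normc_sum _)) //.
rewrite mulr_natl -[p in leRHS]card_ord -sumr_const; apply: ler_sum => l _.
by rewrite normcM; apply: ler_pM => //; exact: normc_ge0.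
Qed.

Lemma Qtilde_entry_le1 (Q : 'M[R]_3) (i j : 'I_5) : Q *m Q^T = 1%:M ->
  normc (Qtilde Q i j) <= 1.
Proof.
move=> /Qreal_orth/matrixP/(_ i i) E; rewrite !mxE eqxx /= in E.
rewrite Qtilde_entry normc_real -ler_sqr ?nnegrE ?ler01 // real_normK ?num_real //.
have sq l : Qreal Q i l * (Qreal Q)^T l i = Qreal Q i l ^+ 2 by rewrite [X in _ * X]mxE.
rewrite expr1n [leRHS](esym E) (bigD1 j) //= sq lerDl sumr_ge0 // => l _.
by rewrite sq sqr_ge0.
Qed.

Lemma poly_mx_growth (T : R -> 'M[C]_5) (P : 'M[{poly C}]_5) (m : nat) :
  (forall i j, (size (P i j) <= m.+1)%N) ->
  (forall (k : R) i j, T k i j = (P i j).[k%:C]) ->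
  exists K : R, forall k : R, 0 <= k -> forall i j, normc (T k i j) <= K * (1 + k) ^+ m.
Proof.
move=> sP TP; pose K (ij : 'I_5 * 'I_5) := \sum_(l < m.+1) normc (P ij.1 ij.2)`_l.
have K0 ij : 0 <= K ij by apply: sumr_ge0 => l _; exact: normc_ge0.
exists (\sum_ij K ij) => k k0 i j.
apply: (@le_trans _ _ (K (i, j) * (1 + k) ^+ m)); last first.
  apply: ler_wpM2r; first by rewrite exprn_ge0 // addr_ge0.
  by rewrite (bigD1 (i, j)) //= lerDl sumr_ge0.
rewrite TP (horner_coef_wide _ (sP i j)) (le_trans (normc_sum _)) // mulr_suml.
apply: ler_sum => l _; rewrite normcM normcX normc_real ger0_norm //.
apply: ler_wpM2l; first exact: normc_ge0.
apply: (@le_trans _ _ ((1 + k) ^+ l)).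
  by apply: lerXn2r; rewrite ?nnegrE ?addr_ge0 // lerDr.
by apply: ler_weXn2l; rewrite ?lerDl // -ltnS.
Qed.

(** Three products of matrices of size 5, with entries of the rotations at most 1, cost the
    factor $5^3$; the growth of [T] is compensated by the decay of the amplitudes. *)
Lemma rotated_growth (Q : 'cV[R]_3 -> 'M[R]_3) (T : R -> 'M[C]_5) (m : nat) (K : R) :
  wave_rotation Q ->
  (forall k : R, 0 <= k -> forall i j, normc (T k i j) <= K * (1 + k) ^+ m) ->
  forall q (a : 'cV[C]_5) (b : R),
    (forall j, (1 + enorm q) ^+ m * normc (a j 0) <= b) ->
    forall j, normc ((Qtilde (Q q) *m T (enorm q) *m (Qtilde (Q q))^T *m a) j 0)
      <= 125%:R * K * b.
Proof.
move=> HQ TK q a b ab j; have [[QQ _] _] := HQ q.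
set w := (1 + enorm q) ^+ m.
have w0 : 0 < w by rewrite exprn_gt0 // ltr_pwDl // enorm_ge0.
have Q1 := fun i l => Qtilde_entry_le1 i l QQ.
have QT1 i l : normc ((Qtilde (Q q))^T i l) <= 1 by rewrite mxE.
have aw l : normc (a l 0) <= w^-1 * b by rewrite ler_pdivlMl.
have s1 i : normc (((Qtilde (Q q))^T *m a) i 0) <= 5%:R * (1 * (w^-1 * b)).
  exact: normc_mulmx.
have s2 i : normc ((T (enorm q) *m ((Qtilde (Q q))^T *m a)) i 0) <=
    5%:R * (K * w * (5%:R * (1 * (w^-1 * b)))).
  by apply: normc_mulmx => // l; apply: TK; exact: enorm_ge0.
have s3 := normc_mulmx (Q1 j) s2.
rewrite -!mulmxA (le_trans s3) // le_eqVlt; apply/orP; left; apply/eqP.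
by field; rewrite lt0r_neq0.
Qed.

(** The equation for the amplitudes bounds their time derivatives by the series that
    dominates the amplitudes, uniformly near [t]. *)
Lemma is_Cderive_time (I : set R) (A : nat -> 'M[C]_5) (a : nat -> R -> 'cV[C]_5)
    (kk : nat -> 'cV[R]_3) (m : nat) (K : R) :
  open I -> (forall n, solves I (A n) (a n)) -> normal_cvg I m kk a ->
  (forall n (v : 'cV[C]_5) (b : R),
     (forall j, (1 + enorm (kk n)) ^+ m * normc (v j 0) <= b) ->
     forall j, normc ((A n *m v) j 0) <= K * b) ->
  forall t j x, I t ->
  is_Cderive (fun s : R => fourier_sum kk a j s x) t 1
    (fsum kk (fun n => (A n *m a n t) j 0) x).
Proof.
move=> oI sol nc AK t j x It; have [B cB nB] := nc t It.
have [e e0 eB] : exists2 e : R, 0 < e & forall s, `|s| < e -> I (s *: (1 : R) + t) /\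
    forall n i, (1 + enorm (kk n)) ^+ m * normc (a n (s *: (1 : R) + t) i 0) <= B n.
  have nI : \forall s \near t, I s by apply: open_nbhs_nbhs; split.
  have [e /= e0 be] := (nbhs_ballP _ _).1 (filterI nI nB).
  exists e => // s se; apply: be; rewrite /ball /= opprD addrCA subrr addr0 normrN.
  by rewrite /GRing.scale /= mulr1.
have cKB : cvgn (series (fun n => K * B n)).
  have -> : series (fun n => K * B n) = (fun n => K * series B n).
    by apply/funext => n; rewrite /series /= mulr_sumr.
  exact: is_cvgMr.
apply: (@is_Cderive_series R _ (fun n (s : R) => a n s j 0 * expi (phase (kk n) x))
  (fun n s => (A n *m a n s) j 0 * expi (phase (kk n) x)) (fun n => K * B n) e t 1 e0 cKB).
- move=> n s /eB[Is _]; apply: is_CderiveZ.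
  have [[D1 D2] E] := sol n _ Is j.
  by rewrite -E; split; apply: DeriveDef.
- move=> n s /eB[_ sB]; rewrite normcM normc_expi mulr1.
  by apply: AK => i; exact: sB.
- move=> s /eB[_ sB]; exists B => // n; rewrite normcM normc_expi mulr1.
  apply: le_trans (sB n j); rewrite -[leLHS]mul1r; apply: ler_wpM2r; first exact: normc_ge0.
  by rewrite exprn_ege1 // lerDl enorm_ge0.
Qed.

(** Both sides of each equation are Fourier sums whose coefficients agree by
    [fluid_mx_rotated]. The amplitudes decay fast enough for the derivatives in a term to
    be taken term by term, except possibly when the factor [nu] or [kappa] of the term is
    zero; [scaled] treats both cases. *)
Lemma physical_fluid (Q : 'cV[R]_3 -> 'M[R]_3) (nu kappa : R) (m : nat) (K : R) :
  wave_rotation Q -> (0 < m)%N -> (nu != 0 -> (1 < m)%N) -> (kappa != 0 -> (2 < m)%N) ->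
  (forall k : R, 0 <= k -> forall i j,
     normc (fluid_mx nu kappa k i j) <= K * (1 + k) ^+ m) ->
  physical_form Q (fluid_mx nu kappa) m (fluid_pde nu kappa).
Proof.
move=> HQ m0 mnu mkappa TK I kk a oI sol nc F t It.
pose c j n := a n t j 0.
have FE j : F j t = fsum kk (c j) by [].
have dc j : decay kk m (c j).
  have [B cB /nbhs_singleton tB] := nc t It.
  by exists B => // n; rewrite normcM normc_weight; exact: tB.
have d1 j : decay kk 1 (c j) by exact: decay_weak (dc j).
have d0 j : decay kk 0 (c j) by exact: decay_weak (dc j).
have DF x j := is_Cderive_time oI sol nc
  (fun n v b vb => rotated_growth HQ TK vb) j x It.
split; first by move=> j; rewrite FE; exact: fsum_partially_diff.
move=> x; split; first by move=> j; have [] := is_CderiveP (DF x j).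
have dtF j : dt (F j) t x = fsum kk (fun n =>
    (Qtilde (Q (kk n)) *m fluid_mx nu kappa (enorm (kk n)) *m (Qtilde (Q (kk n)))^T
     *m a n t) j 0) x.
  by have [] := is_CderiveP (DF x j).
have zsum y : fsum kk (fun=> 0) y = 0.
  have -> : (fun=> 0) = (fun n : nat => 0 * c i_rho n) by apply/funext => n; rewrite mul0r.
  by rewrite fsumZ // mul0r.
pose div n := \sum_(j < 3) Dcoef kk j (c (i_u j)) n.
have divE : divg (fun j => F (i_u j) t) = fsum kk div.
  exact: (divg_fsum (fun j => d1 (i_u j))).
have d0div : decay kk 0 div.
  by apply: decay_sum => j; apply: decay_Dcoef; exact: d1.
have div_symbol n : div n = 'i%C * wave_dot (kk n) (a n t).
  by rewrite /wave_dot mulr_sumr; apply: eq_bigr => l _; rewrite /Dcoef mulrA.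
have scaled (r : R) (g : 'cV[R]_3 -> C) (d : nat -> C) :
    (r != 0 -> decay kk 0 d /\ g x = fsum kk d x) ->
    decay kk 0 (fun n => r%:C * d n) /\
    r%:C * g x = fsum kk (fun n => r%:C * d n) x.
  have [-> _|r0 /(_ isT)[dd gE]] := eqVneq r 0; last first.
    by split; [exact: decayZ|rewrite fsumZ // gE].
  have -> : (fun n => 0%:C * d n) = (fun=> 0 : C) by apply/funext => n; rewrite mul0r.
  rewrite mul0r zsum; split=> //.
  have -> : (fun=> 0) = (fun n : nat => 0 * c i_rho n) by apply/funext => n; rewrite mul0r.
  exact: decayZ.
have dlapl m' d : decay kk m'.+2 d ->
    decay kk m' (fun n => - (enorm (kk n) ^+ 2)%:C * d n).
  apply: (Csummable_le (K := 1)) => n; rewrite mul1r !normcM !normc_weight normcN.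
  rewrite normc_real ger0_norm ?sqr_ge0 // mulrA -(addn2 m') exprD.
  apply: ler_wpM2r; first exact: normc_ge0.
  apply: ler_wpM2l; first by rewrite exprn_ge0 // addr_ge0 // enorm_ge0.
  by apply: lerXn2r; rewrite ?nnegrE ?addr_ge0 ?enorm_ge0 // lerDr.
have cnz (p q : R) : p * q != 0 -> q != 0.
  by apply: contra => /eqP->; rewrite mulr0.
split.
- rewrite dtF divE -mulN1r -fsumZ //; apply: eq_fsum => n.
  have [-> _ _] := fluid_mx_rotated nu kappa (kk n) (a n t) HQ.
  by rewrite div_symbol mulN1r.
- move=> j; rewrite dtF.
  have dP : decay kk 1 (fun n => c i_rho n + c i_T n) by exact: decayD.
  have dP0 := decay_Dcoef j dP.
  have EP : - pd j (fun y => F i_rho t y + F i_T t y) x =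
      fsum kk (fun n => -1 * Dcoef kk j (fun n => c i_rho n + c i_T n) n) x.
    by rewrite fsumZ // mulN1r -pd_fsum // fsumD.
  have [|d2 E2] := scaled (4 / 3 * kappa) (pd j (lapl (F i_rho t)))
    (Dcoef kk j (fun n => - (enorm (kk n) ^+ 2)%:C * c i_rho n)).
    move=> /cnz/mkappa m3.
    have dl : decay kk 1 (fun n => - (enorm (kk n) ^+ 2)%:C * c i_rho n).
      by apply: dlapl; exact: decay_weak (dc _).
    split; first exact: decay_Dcoef.
    by rewrite FE lapl_fsum ?pd_fsum //; apply: decay_weak (dc _); exact: ltnW.
  have [|d3 E3] := scaled nu (lapl (F (i_u j) t))
    (fun n => - (enorm (kk n) ^+ 2)%:C * c (i_u j) n).
    move=> /mnu m2; have du2 : decay kk 2 (c (i_u j)) by exact: decay_weak (dc _).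
    by split; [exact: dlapl|rewrite FE lapl_fsum].
  have [|d4 E4] := scaled (nu / 3) (pd j (divg (fun i => F (i_u i) t))) (Dcoef kk j div).
    rewrite mulrC => /cnz/mnu m2.
    have dd : decay kk 1 div.
      by apply: decay_sum => i; apply: decay_Dcoef; exact: decay_weak (dc _).
    by split; [exact: decay_Dcoef|rewrite divE pd_fsum].
  have d1' := decayZ (-1) dP0.
  rewrite EP E2 E3 E4.
  transitivity (fsum kk (fun n =>
    -1 * Dcoef kk j (fun n => c i_rho n + c i_T n) n
    + (4 / 3 * kappa)%:C * Dcoef kk j (fun n => - (enorm (kk n) ^+ 2)%:C * c i_rho n) n
    + nu%:C * (- (enorm (kk n) ^+ 2)%:C * c (i_u j) n)
    + (nu / 3)%:C * Dcoef kk j div n) x).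
    apply: eq_fsum => n.
    have [_ -> _] := fluid_mx_rotated nu kappa (kk n) (a n t) HQ.
    by rewrite /Dcoef div_symbol mulN1r.
  rewrite fsumD //; last by do 2?apply: decayD.
  rewrite fsumD //; last exact: decayD.
  by rewrite fsumD.
- rewrite dtF.
  have EP : - ((2 / 3)%:C * divg (fun j => F (i_u j) t) x) =
      fsum kk (fun n => - (2 / 3)%:C * div n) x.
    by rewrite fsumZ // divE mulNr.
  have dP := decayZ (- (2 / 3)%:C) d0div.
  have [|d2 E2] := scaled (2 / 9 * kappa) (lapl (divg (fun j => F (i_u j) t)))
    (fun n => - (enorm (kk n) ^+ 2)%:C * div n).
    move=> /cnz/mkappa m3.
    have dd : decay kk 2 div.
      by apply: decay_sum => i; apply: decay_Dcoef; exact: decay_weak (dc _).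
    by split; [exact: dlapl|rewrite divE lapl_fsum].
  have [|d3 E3] := scaled (5 / 3 * nu) (lapl (F i_T t))
    (fun n => - (enorm (kk n) ^+ 2)%:C * c i_T n).
    move=> /cnz/mnu m2; have du2 : decay kk 2 (c i_T) by exact: decay_weak (dc _).
    by split; [exact: dlapl|rewrite FE lapl_fsum].
  rewrite EP E2 E3.
  transitivity (fsum kk (fun n => - (2 / 3)%:C * div n
    + (2 / 9 * kappa)%:C * (- (enorm (kk n) ^+ 2)%:C * div n)
    + (5 / 3 * nu)%:C * (- (enorm (kk n) ^+ 2)%:C * c i_T n)) x).
    apply: eq_fsum => n.
    have [_ _ ->] := fluid_mx_rotated nu kappa (kk n) (a n t) HQ.
    by rewrite div_symbol -[in X in X + _ + _ = _]mulNr.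
  rewrite fsumD //; last exact: decayD.
  by rewrite fsumD.
Qed.

End PhysicalForms.

(** * Expansion of the exact hydrodynamics and its truncations *)

Theorem mainTheorem4 (R : realType) (tau : R)
    (lam_diff lam_shear : R -> R) (lam_ac : R -> R[i])
    (Q : 'cV[R]_3 -> 'M[R]_3)
    (tau_gt0 : 0 < tau)
    (Hspec : spectrum_spec tau lam_diff lam_shear lam_ac)
    (Hexp : lam_expansions tau lam_diff lam_shear lam_ac)
    (HQ : wave_rotation Q)
    (Hbasis : spectral_basis_spec tau lam_diff lam_shear lam_ac Q) :
  (exists C1 C2 C3 C4 C5 C6 : R -> R[i],
     (forall kk : 'cV[R]_3, admissible tau kk ->
        let k := enorm kk in
        exact_gen tau lam_diff lam_shear lam_ac Q kk =
        Qtilde (Q kk)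
        *m hydro_mx k (C1 k) (C2 k) (C3 k) (C4 k) (C5 k) (C6 k)
             (lam_shear k)%:C
        *m (Qtilde (Q kk))^T) /\
     coef_expansions tau C1 C2 C3 C4 C5 C6) /\
  (forall (kk : 'cV[R]_3) (I : set R) (w : R -> 'cV[R[i]]_5),
     admissible tau kk ->
     solves I (exact_gen tau lam_diff lam_shear lam_ac Q kk)
       (fun t => Dmacro R *m w t) <->
     solves I (macro_gen tau lam_diff lam_shear lam_ac Q kk) w) /\
  let G := macro_gen tau lam_diff lam_shear lam_ac Q in
  [/\ truncation Q 1 G (@euler_mx R) /\
      physical_form Q (@euler_mx R) 1 (@euler_pde R),
      truncation Q 2 G (navier_stokes_mx tau) /\
      physical_form Q (navier_stokes_mx tau) 2 (navier_stokes_pde tau) &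
      truncation Q 3 G (burnett_mx tau) /\
      physical_form Q (burnett_mx tau) 3 (burnett_pde tau)].
Proof.
have [tr1 tr2 tr3] := truncations tau_gt0 Hspec Hexp HQ Hbasis.
have fluid nu kappa n G : (0 < n)%N -> (nu != 0 -> (1 < n)%N) -> (kappa != 0 -> (2 < n)%N) ->
    truncation Q n G (fluid_mx nu kappa) ->
    physical_form Q (fluid_mx nu kappa) n (fluid_pde nu kappa).
  move=> n0 n1 n2 [[P sP TP] _]; have [K HK] := poly_mx_growth sP TP.
  exact: (physical_fluid HQ n0 n1 n2 HK).
split; last split; last split.
- pose c i j := coef tau lam_diff lam_shear lam_ac i j.
  exists (c 1 0)%N, (c 1 1)%N, (c 1 4)%N, (c 4 0)%N, (c 4 1)%N, (c 4 4)%N; split.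
    move=> kk adm /=; rewrite -(exact_block_hydro HQ Hbasis adm).
    by have [_ ->] := exact_gen_block HQ Hbasis adm.
  exact: (coefs_expansion tau_gt0 Hspec Hexp HQ Hbasis).
- by move=> kk I w _; exact: solves_macro.
- split=> // I kk a oI sol nc F t It.
  rewrite fluid_mx_euler in tr1 sol.
  have [pF DF] := fluid 0 0 1 _ isT (fun n0 => False_ind _ (negP n0 (eqxx 0)))
    (fun n0 => False_ind _ (negP n0 (eqxx 0))) tr1 I kk a oI sol nc t It.
  split=> // x; have [cF [Er Eu ET]] := DF x; split=> //; split=> // [j|].
    by rewrite Eu !mulr0 ?mul0r !addr0.
  by rewrite ET !mulr0 !mul0r !addr0.
- split=> // I kk a oI sol nc F t It.
  rewrite fluid_mx_navier_stokes in tr2 sol.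
  have [pF DF] := fluid tau 0 2 _ isT (fun=> isT)
    (fun n0 => False_ind _ (negP n0 (eqxx 0))) tr2 I kk a oI sol nc t It.
  split=> // x; have [cF [Er Eu ET]] := DF x; split=> //; split=> // [j|].
    by rewrite Eu mulr0 mul0r addr0.
  by rewrite ET mulr0 mul0r addr0 mulrC.
- by split=> //; rewrite fluid_mx_burnett in tr3 *; exact: (fluid _ _ 3 _ isT _ _ tr3).
Qed.
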